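(* Let $m\in\mathbb Z^+$, $\gamma\in\Delta_m$, $W_0\in\mathcal B^{\gamma,*}$. Let $H$ be a finite $d$-regular graph, let $\tau=t(H,\cdot)$, and write $t_{\max}=t^\tau_{\max}(\tilde{\mathcal W}_\Omega)$. If $t(H,W_0)<t_{\max}$, then there exists $\eta>0$ such that every $t\in((1-\eta)t_{\max},t_{\max}]$ is in the symmetric regime for $W_0$ and $t(H,\cdot)$. In addition, for such $t$, every minimizer $\tilde h$ of $\min\{J_{W_0}(\tilde f):\tilde f\in\tilde{\mathcal W},\ t(H,\tilde f)\ge t\}$ has a representative $h\in\mathcal B^\gamma$ with $$J_{W_0}(\tilde h)=I_{W_0}(h)=\min\{I_{W_0}(g):g\in\mathcal B^\gamma,\ t(H,g)\ge t\}.$$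
   Context: A graphon is a measurable symmetric function $f:[0,1]^2\to[0,1]$; $\mathcal W$ is the set of graphons. $d_\square(f,g)=\sup_{S,T\subseteq[0,1]}\left|\int_{S\times T}(f-g)\right|$ over measurable $S,T$; $\delta_\square(f,g)=\inf_{\phi}d_\square(f,g^\phi)$ over bijective Lebesgue-measure-preserving $\phi:[0,1]\to[0,1]$, where $g^\phi(x,y)=g(\phi(x),\phi(y))$. $\tilde f$ is the class of $f$ under $f\sim g\iff\delta_\square(f,g)=0$, and $\tilde{\mathcal W}=\mathcal W/\!\sim$ with metric $\delta_\square$ (a compact metric space). For a finite simple graph $H$ on $v$ vertices, $t(H,f)=\int_{[0,1]^v}\prod_{(i,j)\in E(H)}f(x_i,x_j)\,dx_1\cdots dx_v$; it is well defined and continuous on $\tilde{\mathcal W}$. $\Delta_m=\{\gamma\in[0,1]^m\cap\mathbb Q^m:\sum_i\gamma_i=1\}$. For $\gamma\in\Delta_m$ let $I_1=[0,\gamma_1]$, $I_j=(\sum_{k<j}\gamma_k,\sum_{k\le j}\gamma_k]$ for $j\ge 2$. $\mathcal B^\gamma$ is the set of graphons that are constant, equal to some $p_{ij}=p_{ji}\in[0,1]$, on each $I_i\times I_j$. $\mathcal B^{\gamma,*}$ is the set of $f\in\mathcal B^\gamma$ with $f\notin\mathcal B^\eta$ for all $\eta\in\Delta_{m-1}$. $\tilde{\mathcal B}^\gamma$ is the set of $\tilde f\in\tilde{\mathcal W}$ with $\delta_\square(\tilde f,g)=0$ for some $g\in\mathcal B^\gamma$. $h_p(u)=u\log\frac up+(1-u)\log\frac{1-u}{1-p}$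 (with $0\log0=0$, $0\log(0/0)=0$, value $+\infty$ if $p\in\{0,1\}$, $u\ne p$); $I_{W_0}(f)=\frac12\int_{[0,1]^2}h_{W_0(x,y)}(f(x,y))\,dx\,dy$; $\Omega=\{W_0\in(0,1)\}$; $\mathcal W_\Omega$ is the set of graphons equal to $W_0$ a.e. on $\Omega^c$; $\tilde{\mathcal W}_\Omega$ is the set of classes $\tilde f$ with $\delta_\square(\tilde f,g)=0$ for some $g\in\mathcal W_\Omega$. $J_{W_0}(\tilde f)=\sup_{\eta>0}\inf\{I_{W_0}(h):h\in\mathcal W,\delta_\square(\tilde f,h)\le\eta\}$ if $\tilde f\in\tilde{\mathcal W}_\Omega$ and $\infty$ otherwise. $t^\tau_{\max}(\tilde{\mathcal W}_\Omega)=\max_{\tilde f\in\tilde{\mathcal W}_\Omega}\tau(\tilde f)$. Symmetric regime: for $W_0\in\mathcal B^{\gamma,*}$ and a continuous graph parameter $\tau$, a value $t\le t^\tau_{\max}(\tilde{\mathcal W}_\Omega)$ is in the symmetric regime for $W_0$ and $\tau$ if all minimizers $\tilde g$ of $\min\{J_{W_0}(\tilde f):\tilde f\in\tilde{\mathcal W},\tau(\tilde f)\ge t\}$ satisfy $\tilde g\in\tilde{\mathcal B}^\gamma$. *)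

(* Defs.v *)
From HB Require Import structures.
From mathcomp Require Import all_boot all_order all_algebra.
From mathcomp Require Import all_classical all_reals all_analysis.
From mathcomp Require Import measurable_realfun generic_quotient lra.

Set Implicit Arguments.
Unset Strict Implicit.
Unset Printing Implicit Defensive.

Import Order.TTheory GRing.Theory Num.Theory.
Import numFieldNormedType.Exports.

Local Open Scope classical_set_scope.
Local Open Scope ring_scope.

(* Lebesgue measure on R^n, n-tuples carrying the product sigma-algebra:
   on R^(n+1) it is the image of the product of Lebesgue measure on R and
   Lebesgue measure on R^n under (x, y) |-> x :: y.                        *)
Section lebesgue_tuple.
Variable R : realType.
Local Notation T := (measurableTypeR R).
Local Notation mu := (@lebesgue_measure R).

Section step.
Variables (n : nat) (nu : {sigma_finite_measure set (n.-tuple T) -> \bar R}).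

Definition tuple_cons (z : T * n.-tuple T) : n.+1.-tuple T :=
  [the n.+1.-tuple T of z.1 :: z.2].

Let mcons : measurable_fun [set: T * n.-tuple T] tuple_cons.
Proof. exact: measurable_cons. Qed.
#[local] Hint Resolve mcons : core.

Definition lebesgue_tupleS : set (n.+1.-tuple T) -> \bar R :=
  pushforward (mu \x nu)%E tuple_cons.

Let l0 : lebesgue_tupleS set0 = 0%E. Proof. exact: measure0. Qed.
Let l_ge0 A : (0 <= lebesgue_tupleS A)%E. Proof. exact: measure_ge0. Qed.
Let l_sa : semi_sigma_additive lebesgue_tupleS.
Proof. exact: measure_semi_sigma_additive. Qed.
HB.instance Definition _ := isMeasure.Build _ _ _ lebesgue_tupleS l0 l_ge0 l_sa.

Let l_sf : sigma_finite setT lebesgue_tupleS.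
Proof.
have /sigma_finiteP[F [FT ndF Foo]] := sigma_finiteT mu.
have /sigma_finiteP[G [GT ndG Goo]] := sigma_finiteT nu.
have muncons : measurable_fun setT
    (fun x : n.+1.-tuple T => (thead x, [tuple of behead x]) : T * n.-tuple T).
  apply/measurable_fun_pairP; split.
    exact: measurable_tnth.
  exact: measurable_behead.
set uncons := fun x => _ in muncons.
exists (fun k => uncons @^-1` (F k `*` G k)).
  rewrite -preimage_bigcup (_ : \bigcup_k _ = setT) ?preimage_setT//.
  apply/seteqP; split=> // -[x y] _.
  have [k _ Fkx] : (\bigcup_k F k) x by rewrite -FT.
  have [l _ Gly] : (\bigcup_k G k) y by rewrite -GT.
  exists (maxn k l) => //; split.
    by move: x Fkx; exact/subsetPset/ndF/leq_maxl.
  by move: y Gly; exact/subsetPset/ndG/leq_maxr.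
move=> k; have [mF Fk] := Foo k; have [mG Gk] := Goo k; split.
  by rewrite -[X in measurable X]setTI; apply: muncons => //; exact: measurableX.
rewrite /lebesgue_tupleS /pushforward.
rewrite (_ : tuple_cons @^-1` _ = F k `*` G k).
  by rewrite product_measure1E// lte_mul_pinfty// ge0_fin_numE.
rewrite -comp_preimage (_ : uncons \o tuple_cons = id) ?preimage_id//.
apply/funext => -[x y]; rewrite /uncons /=; congr pair.
by apply/val_inj.
Qed.
HB.instance Definition _ :=
  Measure_isSigmaFinite.Build _ _ _ lebesgue_tupleS l_sf.
End step.

Fixpoint lebesgue_tuple (n : nat) :
    {sigma_finite_measure set (n.-tuple T) -> \bar R} :=
  if n is n'.+1 then lebesgue_tupleS (lebesgue_tuple n')
  else \d_([tuple] : 0.-tuple T).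
End lebesgue_tuple.

(* Measurability is Borel measurability.  A graphon is a function on R * R of
   which only the values on [0, 1]^2 matter.                               *)
Section graphon.
Variable R : realType.
Local Notation T := (measurableTypeR R).
Local Notation mu := (@lebesgue_measure R).
Local Notation mu2 := (mu \x mu)%E.

Definition unitI : set T := `[0, 1]%classic.
Definition unitI2 : set (T * T) := unitI `*` unitI.

Record graphon := Graphon {
  graphon_fun :> T * T -> R;
  graphon_measurable : measurable_fun unitI2 graphon_fun;
  graphon_itv : forall z, unitI2 z -> 0 <= graphon_fun z <= 1;
  graphon_sym : forall x y, unitI x -> unitI y ->
    graphon_fun (x, y) = graphon_fun (y, x) }.

Definition cut_dist (f g : T * T -> R) : R :=
  sup [set r | exists S U : set T,
    [/\ measurable S, S `<=` unitI, measurable U, U `<=` unitI &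
        r = `| \int[mu2]_(z in S `*` U) (f z - g z) |]].

(* Automorphisms of the measure space [0, 1]; measurability of the images (and
   hence of the inverse) is automatic for Borel bijections.               *)
Definition mp_bij (phi : T -> T) : Prop :=
  [/\ set_bij unitI unitI phi,
      forall A, A `<=` unitI -> measurable A ->
        measurable (unitI `&` phi @^-1` A) /\
        mu (unitI `&` phi @^-1` A) = mu A &
      forall A, A `<=` unitI -> measurable A -> measurable (phi @` A)].

Definition relabel (phi : T -> T) (g : T * T -> R) : T * T -> R :=
  fun z => g (phi z.1, phi z.2).

Definition delta (f g : graphon) : R :=
  inf [set cut_dist f (relabel phi g) | phi in mp_bij].

Let munitI : measurable unitI. Proof. exact: measurable_itv. Qed.
Let munitI2 : measurable unitI2. Proof. exact: measurableX. Qed.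

Let mu2_unitI2 : mu2 unitI2 = 1%E.
Proof.
have mu1 : mu unitI = 1%E.
  by rewrite /unitI lebesgue_measure_itv/= lte_fin ltr01 oppr0 adde0.
by rewrite product_measure1E//= mu1 mule1.
Qed.

Definition graphon_like (f : T * T -> R) :=
  measurable_fun unitI2 f /\ forall z, unitI2 z -> 0 <= f z <= 1.

Lemma graphon_b (f : graphon) : graphon_like f.
Proof. by split; [exact: graphon_measurable|exact: graphon_itv]. Qed.

Let subX S U : S `<=` unitI -> U `<=` unitI -> S `*` U `<=` unitI2.
Proof. by move=> SI UI z [? ?]; split; [exact: SI|exact: UI]. Qed.

Let mu2_lty D : measurable D -> D `<=` unitI2 -> (mu2 D <= 1)%E.
Proof.
move=> mD DI; rewrite -mu2_unitI2; apply: le_measure => //; rewrite inE//.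
Qed.

Let int_diff f g D : graphon_like f -> graphon_like g -> measurable D -> D `<=` unitI2 ->
  mu2.-integrable D (EFin \o (fun z => f z - g z)).
Proof.
move=> [mf f01] [mg g01] mD DI.
apply: (@measurable_bounded_integrable _ _ _ mu2) => //.
- by apply: le_lt_trans (mu2_lty mD DI) _; rewrite ltry.
- by apply: measurable_funB; apply: measurable_funS DI _.
- exists 1; split; first exact: num_real.
  move=> r r1 z /DI Dz; apply/ltW; apply: le_lt_trans r1.
  have /andP[? ?] := f01 z Dz; have /andP[? ?] := g01 z Dz.
  rewrite ler_norml; apply/andP; split; lra.
Qed.

Let int_diff_le1 f g D : graphon_like f -> graphon_like g -> measurable D ->
  D `<=` unitI2 -> `| \int[mu2]_(z in D) (f z - g z) | <= 1.
Proof.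
move=> bf bg mD DI.
apply: (le_trans (le_normr_Rintegral mD (int_diff bf bg mD DI))).
have mu2D : mu2 D \is a fin_num.
  rewrite ge0_fin_numE//; apply: le_lt_trans (mu2_lty mD DI) _; exact: ltry.
apply: (@le_trans _ _ (\int[mu2]_(z in D) cst 1 z)).
  apply: le_Rintegral => //.
  - exact/integrable_norm/int_diff.
  - apply: (@measurable_bounded_integrable _ _ _ mu2) => //.
      by rewrite -ge0_fin_numE.
    by exists 1; split; [exact: num_real|move=> r /ltW r1 z _; rewrite /= normr1].
  - move=> z /DI Dz.
    have /andP[? ?] := bf.2 z Dz; have /andP[? ?] := bg.2 z Dz.
    rewrite ler_norml; apply/andP; split; rewrite /cst; lra.
rewrite Rintegral_cst// mul1r -lee_fin fineK//; exact: mu2_lty.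
Qed.

Let ext (phi : T -> T) (x : T) : T := if x \in unitI then phi x else x.

Let mp_ext phi : mp_bij phi -> forall A, measurable A ->
  measurable (ext phi @^-1` A) /\ mu (ext phi @^-1` A) = mu A.
Proof.
move=> [[phiI _ _] phim _] A mA.
have mAI : measurable (A `&` unitI) by exact: measurableI.
have [m1 e1] := phim _ (@subIsetr _ A unitI) mAI.
have mAD : measurable (A `\` unitI) by exact: measurableD.
have -> : ext phi @^-1` A =
    (unitI `&` phi @^-1` (A `&` unitI)) `|` (A `\` unitI).
  apply/seteqP; split=> x; rewrite /ext /=.
    case: ifPn => [/set_mem Ix Ax|/negP nIx Ax]; [left|right]; split => //.
      by split => //; exact: phiI.
    by move=> Ix; apply: nIx; exact/mem_set.
  move=> [[Ix [Ax _]]|[Ax nIx]]; first by rewrite mem_set.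
  by rewrite memNset.
split; first exact: measurableU.
rewrite measureU//; last first.
  by apply/seteqP; split => // x [[Ix _] [_ /(_ Ix)]].
rewrite /= e1 -measureU//=; first by rewrite setUIDK.
by apply/seteqP; split => // x [[_ Ix] [_ /(_ Ix)]].
Qed.

Let ext2 (phi : T -> T) (z : T * T) : T * T := (ext phi z.1, ext phi z.2).

Let mext2 phi : mp_bij phi -> measurable_fun setT (ext2 phi).
Proof.
move=> mp; have mphi : measurable_fun setT (ext phi).
  by move=> _ A mA; rewrite setTI; exact: (mp_ext mp mA).1.
apply/measurable_fun_pairP; split.
  exact: (measurableT_comp mphi).
exact: (measurableT_comp mphi).
Qed.

Let mp_ext2 phi : mp_bij phi -> forall X, measurable X ->
  mu2 X = pushforward mu2 (ext2 phi) X.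
Proof.
move=> mp X mX; have mphi2 := mext2 mp.
pose m' := measure_function_pushforward__canonical__measure_function_Measure
  mu2 mphi2.
apply: (@product_measure_unique _ _ T T R mu mu m') => // A B mA mB.
rewrite /m' /= /pushforward.
have [mA' eA] := mp_ext mp mA; have [mB' eB] := mp_ext mp mB.
rewrite (_ : ext2 phi @^-1` _ = (ext phi @^-1` A) `*` (ext phi @^-1` B))//.
by rewrite product_measure1E//= eA eB.
Qed.

Let int_ext phi (F : T * T -> R) D : mp_bij phi -> measurable_fun unitI2 F ->
  (forall z, unitI2 z -> `|F z| <= 1) -> measurable D -> D `<=` unitI2 ->
  \int[mu2]_(z in D) F z =
  \int[mu2]_(z in ext2 phi @^-1` D) F (ext2 phi z).
Proof.
move=> mp mF F1 mD DI; have mphi2 := mext2 mp.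
pose m' := measure_function_pushforward__canonical__measure_function_Measure
  mu2 mphi2.
pose F' := F \_ unitI2.
have mF' : measurable_fun setT F' by apply/(measurable_restrictT F munitI2).
have F'E z : D z -> F z = F' z by move=> /DI Iz; rewrite /F' patchT// mem_set.
have mD' : measurable (ext2 phi @^-1` D).
  by rewrite -[X in measurable X]setTI; apply: (mext2 mp).
have mu2D' : mu2 (ext2 phi @^-1` D) = mu2 D.
  by rewrite [RHS](mp_ext2 mp mD).
transitivity (\int[m']_(z in D) F' z).
  rewrite (@eq_Rintegral _ _ _ mu2 D F'); last first.
    by move=> z /set_mem; exact: F'E.
  apply: (f_equal fine); apply: eq_measure_integral => A mA _.
  exact: mp_ext2.
transitivity (\int[mu2]_(z in ext2 phi @^-1` D) F' (ext2 phi z)); last first.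
  by apply: eq_Rintegral => z /set_mem Dz; rewrite F'E.
apply: (f_equal fine).
apply: (@integral_pushforward _ _ _ _ _ _ mphi2 mu2 D (EFin \o F')) => //.
  exact/measurable_EFinP.
apply: (@measurable_bounded_integrable _ _ _ mu2 (F' \o ext2 phi)) => //.
- rewrite [X in (X < _)%E](_ : _ = mu2 D)//.
  by apply: le_lt_trans (mu2_lty mD DI) _; rewrite ltry.
- by apply: measurable_funTS; exact: (measurableT_comp mF').
- exists 1; split; first exact: num_real.
  move=> r /ltW r1 z Dz /=; apply: le_trans r1.
  by rewrite -F'E//; apply: F1; exact: DI.
Qed.

Let cset (f g : T * T -> R) : set R := [set r | exists S U : set T,
    [/\ measurable S, S `<=` unitI, measurable U, U `<=` unitI &
        r = `| \int[mu2]_(z in S `*` U) (f z - g z) |]].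

Let cset0 f g : cset f g !=set0.
Proof.
by exists `| \int[mu2]_(z in set0 `*` set0) (f z - g z) |;
  exists set0, set0; split => //; exact: measurable0.
Qed.

Let cset_ub f g : graphon_like f -> graphon_like g -> has_ubound (cset f g).
Proof.
move=> bf bg; exists 1 => _ [S [U [mS SI mU UI ->]]].
by apply: int_diff_le1 => //; [exact: measurableX|exact: subX].
Qed.

Let cut_ge0 f g : graphon_like f -> graphon_like g -> 0 <= cut_dist f g.
Proof.
move=> bf bg; have [r rfg] := cset0 f g.
apply: le_trans (ub_le_sup (cset_ub bf bg) rfg).
by case: rfg => S [U [_ _ _ _ ->]].
Qed.

Let cut_refl f g : (forall z, unitI2 z -> f z = g z) -> cut_dist f g = 0.
Proof.
move=> fg; rewrite /cut_dist -[RHS](sup1 0); congr sup.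
have fg0 S U : S `<=` unitI -> U `<=` unitI ->
    `| \int[mu2]_(z in S `*` U) (f z - g z) | = 0.
  move=> SI UI; rewrite (_ : Rintegral _ _ _ = 0) ?normr0//.
  transitivity (\int[mu2]_(z in S `*` U) (0 : R)).
    apply: eq_Rintegral => z /set_mem zSU.
    by rewrite fg ?subrr//; exact: subX zSU.
  by rewrite /Rintegral integral0.
apply/seteqP; split=> r /=.
  by move=> [S [U [mS SI mU UI ->]]]; exact: fg0.
by move=> ->; exists set0, set0; split; rewrite ?fg0//; exact: measurable0.
Qed.

Let cut_sym f g : graphon_like f -> graphon_like g -> cut_dist f g = cut_dist g f.
Proof.
move=> bf bg; rewrite /cut_dist; congr sup.
suff H h k : graphon_like h -> graphon_like k -> cset h k `<=` cset k h.
  by apply/seteqP; split; exact: H.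
move=> bh bk _ [S [U [mS SI mU UI ->]]]; exists S, U; split => //.
rewrite -normrN; congr `| _ |.
have mSU : measurable (S `*` U) by exact: measurableX.
rewrite -mulN1r -RintegralZl//; last by apply: int_diff => //; exact: subX.
by apply: eq_Rintegral => z _; rewrite mulN1r opprB.
Qed.

Let cut_triangle f g h : graphon_like f -> graphon_like g -> graphon_like h ->
  cut_dist f h <= cut_dist f g + cut_dist g h.
Proof.
move=> bf bg bh; apply: ge_sup; first exact: cset0.
move=> _ [S [U [mS SI mU UI ->]]].
have mSU : measurable (S `*` U) by exact: measurableX.
have SUI := subX SI UI.
rewrite (_ : Rintegral _ _ _ = \int[mu2]_(z in S `*` U) (f z - g z) +
   \int[mu2]_(z in S `*` U) (g z - h z)); last first.
  rewrite -RintegralD//; [|exact: int_diff|exact: int_diff].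
  by apply: eq_Rintegral => z _; rewrite addrA subrK.
apply: le_trans (ler_normD _ _) _; apply: lerD.
  by apply: (ub_le_sup (cset_ub bf bg)); exists S, U.
by apply: (ub_le_sup (cset_ub bg bh)); exists S, U.
Qed.

Let relabel_b phi f : mp_bij phi -> graphon_like f -> graphon_like (relabel phi f).
Proof.
move=> mp [mf f01]; have [[phiI _ _] _ _] := mp.
have extE x : unitI x -> ext phi x = phi x by move=> Ix; rewrite /ext mem_set.
split; last by move=> [x y] [/= Ix Iy]; apply: f01; split; exact: phiI.
pose F' := f \_ unitI2.
have mF' : measurable_fun setT F' by apply/(measurable_restrictT f munitI2).
apply: (@eq_measurable_fun _ _ _ _ _ (F' \o ext2 phi)); last first.
  by apply: measurable_funTS; exact: (measurableT_comp mF' (mext2 mp)).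
move=> [x y] /set_mem[/= Ix Iy]; rewrite /F' /relabel/= /ext2/= !extE// patchT//.
by rewrite mem_set//; split; exact: phiI.
Qed.

Let cut_relabel_le phi f g : mp_bij phi -> graphon_like f -> graphon_like g ->
  cut_dist (relabel phi f) (relabel phi g) <= cut_dist f g.
Proof.
move=> mp bf bg; apply: ge_sup; first exact: cset0.
have [[phiI phi_inj _] phim phim'] := mp.
have extE x : unitI x -> ext phi x = phi x by move=> Ix; rewrite /ext mem_set.
have img A : A `<=` unitI -> phi @` A `<=` unitI.
  by move=> AI _ [x Ax <-]; apply: phiI; exact: AI.
have preimg A : A `<=` unitI -> ext phi @^-1` (phi @` A) = A.
  move=> AI; apply/seteqP; split=> [x|x Ax] /=; last first.
    by rewrite extE//; [exists x|exact: AI].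
  rewrite /ext; case: ifPn => [/set_mem Ix [y Ay]|/negP nIx [y Ay]].
    by move=> /phi_inj <- //; rewrite inE//; exact: AI.
  by move=> xE; exfalso; apply: nIx; rewrite -xE; apply/mem_set/phiI/AI.
move=> _ [S [U [mS SI mU UI ->]]].
apply: (ub_le_sup (cset_ub bf bg)).
exists (phi @` S), (phi @` U); split => //; try exact: phim'; try exact: img.
congr `| _ |; rewrite [RHS](int_ext mp)//.
- rewrite (_ : ext2 phi @^-1` _ = S `*` U); last first.
    transitivity ((ext phi @^-1` (phi @` S)) `*` (ext phi @^-1` (phi @` U))).
      by [].
    by rewrite !preimg.
  apply: eq_Rintegral => -[x y] /set_mem[/= Sx Uy].
  by rewrite /relabel /ext2/= !extE//; [exact: UI|exact: SI].
- by apply: measurable_funB; [exact: bf.1|exact: bg.1].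
- move=> z Iz; have /andP[? ?] := bf.2 z Iz; have /andP[? ?] := bg.2 z Iz.
  rewrite ler_norml; apply/andP; split; lra.
- by apply: measurableX; exact: phim'.
- by apply: subX; exact: img.
Qed.

Let mp_id : mp_bij id.
Proof.
split; first by split => // x Ix; exists x.
  by move=> A AI mA; rewrite preimage_id (_ : unitI `&` A = A)//; exact: setIidr.
by move=> A AI mA; rewrite image_id.
Qed.

Let mp_comp phi psi : mp_bij phi -> mp_bij psi -> mp_bij (phi \o psi).
Proof.
move=> [pI pm pm'] [qI qm qm']; split.
- exact: set_bij_comp qI pI.
- move=> A AI mA.
  have [m1 e1] := pm _ AI mA.
  have [m2 e2] := qm _ (@subIsetl _ _ _) m1.
  suff -> : unitI `&` (phi \o psi) @^-1` A =
      unitI `&` psi @^-1` (unitI `&` phi @^-1` A) by rewrite e2.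
  apply/seteqP; split => [x [Ix Ax]|x [Ix [_ Ax]]]; split => //.
  by split => //; have [f _ _] := qI; exact: f.
- move=> A AI mA; rewrite -image_comp; apply: pm'; last exact: qm'.
  by move=> _ [x Ax <-]; have [f _ _] := qI; apply: f; exact: AI.
Qed.

Let mp_inv phi : mp_bij phi -> exists psi, [/\ mp_bij psi,
  {in unitI, cancel phi psi} & {in unitI, cancel psi phi}].
Proof.
move=> [[pI pinj psurj] pm pm'].
have /choice[psi psiE] : forall y, exists x, unitI y -> unitI x /\ phi x = y.
  move=> y; have [Iy|nIy] := pselect (unitI y); last by exists y.
  by have [x Ix xE] := psurj y Iy; exists x.
have psiI y : unitI y -> unitI (psi y) by move=> /psiE[].
have phiK : {in unitI, cancel phi psi}.
  move=> x /set_mem Ix; have [Ipx E] := psiE _ (pI _ Ix).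
  by apply: pinj => //; exact/mem_set.
have psiK : {in unitI, cancel psi phi} by move=> y /set_mem /psiE[].
have pre A : A `<=` unitI -> unitI `&` psi @^-1` A = phi @` A.
  move=> AI; apply/seteqP; split => [y [Iy Ay]|_ [x Ax <-]].
    by exists (psi y) => //; apply: psiK; exact/mem_set.
  split; first by apply: pI; exact: AI.
  by rewrite /= phiK//; apply/mem_set; exact: AI.
have im A : A `<=` unitI -> psi @` A = unitI `&` phi @^-1` A.
  move=> AI; apply/seteqP; split => [_ [y Ay <-]|x [Ix Ax]].
    split; first by apply: psiI; exact: AI.
    by rewrite /= psiK//; apply/mem_set; exact: AI.
  by exists (phi x) => //; apply: phiK; exact/mem_set.
exists psi; split => //; split.
- split => //.
  + by move=> x y xI yI xy; rewrite -(psiK x xI) -(psiK y yI) xy.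
  + by move=> x Ix; exists (phi x); [exact: pI|apply: phiK; exact/mem_set].
- move=> A AI mA; rewrite pre//; split; first exact: pm'.
  have pAI : phi @` A `<=` unitI by move=> _ [x Ax <-]; apply: pI; exact: AI.
  have [_ <-] := pm _ pAI (pm' _ AI mA); congr (mu _).
  apply/seteqP; split => [x [Ix [y Ay yx]]|x Ax].
    by rewrite -(pinj y x)//; apply/mem_set => //; exact: AI.
  by split; [exact: AI|exists x].
- by move=> A AI mA; rewrite im//; have [] := pm _ AI mA.
Qed.

Let dset (f g : graphon) := [set cut_dist f (relabel phi g) | phi in mp_bij].

Let dset0 f g : dset f g !=set0.
Proof. by exists (cut_dist f (relabel id g)); exists id. Qed.

Let dset_lb f g : has_lbound (dset f g).
Proof.
exists 0 => _ [phi mp <-]; apply: cut_ge0; first exact: graphon_b.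
by apply: relabel_b => //; exact: graphon_b.
Qed.

Lemma delta_ge0 f g : 0 <= delta f g.
Proof.
apply: lb_le_inf; first exact: dset0.
move=> _ [phi mp <-]; apply: cut_ge0; first exact: graphon_b.
by apply: relabel_b => //; exact: graphon_b.
Qed.

Lemma delta_refl f : delta f f = 0.
Proof.
apply/eqP; rewrite eq_le delta_ge0 andbT.
apply: (ge_inf (dset_lb f f)); exists id => //.
by apply: cut_refl => -[].
Qed.

Let delta_sym_le f g : delta g f <= delta f g.
Proof.
have bf := graphon_b f; have bg := graphon_b g.
apply: lb_le_inf; first exact: dset0.
move=> _ [phi mp <-]; have [psi [mpsi _ psiK]] := mp_inv mp.
have bpg := relabel_b mp bg; have bpf := relabel_b mpsi bf.
apply: (@le_trans _ _ (cut_dist g (relabel psi f))).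
  by apply: (ge_inf (dset_lb g f)); exists psi.
rewrite cut_sym//.
apply: le_trans (cut_relabel_le mpsi bf bpg).
apply: le_trans (cut_triangle bpf (relabel_b mpsi bpg) bg) _.
rewrite -[leRHS]addr0; apply: lerD => //.
rewrite cut_refl// => -[x y] [/= Ix Iy].
by rewrite /relabel/= !psiK//; exact/mem_set.
Qed.

Lemma delta_sym f g : delta f g = delta g f.
Proof. by apply/le_anti/andP; split; exact: delta_sym_le. Qed.

Lemma delta_triangle f g h : delta f h <= delta f g + delta g h.
Proof.
have bf := graphon_b f; have bg := graphon_b g; have bh := graphon_b h.
apply/ler_addgt0Pr => e e0; have e20 : 0 < e / 2 by rewrite divr_gt0.
have adh k l : exists2 r, dset k l r & r < delta k l + e / 2.
  apply: inf_adherent; first exact: e20.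
  by split; [exact: dset0|exact: dset_lb].
have [_ [phi mphi <-] /ltW phie] := adh f g.
have [_ [psi mpsi <-] /ltW psie] := adh g h.
have bpg := relabel_b mphi bg; have bqh := relabel_b mpsi bh.
apply: (@le_trans _ _ (cut_dist f (relabel (psi \o phi) h))).
  by apply: (ge_inf (dset_lb f h)); exists (psi \o phi) => //; exact: mp_comp.
apply: le_trans (cut_triangle bf bpg (relabel_b mphi bqh)) _.
have le2 := le_trans (cut_relabel_le mphi bg bqh) psie.
apply: le_trans (lerD phie le2) _.
by rewrite addrACA -splitr.
Qed.
Lemma delta_eq0 f g h : delta f g = 0 -> delta f h = delta g h.
Proof.
move=> fg; apply/eqP; rewrite eq_le; apply/andP; split.
  by have := delta_triangle f g h; rewrite fg add0r.
by have := delta_triangle g f h; rewrite (delta_sym g f) fg add0r.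
Qed.

End graphon.

Section graphon_class.
Variable R : realType.

HB.instance Definition _ := gen_eqMixin (graphon R).
HB.instance Definition _ := gen_choiceMixin (graphon R).

Definition graphon_equiv (f g : graphon R) : bool := delta f g == 0.

Let equiv_refl : reflexive graphon_equiv.
Proof. by move=> f; rewrite /graphon_equiv delta_refl. Qed.

Let equiv_sym : symmetric graphon_equiv.
Proof. by move=> f g; rewrite /graphon_equiv delta_sym. Qed.

Let equiv_trans : transitive graphon_equiv.
Proof.
move=> g f h /eqP fg /eqP gh; have := delta_triangle f g h.
by rewrite fg gh addr0 /graphon_equiv eq_le delta_ge0 andbT.
Qed.

Canonical graphon_equiv_rel :=
  EquivRel graphon_equiv equiv_refl equiv_sym equiv_trans.

Definition graphon_class := {eq_quot graphon_equiv}%qT.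

Definition to_class (f : graphon R) : graphon_class := (\pi f)%qT.

Definition delta_class (F : graphon_class) (g : graphon R) : R :=
  delta (repr F) g.

Lemma to_classP f g : to_class f = to_class g <-> delta f g = 0.
Proof.
split=> [/eqmodP/eqP//|fg]; apply/eqmodP; exact/eqP.
Qed.

Lemma delta_classE f g : delta_class (to_class f) g = delta f g.
Proof.
apply: delta_eq0; apply/to_classP; exact: reprK.
Qed.

End graphon_class.

Section homomorphism_density.

Record simple_graph (v : nat) := SimpleGraph {
  adj :> rel 'I_v;
  adj_sym : symmetric adj;
  adj_irr : irreflexive adj }.

Definition regular (v : nat) (H : simple_graph v) (d : nat) : Prop :=
  forall i, #|H i| = d.

Variable R : realType.

(* Each edge {i, j} contributes one factor, with i < j. *)
Definition hom_density (v : nat) (H : simple_graph v) (f : graphon R) : R :=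
  \int[lebesgue_tuple R v]_(x in [set x | forall i, unitI (tnth x i)])
    \prod_(e : 'I_v * 'I_v | (e.1 < e.2)%N && H e.1 e.2)
      f (tnth x e.1, tnth x e.2).

Definition hom_density_class (v : nat) (H : simple_graph v)
  (F : graphon_class R) : R := hom_density H (repr F).

End homomorphism_density.

Section block_graphon.
Variable R : realType.
Implicit Type f : graphon R.

Definition rat_simplex (m : nat) (gamma : 'I_m -> rat) : Prop :=
  (forall i, 0 <= gamma i <= 1) /\ \sum_i gamma i = 1.

Definition block (m : nat) (gamma : 'I_m -> rat) (i : 'I_m) : set R :=
  [set x | (if i == 0 :> nat then 0 <= x
            else ratr (\sum_(k < m | (k < i)%N) gamma k) < x) /\
           x <= ratr (\sum_(k < m | (k <= i)%N) gamma k)].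

Definition block_graphon (m : nat) (gamma : 'I_m -> rat) f : Prop :=
  exists p : 'M[R]_m,
    [/\ p^T = p, forall i j, 0 <= p i j <= 1 &
        forall i j x y, block gamma i x -> block gamma j y -> f (x, y) = p i j].

Definition block_graphon_star (m : nat) (gamma : 'I_m -> rat) f : Prop :=
  block_graphon gamma f /\
  forall eta : 'I_m.-1 -> rat, rat_simplex eta -> ~ block_graphon eta f.

Definition block_class (m : nat) (gamma : 'I_m -> rat)
    (F : graphon_class R) : Prop :=
  exists2 g, block_graphon gamma g & delta_class F g = 0.

End block_graphon.

Section rate_function.
Variable R : realType.
Local Notation mu2 := (@lebesgue_measure R \x @lebesgue_measure R)%E.
Implicit Types (f : graphon R) (F : graphon_class R).

(* ln 0 = 0 and 0^-1 = 0, so that the real formula takes the value 0 at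
   p = u = 0 and at p = u = 1.                                             *)
Definition rel_entropy (p u : R) : \bar R :=
  if ((p == 0) || (p == 1)) && (u != p) then +oo%E
  else (u * ln (u / p) + (1 - u) * ln ((1 - u) / (1 - p)))%:E.

Definition rate (W0 : graphon R) f : \bar R :=
  ((2^-1)%:E * \int[mu2]_(z in @unitI2 R) rel_entropy (W0 z) (f z))%E.

Definition Omega (W0 : graphon R) : set (R * R) :=
  [set z | unitI2 z /\ 0 < W0 z < 1].

Definition graphon_Omega (W0 : graphon R) f : Prop :=
  {ae mu2, forall z, unitI2 z -> ~ Omega W0 z -> f z = W0 z}.

Definition class_Omega (W0 : graphon R) F : Prop :=
  exists2 g, graphon_Omega W0 g & delta_class F g = 0.

Definition rate_class (W0 : graphon R) F : \bar R :=
  if `[< class_Omega W0 F >] then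
    ereal_sup [set
      ereal_inf [set rate W0 h | h in [set h | delta_class F h <= eta]]
      | eta in [set eta : R | 0 < eta]]
  else +oo%E.

(* The maximum over class_Omega: for continuous tau the supremum is attained,
   by compactness.                                                         *)
Definition t_max (W0 : graphon R) (tau : graphon_class R -> R) : R :=
  sup [set tau F | F in class_Omega W0].

Definition minimizer (W0 : graphon R) (tau : graphon_class R -> R)
    (t : R) F : Prop :=
  t <= tau F /\ forall G, t <= tau G -> (rate_class W0 F <= rate_class W0 G)%E.

Definition symmetric_regime (m : nat) (gamma : 'I_m -> rat) (W0 : graphon R)
    (tau : graphon_class R -> R) (t : R) : Prop :=
  t <= t_max W0 tau /\
  forall F, minimizer W0 tau t F -> block_class gamma F.

Definition is_minimum (A : set (\bar R)) (x : \bar R) : Prop :=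
  A x /\ lbound A x.

End rate_function.

(* Main.v *)
Require Import Defs.
From HB Require Import structures.
From mathcomp Require Import all_boot all_order all_algebra.
From mathcomp Require Import all_classical all_reals all_analysis.
From mathcomp Require Import measurable_realfun ring lra.

Set Implicit Arguments.
Unset Strict Implicit.
Unset Printing Implicit Defensive.

Import Order.TTheory GRing.Theory Num.Theory.
Import numFieldNormedType.Exports.

Local Open Scope classical_set_scope.
Local Open Scope ring_scope.

(** Why the theorem holds.

    Let p be the matrix of the values of W0.  The rate of a graphon f is half
    the integral of the relative entropy of f with respect to p.  Where p is 0
    or 1, a finite rate forces f = p almost everywhere, so the maximal density
    is that of the block graphon with value 1 wherever p > 0 ([t_maxE]).

    As H is d-regular, Finner's inequality ([finner]), which is Hoelder's
    inequality used one coordinate at a time, shows that the density of H does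
    not decrease when f is replaced on each block by its L^d average
    ([hom_le_block_density]).  For the rate to decrease as well, the relative
    entropy h_p(u) has to lie above its tangent at a in the variable u^d.  This
    can fail for general a, but it holds for a close to 1, with (u - a)^2 to spare
    ([kl_power_tangent]): near 1 the slope of h_p grows like ln (1 / (1 - a)),
    and this logarithm dominates every other term.

    When the density is close to its maximum, the L^d averages of f are close
    to 1 on every block that enters the maximal density: such a block occurs in
    the image of some map from the vertices of H to the blocks, and a small
    average there would cost a fixed amount of density ([hom_active_gap]).  On
    the other blocks f may be replaced by p, which has relative entropy 0.
    Altogether f has a symmetrization, constant on the blocks, whose density is
    at least that of f and whose rate is smaller by a constant times the
    squared L^2 distance between the two ([symmetrization_gain]).

    Let now F be a minimizer at a level t close to the maximum.  By definition
    of the rate of a class there are graphons h_n converging to F in the cut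
    metric with rates converging to that of F.  The counting lemma
    ([counting_lemma], [hom_density_delta]) gives their densities limit at
    least t, so each h_n has a symmetrization q_n, given by a matrix with
    entries in [0, 1].  A limit point q of these matrices has density at least
    t, and its rate is at most that of F, by lower semicontinuity; it is
    therefore equal to it, F being a minimizer.  Hence the gain of rate between
    h_n and q_n tends to 0 along a subsequence, so does their L^2 distance, and
    F is the class of the block graphon of q ([minimizer_block]). *)

(** * Bounded measurable functions on probability spaces *)

Section bounded_measurable.
Context {R : realType}.

(** Such functions are integrable for every probability measure, and they are
    stable under all the operations used below: their integrals can be handled
    in R without integrability side conditions. *)
Definition bmeas d (T : measurableType d) (f : T -> R) : Prop :=
  measurable_fun setT f /\ exists M, forall x, `|f x| <= M.

Section closure.
Context d (T : measurableType d).
Implicit Types f g : T -> R.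

Lemma bmeas_cst (c : R) : bmeas (fun _ : T => c).
Proof. by split; [exact: measurable_cst|exists `|c|]. Qed.

Lemma bmeasD f g : bmeas f -> bmeas g -> bmeas (fun x => f x + g x).
Proof.
move=> [mf [M fM]] [mg [N gN]]; split; first exact: measurable_funD.
by exists (M + N) => x; apply: le_trans (ler_normD _ _) _; exact: lerD.
Qed.

Lemma bmeasM f g : bmeas f -> bmeas g -> bmeas (fun x => f x * g x).
Proof.
move=> [mf [M fM]] [mg [N gN]]; split; first exact: measurable_funM.
by exists (M * N) => x; rewrite normrM; apply: ler_pM.
Qed.

Lemma bmeasZ c f : bmeas f -> bmeas (fun x => c * f x).
Proof. by move=> bf; apply: bmeasM => //; exact: bmeas_cst. Qed.

Lemma bmeasB f g : bmeas f -> bmeas g -> bmeas (fun x => f x - g x).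
Proof.
move=> bf bg; apply: bmeasD => //.
have := bmeasZ (-1) bg; congr bmeas.
by apply/funext => x; rewrite mulN1r.
Qed.

Lemma bmeas_norm f : bmeas f -> bmeas (fun x => `|f x|).
Proof.
move=> [mf [M fM]]; split; first exact: measurableT_comp.
by exists M => x; rewrite normr_id.
Qed.

Lemma bmeasX f n : bmeas f -> bmeas (fun x => f x ^+ n).
Proof.
move=> bf; elim: n => [|n IHn]; first exact: bmeas_cst.
have := bmeasM bf IHn; congr bmeas.
by apply/funext => x; rewrite exprS.
Qed.

Lemma bmeas_sum (I : Type) (r : seq I) (Q : pred I) (F : I -> T -> R) :
  (forall i, Q i -> bmeas (F i)) -> bmeas (fun x => \sum_(i <- r | Q i) F i x).
Proof.
move=> bF; elim: r => [|i r IHr].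
  by have := bmeas_cst 0; congr bmeas; apply/funext => x; rewrite big_nil.
have [Qi|nQi] := boolP (Q i).
  have := bmeasD (bF _ Qi) IHr; congr bmeas.
  by apply/funext => x; rewrite big_cons Qi.
move: IHr; congr bmeas.
by apply/funext => x; rewrite big_cons (negbTE nQi).
Qed.

Lemma bmeas_prod (I : Type) (r : seq I) (Q : pred I) (F : I -> T -> R) :
  (forall i, Q i -> bmeas (F i)) -> bmeas (fun x => \prod_(i <- r | Q i) F i x).
Proof.
move=> bF; elim: r => [|i r IHr].
  by have := bmeas_cst 1; congr bmeas; apply/funext => x; rewrite big_nil.
have [Qi|nQi] := boolP (Q i).
  have := bmeasM (bF _ Qi) IHr; congr bmeas.
  by apply/funext => x; rewrite big_cons Qi.
move: IHr; congr bmeas.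
by apply/funext => x; rewrite big_cons (negbTE nQi).
Qed.

Lemma bmeas_comp d' (S : measurableType d') (phi : S -> T) f :
  measurable_fun setT phi -> bmeas f -> bmeas (fun x => f (phi x)).
Proof.
move=> mphi [mf [M fM]]; split; first exact: (measurableT_comp mf).
by exists M => x.
Qed.

Lemma bmeas_indic (A : set T) : measurable A -> bmeas (\1_A : T -> R).
Proof.
move=> mA; split; first exact: measurable_indic.
by exists 1 => x; rewrite indicE ger0_norm// lern1 leq_b1.
Qed.

Lemma bmeas_pos f : measurable_fun setT f -> (forall x, 0 <= f x <= 1) -> bmeas f.
Proof.
by move=> mf f01; split => //; exists 1 => x; have /andP[? ?] := f01 x; rewrite ger0_norm.
Qed.

Lemma bmeas_integrable (P : probability T R) f :
  bmeas f -> P.-integrable setT (EFin \o f).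
Proof.
move=> [mf [M fM]]; apply: measurable_bounded_integrable => //.
  by apply: (le_lt_trans (probability_le1 P measurableT)); rewrite ltry.
exists M; split; first exact: num_real.
by move=> r /ltW Mr x _; exact: le_trans (fM x) Mr.
Qed.

End closure.

Section expectation.
Context d (T : measurableType d) (P : probability T R).
Implicit Types f g : T -> R.

Lemma expect_cst (c : R) : \int[P]_x c = c.
Proof. by rewrite Rintegral_cst//= probability_setT/= mulr1. Qed.

Lemma expectD f g : bmeas f -> bmeas g ->
  \int[P]_x (f x + g x) = \int[P]_x f x + \int[P]_x g x.
Proof. by move=> bf bg; rewrite RintegralD//; exact: bmeas_integrable. Qed.

Lemma expectZl c f : bmeas f -> \int[P]_x (c * f x) = c * \int[P]_x f x.
Proof. by move=> bf; rewrite RintegralZl//; exact: bmeas_integrable. Qed.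

Lemma le_expect f g : bmeas f -> bmeas g -> (forall x, f x <= g x) ->
  \int[P]_x f x <= \int[P]_x g x.
Proof. by move=> bf bg fg; apply: le_Rintegral => //; exact: bmeas_integrable. Qed.

Lemma expect_ge0 f : (forall x, 0 <= f x) -> 0 <= \int[P]_x f x.
Proof. by move=> f0; exact: Rintegral_ge0. Qed.

Lemma le_norm_expect f : bmeas f -> `|\int[P]_x f x| <= \int[P]_x `|f x|.
Proof. by move=> bf; apply: le_normr_Rintegral => //; exact: bmeas_integrable. Qed.

Lemma expect_sum (I : Type) (r : seq I) (Q : pred I) (F : I -> T -> R) :
  (forall i, Q i -> bmeas (F i)) ->
  \int[P]_x (\sum_(i <- r | Q i) F i x) = \sum_(i <- r | Q i) \int[P]_x F i x.
Proof.
move=> bF; elim: r => [|i r IHr].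
  rewrite big_nil -[RHS](expect_cst 0).
  by apply: eq_Rintegral => x _; rewrite big_nil.
rewrite big_cons -IHr; case: ifP => Qi.
  rewrite -expectD; [|exact: bF|exact: bmeas_sum].
  by apply: eq_Rintegral => x _; rewrite big_cons Qi.
by apply: eq_Rintegral => x _; rewrite big_cons Qi.
Qed.

Lemma EFin_expect f : bmeas f -> (\int[P]_x f x)%:E = (\int[P]_x (f x)%:E)%E.
Proof.
move=> bf; rewrite /Rintegral fineK//.
by apply: integrable_fin_num => //; exact: bmeas_integrable.
Qed.

End expectation.

Section fubini_measurable.
Context d1 d2 (T1 : measurableType d1) (T2 : measurableType d2).

Lemma bmeas_section (F : T1 * T2 -> R) x : bmeas F -> bmeas (fun y => F (x, y)).
Proof. exact/bmeas_comp/measurable_pair1. Qed.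

Lemma bmeas_section2 (F : T1 * T2 -> R) y : bmeas F -> bmeas (fun x => F (x, y)).
Proof. exact/bmeas_comp/measurable_pair2. Qed.

Lemma bmeas_fubini (P2 : probability T2 R) (F : T1 * T2 -> R) : bmeas F ->
  bmeas (fun x => \int[P2]_y F (x, y)).
Proof.
move=> bF; have [mF [M FM]] := bF.
have M0 z : 0 <= F z + M.
  by have := FM z; rewrite ler_norml => /andP[]; lra.
have bFM : bmeas (fun z => F z + M) by apply: bmeasD => //; exact: bmeas_cst.
split; last first.
  exists M => x; apply: le_trans (le_norm_expect _ (bmeas_section x bF)) _.
  rewrite -[leRHS](expect_cst P2); apply: le_expect => //.
    exact/bmeas_norm/bmeas_section.
  exact: bmeas_cst.
have -> : (fun x => \int[P2]_y F (x, y)) =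
    (fun x => fine (\int[P2]_y (F (x, y) + M)%:E)%E - M).
  apply/funext => x; rewrite -[X in _ = fine X - _]EFin_expect; last first.
    exact: (bmeas_section x bFM).
  rewrite expectD ?expect_cst ?addrK//; [exact: bmeas_section|exact: bmeas_cst].
apply: measurable_funB => //.
apply: (measurableT_comp (fine_measurable measurableT)) => //.
apply: (@measurable_fun_fubini_tonelli_F _ _ _ _ R P2 (fun z => (F z + M)%:E)).
- by apply/measurable_EFinP; exact: bFM.1.
- by move=> z; rewrite lee_fin.
Qed.

End fubini_measurable.

Section fubini.
Context d1 d2 (T1 : measurableType d1) (T2 : measurableType d2).

Lemma expect_prod (P1 : probability T1 R) (P2 : probability T2 R) (F : T1 * T2 -> R) :
  bmeas F -> \int[(P1 \x P2)%E]_z F z = \int[P1]_x \int[P2]_y F (x, y).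
Proof.
move=> bF; apply: EFin_inj.
rewrite (EFin_expect (P1 \x P2)%E)// EFin_expect; last exact: bmeas_fubini.
rewrite -integral12_prod_meas1; last exact: (bmeas_integrable (P1 \x P2)%E).
by apply: eq_integral => x _; rewrite EFin_expect//; exact: bmeas_section.
Qed.

Lemma expect_swap (P1 : probability T1 R) (P2 : probability T2 R) (F : T1 * T2 -> R) :
  bmeas F -> \int[P1]_x \int[P2]_y F (x, y) = \int[P2]_y \int[P1]_x F (x, y).
Proof.
move=> bF; rewrite -expect_prod//; apply: EFin_inj.
rewrite (EFin_expect (P1 \x P2)%E)// EFin_expect; last first.
  apply: (bmeas_fubini P1 (F := fun z => F (z.2, z.1))).
  by apply: (bmeas_comp _ bF); exact: measurable_fun_pair.
rewrite -integral21_prod_meas1; last exact: (bmeas_integrable (P1 \x P2)%E).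
by apply: eq_integral => x _; rewrite EFin_expect//; exact: bmeas_section2.
Qed.
End fubini.
End bounded_measurable.

(** * Iterated expectations *)

Section iterated_expectation.
Context {R : realType} d (T : measurableType d) (P : probability T R).

(** Integration over the n-th power of P, one coordinate at a time; the
    recursion is that of the product measure on tuples. *)
Fixpoint iexp (n : nat) : (n.-tuple T -> R) -> R :=
  match n with
  | 0 => fun F => F [tuple]
  | n'.+1 => fun F => \int[P]_x iexp (fun y : n'.-tuple T => F [tuple of x :: y])
  end.

Lemma bmeas_cons d' (S : measurableType d') n (F : S * n.+1.-tuple T -> R) :
  bmeas F ->
  bmeas (fun z : (S * T) * n.-tuple T => F (z.1.1, [tuple of z.1.2 :: z.2])).
Proof.
apply: bmeas_comp; apply: measurable_fun_pair.
  exact: (measurableT_comp measurable_fst measurable_fst).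
apply: measurable_cons => //.
exact: (measurableT_comp measurable_snd measurable_fst).
Qed.

(** The space S of parameters is what the induction on n runs on: the head of
    the tuple becomes a parameter of the integral over the tail. *)
Lemma bmeas_iexp d' (S : measurableType d') n (F : S * n.-tuple T -> R) :
  bmeas F -> bmeas (fun s => iexp (fun y => F (s, y))).
Proof.
elim: n d' S F => [|n IHn] d' S F bF /=; first exact: bmeas_section2.
by apply: (bmeas_fubini P (F := fun z => iexp (fun y => F (z.1, [tuple of z.2 :: y]))));
  exact: (IHn _ _ _ (bmeas_cons bF)).
Qed.

Lemma bmeas_tail n (F : n.+1.-tuple T -> R) x :
  bmeas F -> bmeas (fun y : n.-tuple T => F [tuple of x :: y]).
Proof. by apply: bmeas_comp; exact: measurable_cons. Qed.

Lemma bmeas_head n (F : n.+1.-tuple T -> R) :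
  bmeas F -> bmeas (fun x => iexp (fun y : n.-tuple T => F [tuple of x :: y])).
Proof.
move=> bF; apply: (bmeas_iexp (F := fun z => F [tuple of z.1 :: z.2])).
by apply: (bmeas_comp _ bF); exact: measurable_cons.
Qed.

Lemma eq_iexp n (F G : n.-tuple T -> R) : F =1 G -> iexp F = iexp G.
Proof. by move=> /funext ->. Qed.

Lemma iexp_cst n (c : R) : iexp (fun _ : n.-tuple T => c) = c.
Proof.
elim: n => //= n IHn; rewrite -[RHS](expect_cst P).
by apply: eq_Rintegral => x _; exact: IHn.
Qed.

Lemma iexpD n (F G : n.-tuple T -> R) : bmeas F -> bmeas G ->
  iexp (fun x => F x + G x) = iexp F + iexp G.
Proof.
elim: n F G => //= n IHn F G bF bG; rewrite -expectD; [|exact: bmeas_head..].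
by apply: eq_Rintegral => x _; apply: IHn; exact: bmeas_tail.
Qed.

Lemma iexpZ n c (F : n.-tuple T -> R) : bmeas F ->
  iexp (fun x => c * F x) = c * iexp F.
Proof.
elim: n F => //= n IHn F bF; rewrite -expectZl; last exact: bmeas_head.
by apply: eq_Rintegral => x _; apply: IHn; exact: bmeas_tail.
Qed.

Lemma iexpB n (F G : n.-tuple T -> R) : bmeas F -> bmeas G ->
  iexp (fun x => F x - G x) = iexp F - iexp G.
Proof.
move=> bF bG; rewrite -[- iexp G]mulN1r -iexpZ// -iexpD//; last exact: bmeasZ.
by apply: eq_iexp => x; rewrite mulN1r.
Qed.

Lemma iexp_sum n (I : Type) (r : seq I) (Q : pred I) (F : I -> n.-tuple T -> R) :
  (forall i, Q i -> bmeas (F i)) ->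
  iexp (fun x => \sum_(i <- r | Q i) F i x) = \sum_(i <- r | Q i) iexp (F i).
Proof.
move=> bF; elim: r => [|i r IHr].
  by rewrite big_nil -[RHS](iexp_cst n); apply: eq_iexp => x; rewrite big_nil.
rewrite big_cons -IHr; case: ifP => Qi.
  rewrite -iexpD; [|exact: bF|exact: bmeas_sum].
  by apply: eq_iexp => x; rewrite big_cons Qi.
by apply: eq_iexp => x; rewrite big_cons Qi.
Qed.

Lemma le_iexp n (F G : n.-tuple T -> R) : bmeas F -> bmeas G ->
  (forall x, F x <= G x) -> iexp F <= iexp G.
Proof.
elim: n F G => [|n IHn] F G bF bG FG /=; first exact: FG.
apply: le_expect; [exact: bmeas_head|exact: bmeas_head|move=> x].
by apply: IHn => [||y]; [exact: bmeas_tail|exact: bmeas_tail|exact: FG].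
Qed.

Lemma iexp_ge0 n (F : n.-tuple T -> R) : (forall x, 0 <= F x) -> 0 <= iexp F.
Proof.
elim: n F => [|n IHn] F F0 /=; first exact: F0.
by apply: expect_ge0 => x; apply: IHn => y; exact: F0.
Qed.

Lemma iexp_prod n (u : 'I_n -> T -> R) : (forall i, bmeas (u i)) ->
  iexp (fun x => \prod_i u i (tnth x i)) = \prod_i \int[P]_x u i x.
Proof.
elim: n u => [|n IHn] u bu; first by rewrite /= !big_ord0.
rewrite big_ord_recl /= mulrC -expectZl//; apply: eq_Rintegral => x _.
rewrite -IHn// mulrC -iexpZ; last first.
  by apply: bmeas_prod => i _; apply: (bmeas_comp _ (bu _)); exact: measurable_tnth.
apply: eq_iexp => y; rewrite big_ord_recl; congr *%R.
by apply: eq_bigr => i _; rewrite tnthS.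
Qed.

Definition tset n (x : n.-tuple T) (a : 'I_n) (s : T) : n.-tuple T :=
  [tuple if i == a then s else tnth x i | i < n].

Lemma tnth_tset n (x : n.-tuple T) a s i :
  tnth (tset x a s) i = if i == a then s else tnth x i.
Proof. by rewrite tnth_mktuple. Qed.

Lemma measurable_tset n (a : 'I_n) :
  measurable_fun setT (fun z : n.-tuple T * T => tset z.1 a z.2).
Proof.
apply/measurable_fun_tnthP => i.
have -> : (@tnth _ _ ^~ i) \o (fun z : n.-tuple T * T => tset z.1 a z.2) =
    (fun z => if i == a then z.2 else tnth z.1 i).
  by apply/funext => z /=; rewrite tnth_tset.
case: (i == a); first exact: measurable_snd.
exact: (measurableT_comp (measurable_tnth i) measurable_fst).
Qed.

Lemma bmeas_tset n (a : 'I_n) (F : n.-tuple T -> R) :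
  bmeas F -> bmeas (fun z : n.-tuple T * T => F (tset z.1 a z.2)).
Proof. by apply: bmeas_comp; exact: measurable_tset. Qed.

Lemma iexp_swap d' (S : measurableType d') (Q : probability S R) n
    (G : S * n.-tuple T -> R) : bmeas G ->
  iexp (fun y => \int[Q]_s G (s, y)) = \int[Q]_s iexp (fun y => G (s, y)).
Proof.
elim: n G => [//|n IHn] G bG /=.
have bGc := bmeas_cons bG.
have bH := bmeas_iexp bGc.
apply: etrans; last exact/esym/(expect_swap Q P bH).
apply: eq_Rintegral => x _.
rewrite (IHn (fun z => G (z.1, [tuple of x :: z.2])))//.
apply: (bmeas_comp _ bG); apply: measurable_fun_pair => //.
exact: measurable_cons.
Qed.

(** An independent copy of one coordinate has the same law.  This isolates any
    coordinate without permuting the others. *)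
Lemma iexp_resample n (a : 'I_n) (F : n.-tuple T -> R) : bmeas F ->
  iexp F = iexp (fun x => \int[P]_s F (tset x a s)).
Proof.
elim: n a F => [|n IHn] a F bF; first by case: a.
have [->|[b ->]] : a = ord0 \/ exists b, a = lift ord0 b.
  by case: (unliftP ord0 a) => [b ->|->]; [right; exists b|left].
- rewrite /=.
  have E x s (y : n.-tuple T) : tset [tuple of x :: y] ord0 s = [tuple of s :: y].
    apply: eq_from_tnth => i; rewrite tnth_tset.
    case: (unliftP ord0 i) => [j ->|->]; last by rewrite eqxx.
    by rewrite eq_sym (negbTE (neq_lift _ _)) !tnthS.
  under [RHS]eq_Rintegral do under eq_iexp do under eq_Rintegral do rewrite E.
  rewrite expect_cst (iexp_swap P (G := fun z => F [tuple of z.1 :: z.2]))//.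
  by apply: (bmeas_comp _ bF); exact: measurable_cons.
- rewrite /=; apply: eq_Rintegral => x _.
  rewrite (IHn b); last exact: bmeas_tail.
  apply: eq_iexp => y; apply: eq_Rintegral => s _; congr F.
  apply: eq_from_tnth => i; rewrite tnth_tset.
  case: (unliftP ord0 i) => [j ->|->].
    by rewrite !tnthS tnth_tset (inj_eq lift_inj).
  by rewrite (negbTE (neq_lift _ _)) !tnth0.
Qed.

End iterated_expectation.

(** * The inequalities of Hoelder and Finner *)

Section nroot.
Context {R : realType}.

Definition nroot (d : nat) (x : R) : R := x `^ (d%:R^-1).

Lemma nroot_ge0 d x : 0 <= nroot d x.
Proof. exact: powR_ge0. Qed.

Lemma nrootK d x : (0 < d)%N -> 0 <= x -> nroot d x ^+ d = x.
Proof.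
move=> d0 x0; rewrite -powR_mulrn ?nroot_ge0// -powRrM mulVf ?powRr1//.
by rewrite pnatr_eq0 -lt0n.
Qed.

Lemma bmeas_nroot d0 (T : measurableType d0) d (f : T -> R) : (0 < d)%N ->
  bmeas f -> (forall x, 0 <= f x) -> bmeas (fun x => nroot d (f x)).
Proof.
move=> d0' [mf [M fM]] f0; split.
  exact: (measurableT_comp (measurable_powR _) mf).
exists (nroot d M) => x; rewrite ger0_norm ?nroot_ge0//.
have fxM : f x <= M by apply: le_trans (fM x); exact: ler_norm.
by apply: ge0_ler_powR => //; rewrite nnegrE// (le_trans (f0 x)).
Qed.

End nroot.

Section hoelder.
Context {R : realType}.

(** Reduces inequalities between products of norms to positive norms. *)
Lemma prod_addr_lim (I : finType) (A : pred I) (N : I -> R) (c : R) :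
  (forall e, 0 < e -> c <= \prod_(i | A i) (N i + e)) -> c <= \prod_(i | A i) N i.
Proof.
move=> H; pose p := \prod_(i | A i) ((N i)%:P + 'X).
have pE e : p.[e] = \prod_(i | A i) (N i + e).
  by rewrite horner_prod; apply: eq_bigr => i _; rewrite !hornerE.
have -> : \prod_(i | A i) N i = p.[0].
  by rewrite pE; apply: eq_bigr => i _; rewrite addr0.
apply: (cvgr_to_ge (F := 0^'+) (f := horner p)).
  exact/cvg_at_right_filter/continuous_horner.
by near=> e; rewrite pE; apply: H; near: e; exact: nbhs_right_gt.
Unshelve. all: by end_near. Qed.

Context d0 (T : measurableType d0) (P : probability T R).

(** Once the factors are divided by their norms, the inequality between
    arithmetic and geometric means bounds their product by the mean of their
    d-th powers, whose integral is at most 1. *)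
Lemma hoelder_prod (I : finType) (A : pred I) (d : nat) (G : I -> T -> R)
    (N : I -> R) :
  (0 < d)%N -> #|A| = d ->
  (forall i, bmeas (G i)) -> (forall i x, 0 <= G i x) ->
  (forall i, 0 <= N i) ->
  (forall i, A i -> \int[P]_x (G i x ^+ d) <= N i ^+ d) ->
  \int[P]_x \prod_(i | A i) G i x <= \prod_(i | A i) N i.
Proof.
move=> d_gt0 cA bG G0 N0 GN; apply: prod_addr_lim => e e0.
(* the norms N i may vanish, the numbers M i do not *)
pose M i := N i + e.
have M0 i : 0 < M i by rewrite ltr_wpDl.
have dR : (0 : R) < d%:R by rewrite ltr0n.
have pM0 : 0 < \prod_(i | A i) M i by apply: prodr_gt0 => i _.
rewrite -[leRHS]mul1r -ler_pdivrMr//.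
have pt x : (\prod_(i | A i) G i x) / (\prod_(i | A i) M i) <=
    \sum_(i | A i) (d%:R^-1 * (M i ^- d)) * G i x ^+ d.
  rewrite -prodf_div.
  set y := fun i => G i x / M i.
  have y0 i : 0 <= y i by rewrite divr_ge0// ltW.
  have [H _] := leif_AGM (A := A) (E := fun i => y i ^+ d) (fun i _ => exprn_ge0 d (y0 i)).
  rewrite cA in H.
  have -> : \sum_(i | A i) (d%:R^-1 * M i ^- d) * G i x ^+ d =
      (\sum_(i in A) y i ^+ d) / d%:R.
    rewrite mulr_suml; apply: eq_bigr => i _.
    by rewrite /y expr_div_n [RHS]mulrC mulrA mulrAC -mulrA; congr *%R; rewrite mulrC.
  rewrite -(@ler_pXn2r _ d)//; first by rewrite -prodrXl.
    by rewrite nnegrE; apply: prodr_ge0 => i _; exact: y0.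
  rewrite nnegrE; apply: divr_ge0; last exact: ltW.
  by apply: sumr_ge0 => i _; exact: exprn_ge0.
have bp : bmeas (fun x => \prod_(i | A i) G i x) by exact: bmeas_prod.
rewrite mulrC -expectZl//.
apply: (@le_trans _ _ (\int[P]_x \sum_(i | A i) (d%:R^-1 * (M i ^- d)) * G i x ^+ d)).
  apply: le_expect => [||x]; [exact: bmeasZ| |by rewrite mulrC].
  by apply: bmeas_sum => i _; apply/bmeasZ/bmeasX.
rewrite expect_sum; last by move=> i _; apply/bmeasZ/bmeasX.
apply: (@le_trans _ _ (\sum_(i | A i) d%:R^-1)).
  apply: ler_sum => i Ai; rewrite expectZl; last exact: bmeasX.
  rewrite -mulrA ler_piMr ?invr_ge0 ?ler0n//.
  rewrite mulrC ler_pdivrMr ?exprn_gt0// mul1r.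
  apply: (le_trans (GN i Ai)); apply: lerXn2r; rewrite ?nnegrE//; first exact: ltW.
  by rewrite lerDl ltW.
by rewrite sumr_const cA -[_ *+ d]mulr_natl mulfV// gt_eqF.
Qed.

(** Here dep i a holds if the factor F i may depend on the coordinate a.  For a
    fixed first coordinate, the induction hypothesis replaces each factor by its
    L^d norm in the other coordinates.  Exactly d of these norms still depend on
    the first coordinate, and Hoelder's inequality applies to them. *)
Lemma finner (I : finType) (Q : pred I) (d : nat) : (0 < d)%N ->
  forall n (F : I -> n.-tuple T -> R) (dep : I -> 'I_n -> bool) (N : I -> R),
  (forall i, bmeas (F i)) -> (forall i x, 0 <= F i x) ->
  (forall i x y, (forall a, dep i a -> tnth x a = tnth y a) -> F i x = F i y) ->
  (forall a, #|[pred i | Q i && dep i a]| = d) ->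
  (forall i, 0 <= N i) ->
  (forall i, Q i -> iexp P (fun x => F i x ^+ d) <= N i ^+ d) ->
  iexp P (fun x => \prod_(i | Q i) F i x) <= \prod_(i | Q i) N i.
Proof.
move=> d_gt0; elim=> [|n IHn] F dep N bF F0 depF cdep N0 FN.
  rewrite /=; apply: ler_prod => i Qi; rewrite F0/=.
  by have := FN i Qi; rewrite /= ler_pXn2r// nnegrE.
have bFd i : bmeas (fun x => F i x ^+ d) by exact: bmeasX.
pose g i x := iexp P (fun y : n.-tuple T => F i [tuple of x :: y] ^+ d).
have bg i : bmeas (g i) by exact: (bmeas_head P (bFd i)).
have g0 i x : 0 <= g i x by apply: iexp_ge0 => y; exact: exprn_ge0.
pose G i x := nroot d (g i x).
have G0 i x : 0 <= G i x by exact: nroot_ge0.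
have bGn i : bmeas (G i) by exact: bmeas_nroot.
have Gd i x : G i x ^+ d = g i x by exact: nrootK.
pose A := [pred i | Q i && dep i ord0].
pose B := [pred i | Q i && ~~ dep i ord0].
have GB i x : i \in B -> G i x <= N i.
  move=> /andP[Qi ndep]; rewrite -(@ler_pXn2r _ d) ?nnegrE// Gd.
  apply: le_trans (FN i Qi) => /=; rewrite le_eqVlt; apply/orP; left; apply/eqP.
  rewrite -[LHS](expect_cst P); apply: eq_Rintegral => z _; apply: eq_iexp => y.
  congr (_ ^+ _); apply: depF => a.
  by case: (unliftP ord0 a) => [b ->|->]; [rewrite !tnthS|rewrite (negbTE ndep)].
apply: (@le_trans _ _ (\int[P]_x ((\prod_(i | B i) N i) * \prod_(i | A i) G i x))).
  rewrite /=; apply: le_expect => [||x].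
  - apply: (bmeas_head P (F := fun x => \prod_(i | Q i) F i x)).
    exact: bmeas_prod.
  - by apply: bmeasZ; exact: bmeas_prod.
  apply: (@le_trans _ _ (\prod_(i | Q i) G i x)).
    apply: (IHn _ (fun i a => dep i (lift ord0 a))) => //.
    - by move=> i; exact: bmeas_tail.
    - move=> i y z H; apply: depF => a.
      by case: (unliftP ord0 a) => [b ->|->]; [rewrite !tnthS; exact: H|].
    - by move=> i _; rewrite Gd.
  rewrite (bigID (fun i => dep i ord0))/= mulrC; apply: ler_pM => //.
  - by apply: prodr_ge0 => i _; exact: G0.
  - by apply: prodr_ge0 => i _; exact: G0.
  - by apply: ler_prod => i Bi; rewrite G0/=; exact: GB.
rewrite expectZl; last exact: bmeas_prod.
rewrite [leRHS](bigID (fun i => dep i ord0))/= mulrC; apply: ler_wpM2r.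
  by apply: prodr_ge0 => i _; exact: N0.
apply: (hoelder_prod (A := A) (d := d)) => // [|i /andP[Qi _]].
  exact: (cdep ord0).
by under eq_Rintegral do rewrite Gd; exact: FN.
Qed.

End hoelder.

(** * Integrals over homomorphisms and the counting lemma *)

Section hom_integral.
Context {R : realType} d0 (T : measurableType d0) (P : probability T R).
Context (v : nat) (Q : pred ('I_v * 'I_v)).
Hypothesis Qlt : forall e, Q e -> (e.1 < e.2)%N.

(** One kernel for each edge: the counting lemma changes the kernels of the
    edges one at a time. *)
Definition hom_integral (K : 'I_v * 'I_v -> T * T -> R) : R :=
  iexp P (fun x : v.-tuple T => \prod_(e | Q e) K e (tnth x e.1, tnth x e.2)).

Lemma bmeas_pair n (a b : 'I_n) (G : T * T -> R) : bmeas G ->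
  bmeas (fun x : n.-tuple T => G (tnth x a, tnth x b)).
Proof. by apply: bmeas_comp; apply: measurable_fun_pair; exact: measurable_tnth. Qed.

Lemma bmeas_hom (A : pred ('I_v * 'I_v)) (K : 'I_v * 'I_v -> T * T -> R) :
  (forall e, bmeas (K e)) ->
  bmeas (fun x : v.-tuple T => \prod_(e | A e) K e (tnth x e.1, tnth x e.2)).
Proof. by move=> bK; apply: bmeas_prod => e _; exact: bmeas_pair. Qed.

Lemma iexp_resample2 n (a b : 'I_n) (F : n.-tuple T -> R) : bmeas F ->
  iexp P F = iexp P (fun x => \int[P]_s \int[P]_t F (tset (tset x a s) b t)).
Proof.
move=> bF; rewrite (iexp_resample P b bF).
have bF1 := bmeas_fubini P (bmeas_tset b bF).
by rewrite (iexp_resample P a bF1).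
Qed.

Lemma bmeas_resample2 n (a b : 'I_n) (F : n.-tuple T -> R) : bmeas F ->
  bmeas (fun x => \int[P]_s \int[P]_t F (tset (tset x a s) b t)).
Proof.
move=> bF; have bF1 := bmeas_fubini P (bmeas_tset b bF).
exact: (bmeas_fubini P (bmeas_tset a bF1)).
Qed.

Lemma iexp_marginal2 n (a b : 'I_n) (G : T * T -> R) : a != b -> bmeas G ->
  iexp P (fun x : n.-tuple T => G (tnth x a, tnth x b)) =
  \int[P]_s \int[P]_t G (s, t).
Proof.
move=> ab bG; rewrite (iexp_resample2 a b); last exact: bmeas_pair.
rewrite -[RHS](iexp_cst P n); apply: eq_iexp => x.
apply: eq_Rintegral => s _; apply: eq_Rintegral => t _.
by rewrite !tnth_tset (negbTE ab) !eqxx.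
Qed.

Definition cut_le (W : T * T -> R) (eps : R) := forall S U : set T,
  measurable S -> measurable U ->
  `|\int[P]_x \int[P]_y (\1_S x * \1_U y * W (x, y))| <= eps.

(** The integral of u k over weights u in [0, 1] is largest when u is the
    indicator of the set where k is nonnegative; this turns weights into sets. *)
Lemma maximize_weight (u k : T -> R) : bmeas u -> bmeas k ->
  (forall x, 0 <= u x <= 1) -> exists2 S, measurable S &
  \int[P]_x (u x * k x) <= \int[P]_x (\1_S x * k x).
Proof.
move=> bu bk u01; exists (k @^-1` `[0, +oo[).
  by rewrite -[X in measurable X]setTI; apply: bk.1 => //; exact: measurable_itv.
have mS : measurable (k @^-1` `[0, +oo[).
  by rewrite -[X in measurable X]setTI; apply: bk.1 => //; exact: measurable_itv.
apply: le_expect => [||x]; [exact: bmeasM|by apply: bmeasM => //; exact: bmeas_indic|].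
rewrite indicE; have /andP[u0 u1] := u01 x.
case: (boolP (x \in _)); rewrite ?inE ?notin_setE/= in_itv/= andbT.
  by move=> k0; rewrite mul1r ler_piMl.
by move=> /negP; rewrite -ltNge => k0; rewrite mul0r mulr_ge0_le0// ltW.
Qed.

Lemma cut_le_weighted (W : T * T -> R) eps (u w : T -> R) :
  bmeas W -> cut_le W eps -> bmeas u -> bmeas w ->
  (forall x, 0 <= u x <= 1) -> (forall x, 0 <= w x <= 1) ->
  \int[P]_x \int[P]_y (W (x, y) * (u x * w y)) <= eps.
Proof.
move=> bW cW bu bw u01 w01.
have bWw : bmeas (fun z : T * T => W z * w z.2).
  by apply: bmeasM => //; exact: (bmeas_comp measurable_snd).
have [S mS leS] := maximize_weight bu (bmeas_fubini P bWw) u01.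
have b1S : bmeas (\1_S : T -> R) by exact: bmeas_indic.
have bSW : bmeas (fun z : T * T => \1_S z.1 * W z).
  by apply: bmeasM => //; exact: (bmeas_comp measurable_fst b1S).
have bSW' : bmeas (fun z : T * T => \1_S z.2 * W (z.2, z.1)).
  by apply: (bmeas_comp (phi := fun z : T * T => (z.2, z.1)) _ bSW); exact: measurable_fun_pair.
have [U mU leU] := maximize_weight bw (bmeas_fubini P bSW') w01.
have b1U : bmeas (\1_U : T -> R) by exact: bmeas_indic.
have mixed1 : bmeas (fun z : T * T => \1_S z.1 * (W z * w z.2)).
  by apply: bmeasM => //; exact: (bmeas_comp measurable_fst b1S).
have mixed2 : bmeas (fun z : T * T => \1_S z.1 * \1_U z.2 * W z).
  apply: bmeasM => //; apply: bmeasM.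
    exact: (bmeas_comp measurable_fst b1S).
  exact: (bmeas_comp measurable_snd b1U).
have -> : \int[P]_x \int[P]_y (W (x, y) * (u x * w y)) =
    \int[P]_x (u x * \int[P]_y (W (x, y) * w y)).
  apply: eq_Rintegral => x _; rewrite -expectZl; last exact: (bmeas_section x bWw).
  by apply: eq_Rintegral => y _; ring.
apply: (le_trans leS).
have -> : \int[P]_x (\1_S x * \int[P]_y (W (x, y) * w y)) =
    \int[P]_y (w y * \int[P]_x (\1_S x * W (x, y))).
  transitivity (\int[P]_x \int[P]_y (\1_S x * (W (x, y) * w y))).
    by apply: eq_Rintegral => x _; rewrite -expectZl//; exact: (bmeas_section x bWw).
  rewrite (expect_swap P P mixed1); apply: eq_Rintegral => y _.
  rewrite -expectZl; last exact: (bmeas_section2 y bSW).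
  by apply: eq_Rintegral => x _ /=; ring.
apply: (le_trans leU).
have -> : \int[P]_y (\1_U y * \int[P]_x (\1_S x * W (x, y))) =
    \int[P]_x \int[P]_y (\1_S x * \1_U y * W (x, y)).
  rewrite (expect_swap P P mixed2); apply: eq_Rintegral => y _.
  rewrite -expectZl; last exact: (bmeas_section2 y bSW).
  by apply: eq_Rintegral => x _ /=; ring.
by apply: le_trans (cW S U mS mU); exact: ler_norm.
Qed.

(** Resample the two ends of e0 and freeze the other coordinates.  No other
    edge joins these two ends, so the remaining product is a function of the
    first end times a function of the second one, as in [cut_le_weighted]. *)
Lemma hom_edge_le (W : T * T -> R) eps (K : 'I_v * 'I_v -> T * T -> R) e0 :
  bmeas W -> cut_le W eps -> Q e0 ->
  (forall e, bmeas (K e)) -> (forall e z, 0 <= K e z <= 1) ->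
  iexp P (fun x : v.-tuple T => W (tnth x e0.1, tnth x e0.2) *
    \prod_(e | Q e && (e != e0)) K e (tnth x e.1, tnth x e.2)) <= eps.
Proof.
move=> bW cW Qe0 bK K01.
set F := fun x => _.
have bF : bmeas F by apply: bmeasM; [exact: bmeas_pair|exact: bmeas_hom].
have ab : e0.1 != e0.2 by rewrite neq_ltn Qlt.
rewrite (iexp_resample2 e0.1 e0.2 bF) -[leRHS](iexp_cst P v).
apply: le_iexp => [||x]; [exact: bmeas_resample2|exact: bmeas_cst|].
(* an edge that contains the second end of e0 avoids the first one *)
pose touch (e : 'I_v * 'I_v) := (e.1 == e0.2) || (e.2 == e0.2).
pose U s := \prod_(e | (Q e && (e != e0)) && ~~ touch e)
  K e (tnth (tset x e0.1 s) e.1, tnth (tset x e0.1 s) e.2).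
pose V t := \prod_(e | (Q e && (e != e0)) && touch e)
  K e (tnth (tset x e0.2 t) e.1, tnth (tset x e0.2 t) e.2).
have mt a : measurable_fun setT (tset x a).
  exact: (measurableT_comp (measurable_tset a) (measurable_pair1 x)).
have UV01 (A : pred ('I_v * 'I_v)) (y : v.-tuple T) :
    0 <= \prod_(e | A e) K e (tnth y e.1, tnth y e.2) <= 1.
  apply/andP; split.
    by apply: prodr_ge0 => e _; have /andP[] := K01 e (tnth y e.1, tnth y e.2).
  by apply: prodr_ile1 => e _; exact: K01.
have bU : bmeas U.
  apply: (bmeas_comp (mt e0.1) (bmeas_hom _ bK)).
have bV : bmeas V.
  apply: (bmeas_comp (mt e0.2) (bmeas_hom _ bK)).
rewrite (_ : (\int[P]_s _) = \int[P]_s \int[P]_t (W (s, t) * (U s * V t))).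
  by apply: cut_le_weighted => // s; exact: UV01.
apply: eq_Rintegral => s _; apply: eq_Rintegral => t _.
rewrite /F !tnth_tset (negbTE ab) !eqxx; congr (_ * _).
rewrite (bigID touch)/= mulrC; congr (_ * _).
  apply: eq_bigr => e /andP[_]; rewrite negb_or => /andP[e1 e2].
  by rewrite !tnth_tset (negbTE e1) (negbTE e2).
apply: eq_bigr => e /andP[/andP[Qe ne0]] te.
rewrite !tnth_tset.
have e1 : e.1 != e0.1.
  apply: contra ne0 => /eqP e1; move: te; rewrite /touch e1 (negbTE ab) /= => /eqP e2.
  by rewrite [e]surjective_pairing [e0]surjective_pairing e1 e2.
have e2 : e.2 != e0.1.
  apply/eqP => e2; move: te; rewrite /touch e2 (negbTE ab) orbF => /eqP e1'.
  by have := Qlt Qe; rewrite e1' e2 ltnNge ltnW// Qlt.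
by rewrite (negbTE e1) (negbTE e2).
Qed.

(** Passing from g to f one edge at a time costs at most eps for each edge. *)
Lemma counting_lemma (f g : T * T -> R) eps :
  bmeas f -> bmeas g -> (forall z, 0 <= f z <= 1) -> (forall z, 0 <= g z <= 1) ->
  cut_le (fun z => f z - g z) eps ->
  hom_integral (fun=> f) <= hom_integral (fun=> g) + #|Q|%:R * eps.
Proof.
move=> bf bg f01 g01 cfg.
pose K (r : seq ('I_v * 'I_v)) e := if e \in r then f else g.
have bK r e : bmeas (K r e) by rewrite /K; case: ifP.
have K01 r e z : 0 <= K r e z <= 1 by rewrite /K; case: ifP.
have step r : uniq r -> {subset r <= Q} ->
    hom_integral (K r) <= hom_integral (fun=> g) + (size r)%:R * eps.
  elim: r => [_ _|e0 r IHr /= /andP[e0r ur] sr].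
    rewrite mul0r addr0 le_eqVlt; apply/orP; left; apply/eqP.
    by apply: eq_iexp => x; apply: eq_bigr => e _; rewrite /K.
  have Qe0 : Q e0 by apply: sr; rewrite inE eqxx.
  have {}IHr : hom_integral (K r) <= hom_integral (fun=> g) + (size r)%:R * eps.
    by apply: IHr => // e er; apply: sr; rewrite inE er orbT.
  rewrite -natr1 mulrDl mul1r addrA; apply: le_trans (lerD IHr (lexx _)).
  rewrite -lerBlDl.
  apply: le_trans (hom_edge_le (bmeasB bf bg) cfg Qe0 (bK r) (K01 r)).
  rewrite le_eqVlt; apply/orP; left; apply/eqP.
  rewrite -iexpB; [|exact: bmeas_hom..].
  apply: eq_iexp => x; rewrite (bigD1 e0)//= [X in _ - X](bigD1 e0)//= mulrBl.
  rewrite /K mem_head (negbTE e0r); congr (_ * _ - _).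
  apply: eq_bigr => e /andP[_ ne]; rewrite inE (negbTE ne)//.
have := step (enum Q) (enum_uniq Q); rewrite -cardE => H.
rewrite (_ : hom_integral (fun=> f) = hom_integral (K (enum Q))); first by apply: H => e; rewrite mem_enum.
by apply: eq_iexp => x; apply: eq_bigr => e Qe; rewrite /K mem_enum ifT.
Qed.

End hom_integral.

(** * Densities of block kernels *)

Section block_hom.
Context {R : realType} d0 (T : measurableType d0) (P : probability T R).
Context (v : nat) (Q : pred ('I_v * 'I_v)).
Hypothesis Qlt : forall e, Q e -> (e.1 < e.2)%N.
Context (m : nat) (beta : T -> 'I_m).
Hypothesis mbeta : forall i, measurable (beta @^-1` [set i]).

Definition block_indic (i : 'I_m) : T -> R := \1_(beta @^-1` [set i]).
Definition block_weight (i : 'I_m) : R := \int[P]_x block_indic i x.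

Lemma block_indicE i x : block_indic i x = (beta x == i)%:R.
Proof.
rewrite /block_indic indicE; congr (nat_of_bool _)%:R.
by apply/idP/eqP => [/set_mem|xi]; [|apply/mem_set].
Qed.

Lemma bmeas_block_indic i : bmeas (block_indic i).
Proof. exact: bmeas_indic. Qed.

Lemma block_indic_ge0 i x : 0 <= block_indic i x.
Proof. by rewrite block_indicE ler0n. Qed.

Lemma block_weight_ge0 i : 0 <= block_weight i.
Proof. by apply: expect_ge0 => x; exact: block_indic_ge0. Qed.

Definition block_kernel (q : 'M[R]_m) (z : T * T) : R := q (beta z.1) (beta z.2).

Definition pair_indic (i j : 'I_m) (z : T * T) : R :=
  block_indic i z.1 * block_indic j z.2.

Lemma pair_indicE i j z : pair_indic i j z = ((beta z.1 == i) && (beta z.2 == j))%:R.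
Proof. by rewrite /pair_indic !block_indicE -natrM mulnb. Qed.

Lemma pair_indic_ge0 i j z : 0 <= pair_indic i j z.
Proof. by rewrite pair_indicE ler0n. Qed.

Lemma bmeas_pair_indic i j : bmeas (pair_indic i j).
Proof.
apply: bmeasM.
  exact: (bmeas_comp measurable_fst (bmeas_block_indic i)).
exact: (bmeas_comp measurable_snd (bmeas_block_indic j)).
Qed.

Lemma sum_pair_indic (F : 'I_m -> 'I_m -> R) z :
  \sum_i \sum_j pair_indic i j z * F i j = F (beta z.1) (beta z.2).
Proof.
rewrite (bigD1 (beta z.1))//= (bigD1 (beta z.2))//= pair_indicE !eqxx mul1r.
rewrite big1 ?addr0 ?big1 ?addr0// => [i ni|j nj].
  by apply: big1 => j _; rewrite pair_indicE eq_sym (negbTE ni) mul0r.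
by rewrite pair_indicE [_ == j]eq_sym (negbTE nj) andbF mul0r.
Qed.

Lemma bmeas_block_dep (F : 'I_m -> 'I_m -> T * T -> R) : (forall i j, bmeas (F i j)) ->
  bmeas (fun z => F (beta z.1) (beta z.2) z).
Proof.
move=> bF.
have -> : (fun z => F (beta z.1) (beta z.2) z) =
    (fun z => \sum_i \sum_j pair_indic i j z * F i j z).
  by apply/funext => z; rewrite (sum_pair_indic (fun i j => F i j z)).
apply: bmeas_sum => i _; apply: bmeas_sum => j _.
by apply: bmeasM => //; exact: bmeas_pair_indic.
Qed.

Lemma bmeas_block_kernel q : bmeas (block_kernel q).
Proof.
by apply: (bmeas_block_dep (F := fun i j _ => q i j)) => i j; exact: bmeas_cst.
Qed.

(** The probability that the vertices fall in the blocks prescribed by s. *)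
Definition coloring_weight (s : {ffun 'I_v -> 'I_m}) : R :=
  \prod_a block_weight (s a).

Lemma coloring_weight_ge0 s : 0 <= coloring_weight s.
Proof. by apply: prodr_ge0 => a _; exact: block_weight_ge0. Qed.

Definition block_density (q : 'M[R]_m) : R :=
  \sum_(s : {ffun 'I_v -> 'I_m})
    coloring_weight s * \prod_(e | Q e) q (s e.1) (s e.2).

Definition coloring_indic (s : {ffun 'I_v -> 'I_m}) (x : v.-tuple T) : R :=
  \prod_a block_indic (s a) (tnth x a).

Lemma coloring_indicE s x :
  coloring_indic s x = (s == [ffun a => beta (tnth x a)])%:R.
Proof.
rewrite /coloring_indic; have [->|ns] := eqVneq.
  by apply: big1 => a _; rewrite block_indicE ffunE eqxx.
have /existsP[a na] : [exists a, s a != beta (tnth x a)].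
  apply: contraR ns; rewrite negb_exists => /forallP H.
  by apply/eqP/ffunP => a; rewrite ffunE; apply/eqP; rewrite -[_ == _]negbK H.
by rewrite (bigD1 a)//= block_indicE eq_sym (negbTE na) mul0r.
Qed.

Lemma bmeas_coloring_indic s : bmeas (coloring_indic s).
Proof.
apply: bmeas_prod => a _; apply: (bmeas_comp _ (bmeas_block_indic (s a))).
exact: measurable_tnth.
Qed.

Lemma sum_coloring_indic (F : {ffun 'I_v -> 'I_m} -> R) (x : v.-tuple T) :
  \sum_s coloring_indic s x * F s = F [ffun a => beta (tnth x a)].
Proof.
rewrite (bigD1 [ffun a => beta (tnth x a)])//= coloring_indicE eqxx mul1r.
by rewrite big1 ?addr0// => s ns; rewrite coloring_indicE (negbTE ns) mul0r.
Qed.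

Lemma iexp_coloring_indic s : iexp P (coloring_indic s) = coloring_weight s.
Proof.
by apply: (iexp_prod P (u := fun a => block_indic (s a))) => i; exact: bmeas_block_indic.
Qed.

Lemma hom_block_kernel q : hom_integral P Q (fun=> block_kernel q) = block_density q.
Proof.
rewrite /hom_integral /block_density.
transitivity (iexp P (fun x : v.-tuple T => \sum_s coloring_indic s x *
    \prod_(e | Q e) q (s e.1) (s e.2))).
  apply: eq_iexp => x; rewrite sum_coloring_indic.
  by apply: eq_bigr => e _; rewrite !ffunE.
rewrite iexp_sum; last first.
  by move=> s _; apply: bmeasM; [exact: bmeas_coloring_indic|exact: bmeas_cst].
apply: eq_bigr => s _; under eq_iexp do rewrite mulrC.
by rewrite iexpZ ?iexp_coloring_indic 1?mulrC//; exact: bmeas_coloring_indic.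
Qed.

Section regular.
Context (d : nat).
Hypothesis d_gt0 : (0 < d)%N.
Hypothesis Qreg : forall a,
  #|[pred e : 'I_v * 'I_v | Q e && ((e.1 == a) || (e.2 == a))]| = d.

(** Each vertex lies on d edges. *)
Lemma prod_edges_vertices (u : 'I_v -> R) :
  \prod_(e | Q e) (u e.1 * u e.2) = (\prod_a u a) ^+ d.
Proof.
transitivity (\prod_(e | Q e) \prod_(a | (e.1 == a) || (e.2 == a)) u a).
  apply: eq_bigr => e Qe; rewrite (bigD1 e.1) ?eqxx//=; congr *%R.
  have ne : e.1 != e.2 by rewrite neq_ltn Qlt.
  rewrite (big_pred1 e.2)// => a; rewrite pred1E -![a == _]eq_sym.
  by case: (eqVneq e.1 a) => [<-|]; rewrite ?andbF ?andbT//= eq_sym; apply/esym/negbTE.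
rewrite (exchange_big_dep predT)//= -prodrXl; apply: eq_bigr => a _.
by rewrite prodr_const -(Qreg a); congr (_ ^+ _); apply: eq_card.
Qed.

(** Sort the integral by the blocks in which the vertices fall, and apply
    Finner's inequality to each term with the indicators of the blocks attached
    to the edges: by regularity the d-th roots of their weights recombine into
    [coloring_weight]. *)
Lemma hom_le_block_density (f : T * T -> R) (N : 'M[R]_m) :
  bmeas f -> (forall z, 0 <= f z) ->
  (forall i j, 0 <= N i j) ->
  (forall i j, \int[(P \x P)%E]_z (pair_indic i j z * f z ^+ d) <=
     block_weight i * block_weight j * N i j ^+ d) ->
  hom_integral P Q (fun=> f) <= block_density N.
Proof.
move=> bf f0 N0 fN; rewrite /hom_integral.
pose fs (s : {ffun 'I_v -> 'I_m}) (e : 'I_v * 'I_v) (z : T * T) :=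
  pair_indic (s e.1) (s e.2) z * f z.
have bfs s e : bmeas (fs s e) by apply: bmeasM => //; exact: bmeas_pair_indic.
have -> : iexp P (fun x : v.-tuple T => \prod_(e | Q e) f (tnth x e.1, tnth x e.2)) =
    iexp P (fun x : v.-tuple T => \sum_s coloring_indic s x *
      \prod_(e | Q e) fs s e (tnth x e.1, tnth x e.2)).
  apply: eq_iexp => x; rewrite sum_coloring_indic; apply: eq_bigr => e _.
  by rewrite /fs/= !ffunE pair_indicE !eqxx mul1r.
rewrite iexp_sum; last first.
  move=> s _; apply: bmeasM; [exact: bmeas_coloring_indic|exact: bmeas_hom].
apply: ler_sum => s _.
have fs0 e z : 0 <= fs s e z.
  by rewrite mulr_ge0// pair_indic_ge0.
apply: (@le_trans _ _ (iexp P (fun x : v.-tuple T =>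
    \prod_(e | Q e) fs s e (tnth x e.1, tnth x e.2)))).
  apply: le_iexp => [||x].
  - by apply: bmeasM; [exact: bmeas_coloring_indic|exact: bmeas_hom].
  - exact: bmeas_hom.
  - rewrite ler_piMl//; first by apply: prodr_ge0.
    by rewrite coloring_indicE lern1 leq_b1.
pose ww e := block_weight (s e.1) * block_weight (s e.2).
have ww0 e : 0 <= ww e by rewrite mulr_ge0// block_weight_ge0.
have cw : \prod_(e | Q e) nroot d (ww e) = coloring_weight s.
  apply/eqP; rewrite -(@eqrXn2 _ d)//.
  - rewrite -prodrXl (eq_bigr ww); last by move=> e _; rewrite nrootK.
    by rewrite (prod_edges_vertices (fun a => block_weight (s a))).
  - by apply: prodr_ge0 => e _; exact: nroot_ge0.
  - exact: coloring_weight_ge0.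
rewrite -cw -big_split/=.
apply: (finner d_gt0 (F := fun e (x : v.-tuple T) => fs s e (tnth x e.1, tnth x e.2))
  (dep := fun e a => (e.1 == a) || (e.2 == a))) => //.
- by move=> e; exact: bmeas_pair.
- by move=> e x y H; rewrite /fs /pair_indic/= (H e.1) ?eqxx// (H e.2) ?eqxx ?orbT.
- by move=> e; rewrite mulr_ge0// nroot_ge0.
- move=> e Qe; have ne : e.1 != e.2 by rewrite neq_ltn Qlt.
  rewrite exprMn nrootK// (iexp_marginal2 P ne (bmeasX d (bfs s e))).
  apply: le_trans (fN (s e.1) (s e.2)); rewrite le_eqVlt; apply/orP; left; apply/eqP.
  rewrite -(expect_prod P P (F := fun z => fs s e z ^+ d)); last exact: bmeasX.
  apply: eq_Rintegral => z _; rewrite /fs exprMn; congr (_ * _).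
  by rewrite pair_indicE; case: (_ && _); rewrite ?expr1n// expr0n gtn_eqF.
Qed.

End regular.
End block_hom.

(** * Relative entropy *)

Section entropy.
Context {R : realType}.
Implicit Types p u a y w : R.

(** As ln 0 = 0, this is the relative entropy of u with respect to p, except
    when p is 0 or 1 and u <> p, where the latter is infinite. *)
Definition kl p u : R := u * ln (u / p) + (1 - u) * ln ((1 - u) / (1 - p)).

Lemma ln_le_sub1 (x : R) : 0 < x -> ln x <= x - 1.
Proof.
by move=> x0; rewrite -[leLHS]/(ln x) -{1}[x](subrK 1) addrC le_ln1Dx// ltrBrDl addrN.
Qed.

Lemma mul_ln_div y w : 0 <= y -> 0 < w -> y * ln (y / w) = y * ln y - y * ln w.
Proof.
rewrite le_eqVlt => /predU1P[<- _|y0 w0]; first by rewrite !mul0r subrr.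
by rewrite ln_div ?posrE// mulrBr.
Qed.

(** From ln x <= x - 1 at the square root of w / y: twice this inequality leaves
    (sqrt y - sqrt w)^2, which dominates the quadratic term. *)
Lemma mul_ln_ge y w : 0 <= y -> 0 < w ->
  y - w + (y - w) ^+ 2 / (2 * (y + w)) <= y * ln (y / w).
Proof.
rewrite le_eqVlt => /predU1P[<- w0|y0 w0].
  rewrite !mul0r !sub0r add0r sqrrN.
  have -> : w ^+ 2 / (2 * w) = w / 2 by field; rewrite gt_eqF.
  lra.
pose b := Num.sqrt y; pose c := Num.sqrt w.
have b0 : 0 < b by rewrite sqrtr_gt0.
have c0 : 0 < c by rewrite sqrtr_gt0.
have yE : y = b ^+ 2 by rewrite sqr_sqrtr// ltW.
have wE : w = c ^+ 2 by rewrite sqr_sqrtr// ltW.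
rewrite {}yE {}wE -expr_div_n lnXn ?divr_gt0//.
have H : 1 - c / b <= ln (b / c).
  have := @ln_le_sub1 (c / b) (divr_gt0 c0 b0).
  by rewrite -[c / b]invf_div lnV ?posrE ?divr_gt0//; lra.
have H2 : b ^+ 2 * (1 - c / b) = b ^+ 2 - b * c by field; rewrite gt_eqF.
have H3 : b ^+ 2 - b * c <= b ^+ 2 * ln (b / c).
  by rewrite -H2 ler_pM2l// exprn_gt0.
have H4 : (b ^+ 2 - c ^+ 2) ^+ 2 / (2 * (b ^+ 2 + c ^+ 2)) <= (b - c) ^+ 2.
  rewrite ler_pdivrMr; last by rewrite mulr_gt0// addr_gt0// exprn_gt0.
  rewrite -subr_ge0 (_ : _ - _ = ((b - c) ^+ 2) ^+ 2); first exact: sqr_ge0.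
  by ring.
rewrite -mulr_natr; lra.
Qed.

Lemma kl_expand p u : 0 < p < 1 -> 0 <= u <= 1 ->
  kl p u = u * ln u - u * ln p + ((1 - u) * ln (1 - u) - (1 - u) * ln (1 - p)).
Proof.
by move=> /andP[p0 p1] /andP[u0 u1]; rewrite /kl !mul_ln_div// ?subr_ge0 ?subr_gt0.
Qed.

Definition kl_slope p a : R := ln a - ln (1 - a) - ln p + ln (1 - p).

(** The divergence of kl p from its tangent at a does not involve p. *)
Lemma kl_split p a u : 0 < p < 1 -> 0 < a < 1 -> 0 <= u <= 1 ->
  kl p u = kl p a + kl_slope p a * (u - a) + kl a u.
Proof.
move=> p01 a01 u01; rewrite !kl_expand//; last by case/andP: a01 => /ltW -> /ltW ->.
by rewrite /kl_slope; ring.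
Qed.

Lemma kl_ge_log a u : 0 < a < 1 -> 0 <= u <= 1 ->
  (1 - u) * ln ((1 - u) / (1 - a)) - (1 - u) + (1 - a) <= kl a u.
Proof.
move=> /andP[a0 a1] /andP[u0 u1].
have := mul_ln_ge u0 a0.
have : 0 <= (u - a) ^+ 2 / (2 * (u + a)).
  by rewrite divr_ge0 ?sqr_ge0// mulr_ge0// addr_ge0// ltW.
rewrite /kl; lra.
Qed.

Lemma kl_ge_sqr a u : 0 < a < 1 -> 0 <= u <= 1 ->
  (u - a) ^+ 2 / (2 * ((1 - u) + (1 - a))) <= kl a u.
Proof.
move=> a01 u01; apply: le_trans (kl_ge_log a01 u01).
move: a01 u01 => /andP[a0 a1] /andP[u0 u1].
have := @mul_ln_ge (1 - u) (1 - a); rewrite subr_ge0 subr_gt0 => /(_ u1 a1).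
by rewrite (_ : (1 - u - (1 - a)) ^+ 2 = (u - a) ^+ 2); [lra|ring].
Qed.

Lemma kl_ge_quarter a u : 0 < a < 1 -> 0 <= u <= 1 -> (u - a) ^+ 2 / 4 <= kl a u.
Proof.
move=> a01 u01; apply: le_trans (kl_ge_sqr a01 u01).
move: a01 u01 => /andP[a0 a1] /andP[u0 u1].
apply: ler_wpM2l; first exact: sqr_ge0.
rewrite lef_pV2 ?posrE; lra.
Qed.

Lemma kl_self a : kl a a = 0.
Proof.
rewrite /kl; have [->|a0] := eqVneq a 0.
  by rewrite !mul0r subr0 divr1 ln1 mulr0 addr0.
have [->|a1] := eqVneq a 1.
  by rewrite subrr !mul0r divr1 ln1 mulr0 addr0.
by rewrite !divff// ?ln1 ?mulr0 ?addr0// subr_eq0 eq_sym.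
Qed.

Lemma kl_ge0 a u : 0 < a < 1 -> 0 <= u <= 1 -> 0 <= kl a u.
Proof.
move=> a01 u01; apply: le_trans (kl_ge_quarter a01 u01).
by rewrite divr_ge0// sqr_ge0.
Qed.

(** By [kl_split] the tangents of kl p lie below it and their supremum is kl p.
    Tangents at interior points suffice, also when u0 is 0 or 1, where the slope
    of kl p is infinite. *)
Lemma kl_lsc p u0 (e : R) : 0 < p < 1 -> 0 <= u0 <= 1 -> 0 < e ->
  exists2 K, 0 <= K & forall u, 0 <= u <= 1 ->
    kl p u0 - e - K * `|u - u0| <= kl p u.
Proof.
move=> p01 u01 e0.
have [a a01 klau] : exists2 a, 0 < a < 1 & kl a u0 <= e.
  have e1 : expR (- e) < 1 by rewrite expR_lt1 oppr_lt0.
  have [->|un0] := eqVneq u0 0.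
    (* here kl a 0 = - ln (1 - a) *)
    exists (1 - expR (- e)); first by rewrite subr_gt0 e1 gtrBl expR_gt0.
    rewrite /kl mul0r add0r subr0 mul1r opprB addrC subrK div1r lnV ?posrE ?expR_gt0//.
    by rewrite expRK opprK.
  have [->|un1] := eqVneq u0 1.
    (* here kl a 1 = - ln a *)
    exists (expR (- e)); first by rewrite expR_gt0.
    rewrite /kl subrr mul0r addr0 mul1r div1r lnV ?posrE ?expR_gt0//.
    by rewrite expRK opprK.
  exists u0; last by rewrite kl_self ltW.
  by move: u01; rewrite !le_eqVlt eq_sym (negbTE un0) (negbTE un1)/=.
exists `|kl_slope p a| => // u u01'.
rewrite (kl_split p01 a01 u01) (kl_split p01 a01 u01').
have := kl_ge0 a01 u01'.
have : - (`|kl_slope p a| * `|u - u0|) <= kl_slope p a * (u - u0).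
  by rewrite -normrM lerNl -normrN; exact: ler_norm.
have -> : kl_slope p a * (u - u0) =
  kl_slope p a * (u - a) - kl_slope p a * (u0 - a) by ring.
lra.
Qed.

Lemma pow_tangent (d : nat) a u : 0 <= a <= 1 -> 0 <= u <= 1 ->
  0 <= u ^+ d - a ^+ d - d%:R * a ^+ d.-1 * (u - a) <= (d ^ 2)%:R * (u - a) ^+ 2.
Proof.
move=> /andP[a0 a1] /andP[u0 u1]; elim: d => [|d /andP[IH0 IH1]].
  by rewrite !expr0 subrr !mul0r subrr lexx.
have E : u ^+ d.+1 - a ^+ d.+1 - d.+1%:R * a ^+ d.+1.-1 * (u - a) =
    u * (u ^+ d - a ^+ d - d%:R * a ^+ d.-1 * (u - a)) +
    d%:R * a ^+ d.-1 * (u - a) ^+ 2.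
  case: d {IH0 IH1} => [|d]; rewrite /= ?mul0r; first by rewrite !expr1 !expr0; ring.
  by rewrite !exprS -[d.+2%:R]natr1; ring.
have s0 : 0 <= (u - a) ^+ 2 by exact: sqr_ge0.
have ad0 : 0 <= a ^+ d.-1 by exact: exprn_ge0.
have ad1 : a ^+ d.-1 <= 1 by exact: exprn_ile1.
have dR : (0 : R) <= d%:R by exact: ler0n.
rewrite {}E; apply/andP; split.
  by rewrite addr_ge0// mulr_ge0// mulr_ge0.
have H1 : u * (u ^+ d - a ^+ d - d%:R * a ^+ d.-1 * (u - a)) <= (d ^ 2)%:R * (u - a) ^+ 2.
  by apply: le_trans IH1; rewrite ler_piMl.
have H2 : d%:R * a ^+ d.-1 * (u - a) ^+ 2 <= d%:R * (u - a) ^+ 2.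
  by rewrite ler_wpM2r// ler_piMr.
apply: (le_trans (lerD H1 H2)); rewrite -mulrDl ler_wpM2r// -natrD ler_nat.
by rewrite -!mulnn mulSnr mulnS [(d * d + d)%N]addnC leq_addr.
Qed.

End entropy.

(** * Relative entropy against powers *)

Section entropy_tangent.
Context {R : realType}.
Implicit Types p u a y w : R.

(** With L = - ln w, all these bounds hold for small w because L tends to
    infinity more slowly than the negative powers of w. *)
Lemma small_parameter (C D : R) : 0 <= C -> 1 <= D -> exists2 del, 0 < del < 1 &
  forall w, 0 < w -> w <= del ->
  [/\ (2 * D * (- ln w + C) + 1) * (4 * Num.sqrt w) <= 1,
      4 * (C + 2) <= - ln w,
      2 * D * (C + 2) * (8 * D + 4) <= - ln w &
      w * (2 * (8 * D + 4)) <= 1].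
Proof.
move=> C0 D1; pose s0 := (4 * (8 * D + 2 * D * C + 1))^-1.
have s00 : 0 < s0 by rewrite invr_gt0; nra.
(* w <= s0 ^+ 4 makes s = w ^ (1/4) small, w <= expR (- X) makes L large *)
pose X := 4 * (C + 2) + 2 * D * (C + 2) * (8 * D + 4).
pose z1 := (2 * (8 * D + 4))^-1.
have z10 : 0 < z1 by rewrite invr_gt0; lra.
have eX : 0 < expR (- X) by exact: expR_gt0.
exists (Num.min (2^-1) (Num.min (s0 ^+ 4) (Num.min (expR (- X)) z1))).
  rewrite !lt_min gt_min exprn_gt0// z10 eX invr_gt0 ltr0n/=.
  by rewrite invf_lt1//; lra.
move=> w w0; rewrite !le_min => /and4P[wh ws wX wz].
have LX : X <= - ln w.
  by rewrite lerNr -[leRHS]expRK; rewrite ler_ln ?posrE.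
have DC : 0 <= 2 * D * (C + 2) * (8 * D + 4) by rewrite !mulr_ge0//; lra.
have C2 : 0 <= 4 * (C + 2) by lra.
split; [|by rewrite /X in LX; lra|by rewrite /X in LX; lra|]; last first.
  rewrite -ler_pdivlMr; [by rewrite mul1r|lra].
pose s := Num.sqrt (Num.sqrt w).
have sw0 : 0 < Num.sqrt w by rewrite sqrtr_gt0.
have sp : 0 < s by rewrite sqrtr_gt0.
have s2 : Num.sqrt w = s ^+ 2 by rewrite sqr_sqrtr// ltW.
have s4 : w = s ^+ 4 by rewrite -[4%N]/(2 * 2)%N exprM -s2 sqr_sqrtr// ltW.
have ss0 : s <= s0.
  by rewrite -(@ler_pXn2r _ 4)// ?nnegrE -?s4// ltW.
have s1 : s <= 1.
  by rewrite -(@ler_pXn2r _ 4)// ?nnegrE ?ltW// -s4 expr1n; lra.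
have Ls : - ln w * s <= 4.
  have := @ln_le_sub1 _ s^-1; rewrite invr_gt0 lnV ?posrE// => /(_ sp) H.
  have {}H : - ln s * s <= 1 - s.
    by rewrite (_ : 1 - s = (s^-1 - 1) * s) ?ler_pM2r// mulrBl mulVf ?gt_eqF// mul1r.
  by rewrite s4 lnXn// -[ln s *+ 4]mulr_natr; nra.
have s0E : s * (4 * (8 * D + 2 * D * C + 1)) <= 1.
  rewrite -ler_pdivlMr; [by rewrite mul1r|nra].
rewrite s2.
have -> : (2 * D * (- ln w + C) + 1) * (4 * s ^+ 2) =
  s * (4 * (2 * D * (- ln w * s) + (2 * D * C + 1) * s)) by ring.
apply: le_trans s0E; rewrite ler_pM2l// ler_pM2l//.
have : 2 * D * (- ln w * s) <= 2 * D * 4 by rewrite ler_pM2l//; lra.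
have : (2 * D * C + 1) * s <= 2 * D * C + 1 by rewrite ler_piMr//; nra.
lra.
Qed.

(** The excess of u^d over its tangent at a, divided by the slope of that tangent:
    the loss incurred by averaging u^d in place of u. *)
Definition pow_gap (d : nat) a u : R :=
  (u ^+ d - a ^+ d - d%:R * a ^+ d.-1 * (u - a)) / (d%:R * a ^+ d.-1).

Section pow_gap_theory.
Context (d : nat) (a u : R).
Hypotheses (d_gt0 : (0 < d)%N) (a01 : 0 < a < 1) (u01 : 0 <= u <= 1).

Let D : R := d%:R.
Let D0 : 0 < D. Proof. by rewrite ltr0n. Qed.
Let a0 : 0 < a. Proof. by case/andP: a01. Qed.
Let a01w : 0 <= a <= 1. Proof. by case/andP: a01 => /ltW -> /ltW ->. Qed.
Let Da : 0 < D * a ^+ d.-1. Proof. by rewrite mulr_gt0// exprn_gt0. Qed.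

Lemma pow_gap_ge0 : 0 <= pow_gap d a u.
Proof.
by have /andP[E0 _] := pow_tangent d a01w u01; apply: divr_ge0 => //; exact: ltW.
Qed.

Lemma pow_gap_le_sqr : d%:R * (1 - a) <= 2^-1 -> pow_gap d a u <= 2 * D * (u - a) ^+ 2.
Proof.
move=> aD; have a1 : a <= 1 by case/andP: a01w.
have bernoulli k : 1 - k%:R * (1 - a) <= a ^+ k.
  elim: k => [|k IHk]; first by rewrite mul0r subr0.
  have ak1 : a ^+ k <= 1 by apply: exprn_ile1 => //; exact: ltW.
  have : (1 - a) * a ^+ k <= 1 - a by rewrite ler_piMr// subr_ge0.
  rewrite exprS -natr1; lra.
have ad : 2^-1 <= a ^+ d.-1.
  apply: le_trans (bernoulli d.-1).
  have : d.-1%:R * (1 - a) <= D * (1 - a).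
    by rewrite ler_wpM2r ?subr_ge0// ler_nat leq_pred.
  rewrite /D; lra.
have /andP[_ E1] := pow_tangent d a01w u01.
rewrite ler_pdivrMr//; apply: (le_trans E1); rewrite natrX -/D.
have -> : 2 * D * (u - a) ^+ 2 * (D * a ^+ d.-1) =
  D ^+ 2 * (u - a) ^+ 2 * (2 * a ^+ d.-1) by ring.
have s0 : 0 <= D ^+ 2 * (u - a) ^+ 2 by apply: mulr_ge0; exact: sqr_ge0.
by rewrite ler_peMr//; lra.
Qed.

Lemma pow_gap_le_lin : u <= a -> pow_gap d a u <= (a - u) * (1 - D^-1).
Proof.
move=> ua; have u0 : 0 <= u by case/andP: u01.
rewrite ler_pdivrMr// -/D.
have -> : (a - u) * (1 - D^-1) * (D * a ^+ d.-1) =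
    - (D * a ^+ d.-1 * (u - a)) - (a - u) * a ^+ d.-1 by field; rewrite gt_eqF.
have pow_pred (x : R) : x ^+ d = x * x ^+ d.-1 by rewrite -exprS prednK.
have : u * u ^+ d.-1 <= u * a ^+ d.-1.
  by apply: ler_wpM2l => //; apply: lerXn2r => //; rewrite nnegrE// ltW.
by rewrite !pow_pred; lra.
Qed.

End pow_gap_theory.

Section kl_vs_gap.
Context (a u L C D phi : R).
Hypotheses (a01 : 0 < a < 1) (u01 : 0 <= u <= 1).
Let y : R := 1 - u.
Let w : R := 1 - a.
Hypotheses (LE : L = - ln w) (C0 : 0 <= C) (D1 : 1 <= D) (LC0 : 0 <= L + C).
Hypothesis phi_sqr : phi <= 2 * D * (u - a) ^+ 2.

Let w0 : 0 < w. Proof. by rewrite subr_gt0; case/andP: a01. Qed.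
Let y0 : 0 <= y. Proof. by rewrite subr_ge0; case/andP: u01. Qed.
Let w_le_sqrt : w <= Num.sqrt w.
Proof.
have sw0 : 0 <= Num.sqrt w by exact: sqrtr_ge0.
have w1 : w <= 1 by rewrite gerBl; case/andP: a01 => /ltW.
apply: (@le_trans _ _ (Num.sqrt w ^+ 2)); first by rewrite sqr_sqrtr// ltW.
by rewrite expr2 ler_piMr//; have := ler_wsqrtr w1; rewrite sqrtr1.
Qed.
Let DLC : 0 <= 2 * D * (L + C).
Proof. by rewrite mulr_ge0// mulr_ge0//; exact: le_trans D1. Qed.

Lemma gap_le_sqr : (L + C) * phi + (u - a) ^+ 2 <= (2 * D * (L + C) + 1) * (u - a) ^+ 2.
Proof.
have H := ler_wpM2l LC0 phi_sqr; lra.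
Qed.

(** Here a quadratic lower bound for kl a u has the factor 1 / (4 sqrt w), against
    which the logarithm L is negligible. *)
Lemma kl_ge_gap_near : (2 * D * (L + C) + 1) * (4 * Num.sqrt w) <= 1 ->
  y <= Num.sqrt w -> (L + C) * phi + (u - a) ^+ 2 <= kl a u.
Proof.
move=> small yw; apply: (le_trans gap_le_sqr); apply: le_trans (kl_ge_sqr a01 u01).
have sw0 : 0 < Num.sqrt w by rewrite sqrtr_gt0.
have wsw := w_le_sqrt.
rewrite -/y -/w mulrC ler_wpM2l ?sqr_ge0//.
rewrite -[leRHS]mul1r ler_pdivlMr; last by rewrite mulr_gt0// ltr_wpDl.
apply: le_trans small; apply: ler_wpM2l; first by rewrite addr_ge0.
lra.
Qed.

(** Here kl a u is at least of the order of y ln (y / w) >= y L / 2, while phi L is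
    at most of the order of y^2 L, with y small. *)
Lemma kl_ge_gap_middle : 4 * (C + 2) <= L -> Num.sqrt w < y ->
  y * (8 * D + 4) <= 1 -> (L + C) * phi + (u - a) ^+ 2 <= kl a u.
Proof.
move=> largeL wy ysmall; apply: (le_trans gap_le_sqr).
have sw0 : 0 < Num.sqrt w by rewrite sqrtr_gt0.
have yp : 0 < y by exact: lt_trans wy.
have := kl_ge_log a01 u01; rewrite -/y -/w mul_ln_div//; apply: le_trans.
have lny : L / 2 <= ln y - ln w.
  have : ln (Num.sqrt w) <= ln y by rewrite ler_ln ?posrE// ltW.
  have : ln w = ln (Num.sqrt w) + ln (Num.sqrt w).
    by rewrite -lnM ?posrE// -expr2 sqr_sqrtr// ltW.
  by rewrite LE; lra.
have ylny : y * (L / 2) <= y * (ln y - ln w) by rewrite ler_pM2l.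
apply: (@le_trans _ _ (y * (L / 2 - 1))); last by have := w0; lra.
have K0 : 0 <= 2 * D * (L + C) + 1 by rewrite addr_ge0.
have wy2 : 0 <= w * (2 * y - w).
  apply: mulr_ge0; first exact: ltW.
  rewrite subr_ge0; apply: (le_trans w_le_sqrt); apply: (le_trans (ltW wy)).
  by rewrite ler_peMl ?ler1n// ltW.
have zy : (u - a) ^+ 2 <= y * y.
  have -> : u - a = w - y by rewrite /w /y; ring.
  by lra.
apply: le_trans (ler_wpM2l K0 zy) _; rewrite mulrCA ler_pM2l//.
have E8 : 0 < 8 * D + 4 by have := D1; lra.
rewrite -(ler_pM2r E8); apply: (@le_trans _ _ (2 * D * (L + C) + 1)).
  have : (2 * D * (L + C) + 1) * (y * (8 * D + 4)) <= 2 * D * (L + C) + 1 by rewrite ler_piMr.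
  by lra.
have DL : 0 <= D * (L - 4 * (C + 2)).
  by apply: mulr_ge0; [exact: le_trans D1|rewrite subr_ge0].
have DC : 0 <= D * C by apply: mulr_ge0 => //; exact: le_trans D1.
by have := D1; have := C0; lra.
Qed.

(** Here both sides are of the order of (a - u) L, and the factor 1 - 1 / D in the
    linear bound for phi is decisive. *)
Lemma kl_ge_gap_far : 2 * D * (C + 2) * (8 * D + 4) <= L ->
  w * (2 * (8 * D + 4)) <= 1 -> 1 < y * (8 * D + 4) ->
  (u <= a -> phi <= (a - u) * (1 - D^-1)) ->
  (L + C) * phi + (u - a) ^+ 2 <= kl a u.
Proof.
move=> largeL wsmall ylarge phi_lin.
have D0 : 0 < D by exact: lt_le_trans D1.
have E8 : 0 < 8 * D + 4 by have := D1; lra.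
have zE : a - u = y - w by rewrite /y /w; ring.
have zlarge : 1 <= (a - u) * (2 * (8 * D + 4)).
  by rewrite zE; lra.
have z0 : 0 <= a - u.
  by rewrite -(pmulr_lge0 _ (_ : 0 < 2 * (8 * D + 4))) ?mulr_gt0// (le_trans ler01).
have z1 : a - u <= 1 by case/andP: a01 => _ a1; case/andP: u01 => u0 _; lra.
have zsq : (u - a) ^+ 2 <= 1 by rewrite -sqrrN opprB exprn_ile1.
have kl_lin : (a - u) * L - 1 <= kl a u.
  apply: le_trans (kl_ge_log a01 u01); rewrite -/y -/w mul_ln_div//.
  have Y := mul_ln_ge y0 ltr01; rewrite divr1 in Y.
  have sq : 0 <= (y - 1) ^+ 2 / (2 * (y + 1)).
    by apply: divr_ge0; [exact: sqr_ge0|apply: mulr_ge0 => //; exact: addr_ge0].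
  have L0 : 0 <= L.
    apply: le_trans largeL; rewrite !mulr_ge0//; [exact: ltW|exact: addr_ge0|exact: ltW].
  have wL : 0 <= w * L by apply: mulr_ge0 => //; exact: ltW.
  rewrite zE; have -> : ln w = - L by rewrite LE opprK.
  by have := w0; lra.
apply: le_trans kl_lin.
have ua : u <= a by rewrite -subr_ge0.
have gap1 : (L + C) * phi <= (L + C) * ((a - u) * (1 - D^-1)).
  by apply: ler_wpM2l => //; exact: phi_lin.
have Dinv : 0 <= 1 - D^-1 <= 1 by rewrite subr_ge0 invf_le1// D1 gerBl invr_ge0 ltW.
have gapC : C * ((a - u) * (1 - D^-1)) <= C.
  by rewrite ler_piMr// mulr_ile1//; case/andP: Dinv.
have zL : C + 2 <= (a - u) * L / D.
  rewrite ler_pdivlMr//.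
  apply: (@le_trans _ _ ((a - u) * (2 * D * (C + 2) * (8 * D + 4)))); last exact: ler_wpM2l.
  have -> : (a - u) * (2 * D * (C + 2) * (8 * D + 4)) =
    (C + 2) * D * ((a - u) * (2 * (8 * D + 4))) by ring.
  by rewrite ler_peMr// mulr_ge0// ?addr_ge0// ltW.
by lra.
Qed.

End kl_vs_gap.

(** The convexity behind Jensen's inequality for L^d averages close to 1.  By
    [kl_split] it amounts to a comparison of kl a u with the slope of kl p at a
    times [pow_gap], and this slope is ln (1 / (1 - a)) up to a constant. *)
Lemma kl_power_tangent p d : 0 < p < 1 -> (0 < d)%N ->
  exists2 del, 0 < del < 1 & forall a, 1 - del <= a -> a < 1 ->
  exists lam, forall u, 0 <= u <= 1 ->
    kl p a + lam * (u ^+ d - a ^+ d) + (u - a) ^+ 2 <= kl p u.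
Proof.
move=> p01 d_gt0; pose D : R := d%:R.
have D1 : 1 <= D by rewrite ler1n.
pose C := `|ln p| + `|ln (1 - p)|.
have C0 : 0 <= C by rewrite addr_ge0.
have [del del01 Hdel] := small_parameter C0 D1.
exists del => // a adel a1; have /andP[del0 del1] := del01.
have a0 : 0 < a by lra.
have a01 : 0 < a < 1 by rewrite a0 a1.
pose w := 1 - a; have w0 : 0 < w by rewrite subr_gt0.
have wdel : w <= del by rewrite /w; lra.
have [i1 i2 i3 i4] := Hdel w w0 wdel.
set L := - ln w in i1 i2 i3.
have LC0 : 0 <= L + C by lra.
have slopeL : kl_slope p a <= L + C.
  have la : ln a <= 0 by apply: ln_le0; rewrite ltW.
  have := ler_norm (- ln p); have := ler_norm (ln (1 - p)).
  by rewrite normrN /C /kl_slope /L /w; lra.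
have Da : 0 < D * a ^+ d.-1 by rewrite mulr_gt0 ?exprn_gt0// ltr0n.
exists (kl_slope p a / (D * a ^+ d.-1)) => u u01.
have phi0 := pow_gap_ge0 d_gt0 a01 u01.
have phi_sqr : pow_gap d a u <= 2 * D * (u - a) ^+ 2.
  apply: pow_gap_le_sqr => //; rewrite -/D -/w.
  have : w * D * 16 <= w * (2 * (8 * D + 4)) by rewrite -mulrA ler_pM2l//; lra.
  by lra.
have phi_lin := pow_gap_le_lin d_gt0 a01 u01.
rewrite (kl_split p01 a01 u01).
have -> : kl_slope p a / (D * a ^+ d.-1) * (u ^+ d - a ^+ d) =
    kl_slope p a * (u - a) + kl_slope p a * pow_gap d a u.
  by rewrite /pow_gap -/D; field; rewrite ?gt_eqF ?exprn_gt0// ltr0n.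
suff : (L + C) * pow_gap d a u + (u - a) ^+ 2 <= kl a u.
  by have := ler_wpM2r phi0 slopeL; lra.
have [near|far] := leP (1 - u) (Num.sqrt w); first exact: kl_ge_gap_near i1 near.
have [middle|] := leP ((1 - u) * (8 * D + 4)) 1; first exact: kl_ge_gap_middle i2 far middle.
by move=> large; exact: (kl_ge_gap_far a01 u01 erefl C0 D1 LC0 i3 i4 large phi_lin).
Qed.

End entropy_tangent.

(** * Symmetrization over blocks *)

Section kl_measurable.
Context {R : realType}.

Lemma boundary_or_interior (x : R) : 0 <= x <= 1 -> (x = 0 \/ x = 1) \/ 0 < x < 1.
Proof.
move=> /andP[x0 x1]; have [->|xn0] := eqVneq x 0; first by left; left.
have [->|xn1] := eqVneq x 1; first by left; right.
by right; rewrite !lt_neqAle eq_sym xn0 xn1 x0.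
Qed.

Lemma mul_ln_bounded (p u : R) : 0 <= p -> 0 <= u <= 1 ->
  `|u * ln (u / p)| <= 1 + `|ln p|.
Proof.
move=> p0 /andP[u0 u1].
have [->|pn0] := eqVneq p 0.
  by rewrite invr0 mulr0 ln0// mulr0 normr0 addr_ge0.
have pp : 0 < p by rewrite lt_neqAle eq_sym pn0.
rewrite mul_ln_div//; apply: le_trans (ler_normB _ _) _; apply: lerD; last first.
  by rewrite normrM ger0_norm// ler_piMl.
have := mul_ln_ge u0 ltr01; rewrite divr1.
have : 0 <= (u - 1) ^+ 2 / (2 * (u + 1)) by rewrite divr_ge0 ?sqr_ge0//; lra.
have : u * ln u <= 0 by rewrite mulr_ge0_le0// ln_le0.
by move=> *; rewrite ler_norml; apply/andP; split; lra.
Qed.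

Lemma bmeas_kl d0 (T : measurableType d0) (p : R) (f : T -> R) : 0 <= p <= 1 ->
  bmeas f -> (forall x, 0 <= f x <= 1) -> bmeas (fun x => kl p (f x)).
Proof.
move=> /andP[p0 p1] bf f01.
have half (r : R) (g : T -> R) : 0 <= r -> bmeas g -> (forall x, 0 <= g x <= 1) ->
    bmeas (fun x => g x * ln (g x / r)).
  move=> r0 bg g01; split.
    apply: measurable_funM; first exact: bg.1.
    apply: measurableT_comp => //; apply: measurable_funM => //; exact: bg.1.
  by exists (1 + `|ln r|) => x; exact: mul_ln_bounded.
apply: bmeasD; first exact: half.
apply: (half _ (fun x => 1 - f x)); first by rewrite subr_ge0.
  by apply: bmeasB => //; exact: bmeas_cst.
by move=> x; have := f01 x; lra.
Qed.

Lemma kl_ge_boundary (p u : R) : p = 0 \/ p = 1 -> 0 <= u <= 1 -> - `|u - p| <= kl p u.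
Proof.
have aux (y : R) : 0 <= y -> y - 1 <= y * ln y.
  move=> y0; have := mul_ln_ge y0 ltr01; rewrite divr1.
  have : 0 <= (y - 1) ^+ 2 / (2 * (y + 1)) by rewrite divr_ge0 ?sqr_ge0//; lra.
  lra.
move=> [->|->] /andP[u0 u1]; rewrite /kl.
  rewrite invr0 mulr0 ln0// mulr0 add0r !subr0 divr1 ger0_norm//.
  by have := aux (1 - u); rewrite subr_ge0 => /(_ u1); lra.
rewrite subrr invr0 mulr0 [ln 0]ln0// mulr0 addr0 divr1 -normrN ger0_norm; last lra.
by have := aux u u0; lra.
Qed.
End kl_measurable.

Section symmetrization.
Context {R : realType} d0 (T : measurableType d0) (P : probability T R).
Context (v : nat) (Q : pred ('I_v * 'I_v)).
Hypothesis Qlt : forall e, Q e -> (e.1 < e.2)%N.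
Context (m : nat) (beta : T -> 'I_m).
Hypothesis mbeta : forall i, measurable (beta @^-1` [set i]).
Context (d : nat).
Hypothesis d_gt0 : (0 < d)%N.
Hypothesis Qreg : forall a,
  #|[pred e : 'I_v * 'I_v | Q e && ((e.1 == a) || (e.2 == a))]| = d.

Let PP : probability (T * T)%type R := (P \x P)%E.
Let w := block_weight P beta.
Let w0 i : 0 <= w i. Proof. exact: block_weight_ge0. Qed.
Let ind : 'I_m -> 'I_m -> T * T -> R := pair_indic beta.

Definition block_int i j (G : T * T -> R) : R := \int[PP]_z (ind i j z * G z).

Let bind i j : bmeas (ind i j). Proof. exact: bmeas_pair_indic. Qed.
Let ind0 i j z : 0 <= ind i j z.
Proof. exact: pair_indic_ge0. Qed.

Lemma block_int_le i j F G : bmeas F -> bmeas G -> (forall z, F z <= G z) ->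
  block_int i j F <= block_int i j G.
Proof.
by move=> bF bG FG; apply: le_expect => [||z]; [exact: bmeasM|exact: bmeasM|exact: ler_wpM2l].
Qed.

Lemma block_int_cst i j c : block_int i j (fun=> c) = c * (w i * w j).
Proof.
rewrite /block_int; under eq_Rintegral do rewrite mulrC.
rewrite (expectZl PP)//; congr *%R; rewrite (expect_prod P P)//.
transitivity (\int[P]_x (w j * block_indic beta i x)); last first.
  by rewrite expectZl 1?mulrC//; exact: bmeas_block_indic.
apply: eq_Rintegral => x _; rewrite mulrC -expectZl//; exact: bmeas_block_indic.
Qed.

Lemma block_intD i j F G : bmeas F -> bmeas G ->
  block_int i j (fun z => F z + G z) = block_int i j F + block_int i j G.
Proof.
move=> bF bG; rewrite /block_int -(expectD PP); [|exact: bmeasM|exact: bmeasM].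
by apply: eq_Rintegral => z _; rewrite mulrDr.
Qed.

Lemma block_intZ i j c F : bmeas F ->
  block_int i j (fun z => c * F z) = c * block_int i j F.
Proof.
move=> bF; rewrite /block_int -(expectZl PP); last exact: bmeasM.
by apply: eq_Rintegral => z _; rewrite mulrCA.
Qed.

Lemma block_int_ge0 i j F : (forall z, 0 <= F z) -> 0 <= block_int i j F.
Proof. by move=> F0; apply: expect_ge0 => z; exact: mulr_ge0. Qed.

Lemma block_intE (F : 'I_m -> 'I_m -> T * T -> R) : (forall i j, bmeas (F i j)) ->
  \int[PP]_z F (beta z.1) (beta z.2) z = \sum_i \sum_j block_int i j (F i j).
Proof.
move=> bF.
transitivity (\int[PP]_z \sum_i \sum_j ind i j z * F i j z).
  by apply: eq_Rintegral => z _; rewrite (sum_pair_indic beta (fun i j => F i j z)).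
rewrite (expect_sum PP); last by move=> i _; apply: bmeas_sum => j _; exact: bmeasM.
apply: eq_bigr => i _; rewrite (expect_sum PP)//.
by move=> j _; exact: bmeasM.
Qed.

(** The L^d norms of f on the blocks for the normalized measures; a block of
    measure 0 gets the value 0. *)
Definition block_norm (f : T * T -> R) : 'M[R]_m := \matrix_(i, j)
  nroot d (block_int i j (fun z => f z ^+ d) / (w i * w j)).

Section block_norm_theory.
Context (f : T * T -> R).
Hypothesis bf : bmeas f.
Hypothesis f01 : forall z, 0 <= f z <= 1.

Let ww0 i j : 0 <= w i * w j. Proof. exact: mulr_ge0. Qed.

Lemma block_norm_ge0 i j : 0 <= block_norm f i j.
Proof. by rewrite mxE nroot_ge0. Qed.

Let fd0 z : 0 <= f z ^+ d.
Proof. by apply: exprn_ge0; have /andP[] := f01 z. Qed.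

Let fd1 z : f z ^+ d <= 1.
Proof. by have /andP[? ?] := f01 z; exact: exprn_ile1. Qed.

Lemma block_int_pow_le i j : 0 <= block_int i j (fun z => f z ^+ d) <= w i * w j.
Proof.
apply/andP; split; first exact: block_int_ge0.
rewrite -[leRHS]mul1r -block_int_cst; apply: block_int_le => //.
  exact: bmeasX.
exact: bmeas_cst.
Qed.

Lemma block_normK i j :
  w i * w j * block_norm f i j ^+ d = block_int i j (fun z => f z ^+ d).
Proof.
have /andP[I0 I1] := block_int_pow_le i j.
rewrite mxE nrootK//; last exact: divr_ge0.
have [ww|/eqP ww] := eqVneq (w i * w j) 0; last first.
  by rewrite mulrC mulfVK//; exact/eqP.
by rewrite ww mul0r; apply/le_anti; rewrite I0 -ww.
Qed.

Lemma block_norm_le1 i j : block_norm f i j <= 1.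
Proof.
have /andP[I0 I1] := block_int_pow_le i j.
rewrite -(@ler_pXn2r _ d)// ?nnegrE ?block_norm_ge0// expr1n mxE nrootK//; last first.
  exact: divr_ge0.
have := ww0 i j; rewrite le_eqVlt => /predU1P[<-|ww]; first by rewrite invr0 mulr0.
by rewrite ler_pdivrMr// mul1r.
Qed.

Lemma block_norm_sym : (forall x y, f (x, y) = f (y, x)) ->
  (block_norm f)^T = block_norm f.
Proof.
move=> fs; apply/matrixP => i j; rewrite !mxE [w j * _]mulrC; congr (nroot d (_ / _)).
rewrite /block_int (expect_prod P P); last by apply: bmeasM => //; exact: bmeasX.
rewrite (expect_swap P P (F := fun z => ind j i z * f z ^+ d)); last first.
  by apply: bmeasM => //; exact: bmeasX.
rewrite (expect_prod P P); last by apply: bmeasM => //; exact: bmeasX.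
apply: eq_Rintegral => x _; apply: eq_Rintegral => y _.
by rewrite /ind /pair_indic/= fs; congr (_ * _); rewrite mulrC.
Qed.

Lemma hom_le_block_norm : hom_integral P Q (fun=> f) <= block_density P Q beta (block_norm f).
Proof.
apply: (hom_le_block_density Qlt mbeta d_gt0 Qreg bf) => [z|i j|i j].
- by have /andP[] := f01 z.
- exact: block_norm_ge0.
by rewrite block_normK.
Qed.

End block_norm_theory.

Context (p : 'M[R]_m).
Hypothesis p01 : forall i j, 0 <= p i j <= 1.

(** What a finite rate says about a graphon, as a kernel. *)
Definition admissible (f : T * T -> R) := [/\ bmeas f, forall z, 0 <= f z <= 1,
  forall x y, f (x, y) = f (y, x) &
  forall i j, p i j = 0 \/ p i j = 1 -> block_int i j (fun z => `|f z - p i j|) = 0].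

Definition top_block : 'M[R]_m := \matrix_(i, j) (0 < p i j)%R%:R.

Lemma coloring_weight_gt0 (s : {ffun 'I_v -> 'I_m}) a :
  0 < coloring_weight P beta s -> 0 < w (s a).
Proof.
move=> cs; rewrite lt_neqAle w0 andbT; apply/eqP => wa.
by move: cs; rewrite /coloring_weight (bigD1 a)//= -/(w _) -wa mul0r ltxx.
Qed.

(** On a block of positive measure where p = 0 an admissible f vanishes. *)
Lemma block_norm_le_top f i j : admissible f -> 0 < w i -> 0 < w j ->
  block_norm f i j <= top_block i j.
Proof.
move=> [bf f01 _ fp] wi wj; rewrite [top_block i j]mxE.
have [pij|] := ltP 0 (p i j); first exact: block_norm_le1.
move=> pij; have pij0 : p i j = 0 by apply/le_anti; rewrite pij; case/andP: (p01 i j).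
have bfd := bmeasX d bf.
have : w i * w j * block_norm f i j ^+ d <= 0.
  rewrite block_normK// -(fp i j (or_introl pij0)); apply: block_int_le => //.
    by apply: bmeas_norm; apply: bmeasB => //; exact: bmeas_cst.
  move=> z; have /andP[fz0 fz1] := f01 z.
  rewrite pij0 subr0 ger0_norm// -(prednK d_gt0) exprS ler_piMr//.
  exact: exprn_ile1.
rewrite pmulr_rle0; last exact: mulr_gt0.
move=> Nd; rewrite leNgt; apply/negP => N0.
by move: Nd; rewrite leNgt exprn_gt0.
Qed.

Let cw0 (s : {ffun 'I_v -> 'I_m}) : 0 <= coloring_weight P beta s :> R.
Proof. exact: coloring_weight_ge0. Qed.

Lemma coloring_term_le f (s : {ffun 'I_v -> 'I_m}) : admissible f ->
  coloring_weight P beta s * \prod_(e | Q e) block_norm f (s e.1) (s e.2) <=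
  coloring_weight P beta s * \prod_(e | Q e) top_block (s e.1) (s e.2).
Proof.
move=> af; have := cw0 s; rewrite le_eqVlt => /predU1P[<-|cs]; first by rewrite !mul0r.
rewrite ler_pM2l//; apply: ler_prod => e Qe; rewrite block_norm_ge0/=.
by apply: block_norm_le_top => //; exact: coloring_weight_gt0.
Qed.

Lemma hom_le_top f : admissible f ->
  hom_integral P Q (fun=> f) <= block_density P Q beta top_block.
Proof.
move=> af; have [bf f01 _ _] := af.
apply: (le_trans (hom_le_block_norm bf f01)).
by apply: ler_sum => s _; exact: coloring_term_le.
Qed.

(** The colorings that contribute to the maximal density. *)
Definition active (s : {ffun 'I_v -> 'I_m}) :=
  (0 < coloring_weight P beta s) && [forall (e | Q e), 0 < p (s e.1) (s e.2)].

(** No coloring contributes more to the bound of [hom_le_block_norm] than to the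
    maximal density, and the contribution of s is moreover multiplied by a number
    at most the norm of f at the edge e. *)
Lemma hom_active_gap f s e : admissible f -> active s -> Q e ->
  hom_integral P Q (fun=> f) <= block_density P Q beta top_block -
    coloring_weight P beta s * (1 - block_norm f (s e.1) (s e.2)).
Proof.
move=> af /andP[cs /forall_inP ps] Qe; have [bf f01 _ _] := af.
apply: (le_trans (hom_le_block_norm bf f01)).
rewrite /block_density (bigD1 s)//= [X in _ <= X - _](bigD1 s)//= -addrAC.
apply: lerD; last by apply: ler_sum => t _; exact: coloring_term_le.
rewrite [X in _ <= _ * X - _]big1; last by move=> e' Qe'; rewrite mxE ps.
rewrite mulr1 mulrBr mulr1 opprB addrC subrK ler_pM2l// (bigD1 e)//=.
rewrite ler_piMr ?block_norm_ge0//; apply: prodr_ile1 => e' _.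
by rewrite block_norm_ge0 block_norm_le1.
Qed.

(** The blocks whose values enter the maximal density. *)
Definition relevant i j := [exists s, active s &&
  [exists (e | Q e), ((s e.1, s e.2) == (i, j)) || ((s e.2, s e.1) == (i, j))]].

(** Off the relevant blocks the L^d average of f need not be close to 1.  There p
    is a better value: it has no entropy, and it does not affect the density. *)
Definition symmetrize f : 'M[R]_m := \matrix_(i, j)
  if relevant i j && (0 < p i j < 1) then block_norm f i j else p i j.

Hypothesis psym : p^T = p.

Lemma symmetrize_sym f : admissible f -> (symmetrize f)^T = symmetrize f.
Proof.
move=> [bf f01 fs _]; apply/matrixP => i j.
have pji : p j i = p i j by rewrite -[in LHS]psym mxE.
have rji : relevant j i = relevant i j.
  apply: eq_existsb => s; congr (_ && _); apply: eq_existsb => e; congr (_ && _).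
  have swap (a b : 'I_m) : ((a, b) == (j, i)) = ((b, a) == (i, j)).
    by rewrite !xpair_eqE andbC.
  by rewrite !swap orbC.
have Nji : block_norm f j i = block_norm f i j.
  by rewrite -[in RHS](block_norm_sym bf fs) [RHS]mxE.
rewrite mxE [LHS]mxE [RHS]mxE pji rji Nji; exact: erefl.
Qed.

Lemma symmetrize01 f i j : admissible f -> 0 <= symmetrize f i j <= 1.
Proof.
move=> [bf f01 _ _]; rewrite [symmetrize f i j]mxE; case: ifP => _ //.
by rewrite block_norm_ge0 block_norm_le1.
Qed.

Lemma symmetrize_boundary f i j : p i j = 0 \/ p i j = 1 -> symmetrize f i j = p i j.
Proof. by rewrite [symmetrize f i j]mxE => -[->|->]; rewrite ltxx ?andbF. Qed.

Lemma active_relevant s e : active s -> Q e -> relevant (s e.1) (s e.2).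
Proof.
move=> acs Qe; apply/existsP; exists s; rewrite acs/=.
by apply/exists_inP; exists e => //; rewrite eqxx.
Qed.

(** A coloring that is not active but has positive weight contains an edge on
    which p, and hence the norm of f, vanishes. *)
Lemma block_density_symmetrize f : admissible f ->
  block_density P Q beta (block_norm f) <= block_density P Q beta (symmetrize f).
Proof.
move=> af; have [bf f01 fs _] := af; apply: ler_sum => s _.
have := cw0 s; rewrite le_eqVlt => /predU1P[<-|cs]; first by rewrite !mul0r.
rewrite ler_pM2l//.
have [/forall_inP ps|] := boolP [forall (e | Q e), 0 < p (s e.1) (s e.2)].
  have acs : active s by rewrite /active cs; exact/forall_inP.
  apply: ler_prod => e Qe; rewrite block_norm_ge0/=.
  rewrite [symmetrize f _ _]mxE active_relevant//= ps//=; case: ltP => // p1.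
  by apply: le_trans p1; exact: block_norm_le1.
move=> /forall_inPn[e Qe pe].
have -> : \prod_(e0 | Q e0) block_norm f (s e0.1) (s e0.2) = 0.
  rewrite (bigD1 e)//=; apply/eqP; rewrite mulf_eq0; apply/orP; left.
  rewrite eq_le block_norm_ge0 andbT.
  apply: le_trans (block_norm_le_top af _ _) _; [exact: coloring_weight_gt0..|].
  by rewrite mxE (negbTE pe).
by apply: prodr_ge0 => e' _; have /andP[] := symmetrize01 (s e'.1) (s e'.2) af.
Qed.

(** The average of f^d over the block is the d-th power of its norm a, so the
    linear term of the tangent at a integrates to 0.  There is no tangent at
    a = 1, but then f = 1 almost everywhere on the block, and semicontinuity of
    the entropy at 1 suffices. *)
Lemma block_gain (q : R) f i j (del : R) : admissible f ->
  0 < p i j < 1 -> 0 < w i -> 0 < w j ->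
  (forall a, 1 - del <= a -> a < 1 -> exists lam, forall u, 0 <= u <= 1 ->
    kl (p i j) a + lam * (u ^+ d - a ^+ d) + (u - a) ^+ 2 <= kl (p i j) u) ->
  1 - del <= block_norm f i j -> q = block_norm f i j ->
  kl (p i j) q * (w i * w j) + 4^-1 * block_int i j (fun z => (f z - q) ^+ 2) <=
  block_int i j (fun z => kl (p i j) (f z)).
Proof.
move=> [bf f01 _ _] pij wi wj tang delN ->; set a := block_norm f i j.
have ww : 0 < w i * w j by exact: mulr_gt0.
have bc (c : R) : bmeas (fun _ : T * T => c) by exact: bmeas_cst.
have bk : bmeas (fun z => kl (p i j) (f z)).
  by apply: bmeas_kl => //; have /andP[/ltW -> /ltW ->] := pij.
have bd : bmeas (fun z => f z ^+ d) by exact: bmeasX.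
have b2 : bmeas (fun z => (f z - a) ^+ 2) by apply: bmeasX; exact: bmeasB.
have s0 : 0 <= block_int i j (fun z => (f z - a) ^+ 2).
  by apply: block_int_ge0 => z; exact: sqr_ge0.
have IN := block_normK bf f01 i j; rewrite -/a in IN.
have a1 : a <= 1 by exact: block_norm_le1.
have := a1; rewrite le_eqVlt => /predU1P[aE|a_lt1].
- have I0 : block_int i j (fun z => `|f z - 1|) = 0.
    apply/le_anti; rewrite block_int_ge0// andbT.
    apply: (@le_trans _ _ (block_int i j (fun z => 1 + (-1) * f z ^+ d))).
      apply: block_int_le => [||z].
      + by apply: bmeas_norm; exact: bmeasB.
      + by apply: bmeasD => //; exact: bmeasZ.
      + have /andP[fz0 fz1] := f01 z; rewrite -normrN ger0_norm; last lra.
        have : f z ^+ d <= f z by rewrite -(prednK d_gt0) exprS ler_piMr// exprn_ile1.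
        lra.
    rewrite block_intD//; last exact: bmeasZ.
    by rewrite block_intZ// -IN aE expr1n block_int_cst; lra.
  have I2 : block_int i j (fun z => (f z - a) ^+ 2) <= 0.
    rewrite -I0; apply: block_int_le => // [|z].
      by apply: bmeas_norm; exact: bmeasB.
    have /andP[fz0 fz1] := f01 z; rewrite aE -normrN ger0_norm; last lra.
    nra.
  suff : kl (p i j) a * (w i * w j) <= block_int i j (fun z => kl (p i j) (f z)) by lra.
  apply/ler_addgt0Pr => e e0.
  have e1 : 0 < e / (w i * w j) by exact: divr_gt0.
  have u01 : 0 <= (1 : R) <= 1 by rewrite ler01 lexx.
  have [K K0 HK] := kl_lsc pij u01 e1.
  have bK : bmeas (fun z => - K * `|f z - 1|) by apply: bmeasZ; apply: bmeas_norm; exact: bmeasB.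
  have : block_int i j (fun z => (kl (p i j) 1 - e / (w i * w j)) + (- K) * `|f z - 1|) <=
      block_int i j (fun z => kl (p i j) (f z)).
    apply: block_int_le => // [|z]; first exact: bmeasD.
    by rewrite mulNr; exact: HK.
  rewrite block_intD// block_intZ; last by apply: bmeas_norm; exact: bmeasB.
  rewrite I0 block_int_cst mulrBl mulfVK ?gt_eqF// aE; lra.
- have [lam Hlam] := tang a delN a_lt1.
  have bl : bmeas (fun z => lam * f z ^+ d) by exact: bmeasZ.
  apply: (@le_trans _ _ (block_int i j (fun z =>
      (kl (p i j) a - lam * a ^+ d) + (lam * f z ^+ d + (f z - a) ^+ 2)))).
    rewrite block_intD; [|exact: bc|exact: bmeasD].
    rewrite (block_intD _ _ bl b2) block_intZ// block_int_cst -IN; lra.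
  apply: block_int_le => [||z]; [|exact: bk|].
    by apply: bmeasD; [exact: bc|exact: bmeasD].
  by have := Hlam _ (f01 z); lra.
Qed.

Definition kl_integral (f : T * T -> R) : R :=
  \int[PP]_z kl (p (beta z.1) (beta z.2)) (f z).

Lemma bmeas_kl_block (f : T * T -> R) i j : bmeas f -> (forall z, 0 <= f z <= 1) ->
  bmeas (fun z => kl (p i j) (f z)).
Proof. by move=> bf f01; exact: bmeas_kl. Qed.

Lemma kl_integralE (f : T * T -> R) : bmeas f -> (forall z, 0 <= f z <= 1) ->
  kl_integral f = \sum_i \sum_j block_int i j (fun z => kl (p i j) (f z)).
Proof.
move=> bf f01.
apply: (block_intE (F := fun i j z => kl (p i j) (f z))) => i j.
exact: bmeas_kl_block.
Qed.

Lemma kl_integral_block (q : 'M[R]_m) :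
  kl_integral (block_kernel beta q) = \sum_i \sum_j kl (p i j) (q i j) * (w i * w j).
Proof.
rewrite /kl_integral.
rewrite (block_intE (F := fun i j _ => kl (p i j) (q i j))); last first.
  by move=> i j; exact: bmeas_cst.
by apply: eq_bigr => i _; apply: eq_bigr => j _; rewrite block_int_cst.
Qed.

Lemma block_gain_boundary f i j : admissible f ->
  symmetrize f i j = p i j \/ w i * w j = 0 ->
  kl (p i j) (symmetrize f i j) * (w i * w j) +
    4^-1 * block_int i j (fun z => (f z - symmetrize f i j) ^+ 2) <=
  block_int i j (fun z => kl (p i j) (f z)).
Proof.
move=> af; have [bf f01 _ fp] := af; have bk := bmeas_kl_block i j bf f01.
have bc (c : R) : bmeas (fun _ : T * T => c) by exact: bmeas_cst.
have b2 c : bmeas (fun z => (f z - c) ^+ 2) by apply: bmeasX; exact: bmeasB.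
have bn c : bmeas (fun z => `|f z - c|) by apply: bmeas_norm; exact: bmeasB.
case=> [->|ww].
  rewrite kl_self mul0r add0r -block_intZ//.
  have [pb|pi] := boundary_or_interior (p01 i j).
  - apply: (@le_trans _ _ 0).
      rewrite -(fp i j pb); apply: block_int_le => [||z]; [exact: bmeasZ|exact: bn|].
      rewrite -[X in _ * X]real_normK ?num_real//.
      have := f01 z; have := p01 i j => /andP[p0 p1] /andP[fz0 fz1].
      have : `|f z - p i j| <= 1 by rewrite ler_norml; apply/andP; split; lra.
      have : 0 <= `|f z - p i j| by [].
      by nra.
    have -> : 0 = block_int i j (fun z => (-1) * `|f z - p i j|).
      by rewrite block_intZ ?fp// mulr0.
    apply: block_int_le => [||z]; [exact: bmeasZ|exact: bk|].
    by rewrite mulN1r; exact: kl_ge_boundary.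
  - apply: block_int_le => [||z]; [exact: bmeasZ|exact: bk|].
    by rewrite mulrC; exact: kl_ge_quarter.
have z0 F : bmeas F -> block_int i j F = 0.
  move=> [mF [M FM]]; have bF : bmeas F by split => //; exists M.
  apply/le_anti/andP; split.
    rewrite -(mulr0 M) -ww -block_int_cst; apply: block_int_le => // z.
    exact: le_trans (ler_norm _) (FM z).
  rewrite -(mulr0 (- M)) -ww -block_int_cst; apply: block_int_le => // z.
  by have := FM z; rewrite ler_norml => /andP[].
by rewrite ww mulr0 !z0// mulr0 addr0.
Qed.

Lemma finite_min_pos (I : finType) (F : I -> R) : (forall i, 0 < F i) ->
  exists2 e, 0 < e & forall i, e <= F i.
Proof.
move=> F0; exists (\big[Order.min/1]_i F i).
  by apply: (big_ind (fun x : R => 0 < x)) => // x y x0 y0; rewrite lt_min x0.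
by move=> i; rewrite (bigD1 i)//= ge_min lexx.
Qed.

(** A density within eta of the maximum makes the L^d averages of f so close to 1
    on the relevant blocks that [block_gain] applies there. *)
Theorem symmetrization_gain : exists2 eta, 0 < eta &
  forall f, admissible f -> block_density P Q beta top_block - eta < hom_integral P Q (fun=> f) ->
  hom_integral P Q (fun=> f) <= block_density P Q beta (symmetrize f) /\
  kl_integral (block_kernel beta (symmetrize f)) +
    4^-1 * \int[PP]_z (f z - block_kernel beta (symmetrize f) z) ^+ 2 <=
  kl_integral f.
Proof.
pose tangent ij (del : R) := 0 < p ij.1 ij.2 < 1 ->
  forall a, 1 - del <= a -> a < 1 -> exists lam, forall u, 0 <= u <= 1 ->
    kl (p ij.1 ij.2) a + lam * (u ^+ d - a ^+ d) + (u - a) ^+ 2 <= kl (p ij.1 ij.2) u.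
have /choice[del Hdel] : forall ij : 'I_m * 'I_m, exists del, 0 < del /\ tangent ij del.
  move=> ij; have [pij|npij] := boolP (0 < p ij.1 ij.2 < 1).
    have [del /andP[del0 _] H] := kl_power_tangent pij d_gt0.
    by exists del; split => // _; exact: H.
  by exists 1; split => // pij; rewrite pij in npij.
(* density lost by the coloring t.1 when a norm at one of its edges drops by del t.2 *)
pose F (t : {ffun 'I_v -> 'I_m} * ('I_m * 'I_m)) : R :=
  if 0 < coloring_weight P beta t.1 :> R then coloring_weight P beta t.1 * del t.2 else 1.
have F0 t : 0 < F t.
  by rewrite /F; case: ifPn => // c0; apply: mulr_gt0 => //; have [] := Hdel t.2.
have [eta eta0 etaF] := finite_min_pos F0.
exists eta => // f af homf; have [bf f01 fs fp] := af.
split.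
  exact: le_trans (hom_le_block_norm bf f01) (block_density_symmetrize af).
have gap i j : relevant i j -> [/\ 0 < w i, 0 < w j & 1 - del (i, j) <= block_norm f i j].
  move=> /existsP[s /andP[acs /exists_inP[e Qe se]]].
  have cs : 0 < coloring_weight P beta s :> R by case/andP: acs.
  have := etaF (s, (i, j)); rewrite /F/= cs => etac.
  have := hom_active_gap af acs Qe => hg.
  have Nse : 1 - del (i, j) <= block_norm f (s e.1) (s e.2).
    have : coloring_weight P beta s * (1 - block_norm f (s e.1) (s e.2)) <=
        coloring_weight P beta s * del (i, j) by lra.
    by rewrite ler_pM2l//; lra.
  have W a : 0 < w (s a) by exact: coloring_weight_gt0.
  case/orP: se => /eqP[ei ej]; subst i j; split; try exact: W; first exact: Nse.
  by rewrite -(block_norm_sym bf fs) mxE.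
rewrite (kl_integralE bf f01) kl_integral_block.
rewrite (block_intE (F := fun i j z => (f z - symmetrize f i j) ^+ 2)); last first.
  by move=> i j; apply: bmeasX; apply: bmeasB => //; exact: bmeas_cst.
rewrite mulr_sumr -big_split/=; apply: ler_sum => i _.
rewrite mulr_sumr -big_split/=; apply: ler_sum => j _.
have [/andP[rij pij]|nr] := boolP (relevant i j && (0 < p i j < 1)); last first.
  apply: block_gain_boundary => //; left.
  by rewrite [symmetrize f i j]mxE (negbTE nr).
have [wi wj gij] := gap i j rij.
have [_ tg] := Hdel (i, j).
apply: (block_gain af pij wi wj (tg pij) gij).
by rewrite [symmetrize f i j]mxE rij pij.
Qed.

End symmetrization.

(** * Lebesgue measure on the unit cube *)

Section unit_interval.
Context {R : realType}.
Local Notation T := (measurableTypeR R).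
Local Notation mu := (@lebesgue_measure R).
Local Notation mu2 := (mu \x mu)%E.
Local Notation unitI := (@unitI R).
Local Notation unitI2 := (@unitI2 R).

Definition unif : probability T R := uniform_prob (@ltr01 R).

Lemma measurable_unitI : measurable unitI.
Proof. exact: measurable_itv. Qed.

Lemma measurable_unitI2 : measurable unitI2.
Proof. by apply: measurableX; exact: measurable_unitI. Qed.

Lemma ge0_integral_unif (G : T -> \bar R) : measurable_fun setT G ->
  (forall x, 0 <= G x)%E -> (\int[unif]_x G x = \int[mu]_(x in unitI) G x)%E.
Proof.
move=> mG G0; rewrite /unif integral_uniform// subr0 invr1 mul1e.
by [].
Qed.

Lemma ge0_integral_unif2 (G : T * T -> \bar R) : measurable_fun setT G ->
  (forall x, 0 <= G x)%E ->
  (\int[(unif \x unif)%E]_z G z = \int[mu2]_(z in unitI2) G z)%E.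
Proof.
move=> mG G0.
rewrite (fubini_tonelli1 (m1 := unif) (m2 := unif)) //.
rewrite [RHS]integral_mkcond (fubini_tonelli1 (m1 := mu) (m2 := mu)) /fubini_F; last 2 first.
- by apply/(measurable_restrictT _ _).1 => //; [exact: measurable_unitI2|exact: measurable_funTS].
- by move=> z; rewrite patchE; case: ifP.
rewrite ge0_integral_unif; last 2 first.
- exact: (measurable_fun_fubini_tonelli_F (m2 := unif)).
- by move=> x; exact: integral_ge0.
rewrite integral_mkcond; apply: eq_integral => x _.
rewrite patchE; case: ifPn => [/set_mem Ix|nIx].
  rewrite ge0_integral_unif//; last exact: measurableT_comp.
  rewrite [LHS]integral_mkcond; apply: eq_integral => y _; rewrite !patchE.
  have -> : ((x, y) \in unitI2) = (y \in unitI).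
    by apply/idP/idP => /set_mem; [case=> _ ?; exact/mem_set|move=> Iy; apply/mem_set; split].
  by [].
apply/esym/integral0_eq => y _; rewrite patchE ifF//.
by apply/negP => /set_mem[Ix _]; move/negP: nIx; apply; exact/mem_set.
Qed.

Lemma integral_unif (G : T -> \bar R) : measurable_fun setT G ->
  (\int[unif]_x G x = \int[mu]_(x in unitI) G x)%E.
Proof.
move=> mG; rewrite integralE [RHS]integralE; congr (_ - _)%E;
  apply: ge0_integral_unif => //; [exact: measurable_funepos|exact: measurable_funeneg].
Qed.

Lemma integral_unif2 (G : T * T -> \bar R) : measurable_fun setT G ->
  (\int[(unif \x unif)%E]_z G z = \int[mu2]_(z in unitI2) G z)%E.
Proof.
move=> mG; rewrite integralE [RHS]integralE; congr (_ - _)%E;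
  apply: ge0_integral_unif2 => //; [exact: measurable_funepos|exact: measurable_funeneg].
Qed.

Lemma Rintegral_unif2 (G : T * T -> R) : measurable_fun setT G ->
  \int[(unif \x unif)%E]_z G z = \int[mu2]_(z in unitI2) G z.
Proof. by move=> mG; rewrite /Rintegral integral_unif2//; exact/measurable_EFinP. Qed.

Lemma unifE (A : set T) : measurable A -> unif A = mu (unitI `&` A).
Proof.
move=> mA; transitivity (\int[unif]_x (\1_A x)%:E)%E; first by rewrite integral_indic// setIT.
rewrite integral_unif; last exact/measurable_EFinP/measurable_indic.
rewrite integral_indic//; first by rewrite setIC.
exact: measurable_unitI.
Qed.

Definition cube n : set (n.-tuple T) := [set x | forall i, unitI (tnth x i)].

Lemma measurable_cube n : measurable (@cube n).
Proof.
have -> : @cube n = \bigcap_(i in [set: 'I_n]) (@tnth n T ^~ i @^-1` unitI).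
  by apply/seteqP; split => x /= H i; [move=> _; exact: H|exact: H].
apply: fin_bigcap_measurable => // i _.
rewrite -[X in measurable X]setTI; apply: measurable_tnth => //.
exact: measurable_unitI.
Qed.

Lemma cube_cons n x (y : n.-tuple T) :
  cube [tuple of x :: y] <-> unitI x /\ cube y.
Proof.
split=> [H|[Ix Iy] i].
  split; first by have := H ord0; rewrite tnth0.
  by move=> i; have := H (lift ord0 i); rewrite tnthS.
by case: (unliftP ord0 i) => [j ->|->]; rewrite ?tnthS ?tnth0.
Qed.

Lemma lebesgue_tuple_iexp n (F : n.-tuple T -> R) :
  bmeas F -> (forall x, 0 <= F x) ->
  (\int[lebesgue_tuple R n]_(x in @cube n) (F x)%:E = (iexp unif F)%:E)%E.
Proof.
elim: n F => [|n IHn] F bF F0.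
  have mF : measurable_fun (@cube 0) (fun x => (F x)%:E).
    by apply/measurable_EFinP/measurable_funTS; exact: bF.1.
  rewrite /= integral_dirac//; last exact: measurable_cube.
  by rewrite diracE mem_set ?mul1e//; case.
have mc : measurable_fun setT (@tuple_cons R n) by exact: measurable_cons.
have mFc : measurable_fun (@cube n.+1) (fun x => (F x)%:E).
  by apply/measurable_EFinP/measurable_funTS; exact: bF.1.
transitivity (\int[(mu \x lebesgue_tuple R n)%E]_(z in @tuple_cons R n @^-1` @cube n.+1)
   (F (tuple_cons z))%:E)%E.
  rewrite /=; apply: (ge0_integral_pushforward mc) => //.
    exact: measurable_cube.
  by move=> y _; rewrite lee_fin.
have mpre : measurable (@tuple_cons R n @^-1` @cube n.+1).
  by rewrite -[X in measurable X]setTI; apply: mc => //; exact: measurable_cube.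
rewrite integral_mkcond (fubini_tonelli1 (m1 := mu) (m2 := lebesgue_tuple R n)); last 2 first.
- apply/(measurable_restrictT _ _).1 => //.
  by apply/measurable_EFinP/measurable_funTS; exact: (measurableT_comp bF.1 mc).
- by move=> z; rewrite patchE; case: ifP => _; rewrite ?lee_fin.
have bh := bmeas_head unif bF.
rewrite /= EFin_expect// integral_unif; last by apply/measurable_EFinP; exact: bh.1.
rewrite [RHS]integral_mkcond; apply: eq_integral => x _.
rewrite /fubini_F [RHS]patchE; case: ifPn => [/set_mem Ix|nIx].
  rewrite -IHn//; last exact: bmeas_tail.
  rewrite [RHS]integral_mkcond; apply: eq_integral => y _; rewrite !patchE.
  have -> : ((x, y) \in @tuple_cons R n @^-1` @cube n.+1) = (y \in @cube n).
    apply/idP/idP => /set_mem H; apply/mem_set.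
      by have [] := (cube_cons x y).1 H.
    by apply: (cube_cons x y).2.
  by [].
apply: integral0_eq => y _; rewrite patchE ifF//.
apply/negP => /set_mem H; move/negP: nIx; apply; apply/mem_set.
by have [] := (cube_cons x y).1 H.
Qed.

End unit_interval.

(** * Graphons as kernels on the line *)

Section measure_preserving.
Context {R : realType} d (T : measurableType d) (P : probability T R).
Variable psi : T -> T.
Hypothesis mpsi : measurable_fun setT psi.
Hypothesis Ppsi : forall A, measurable A -> P (psi @^-1` A) = P A.

Lemma expect_comp_mp (G : T -> R) : bmeas G -> \int[P]_x G (psi x) = \int[P]_x G x.
Proof.
move=> bG; pose m' := measure_function_pushforward__canonical__measure_function_Measure P mpsi.
apply: EFin_inj; rewrite !EFin_expect//; last exact: (bmeas_comp mpsi).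
transitivity (\int[m']_x (G x)%:E)%E; last first.
  by apply: eq_measure_integral => A mA _; exact: Ppsi.
rewrite (@integral_pushforward _ _ _ _ _ _ mpsi P setT (EFin \o G)) ?preimage_setT//.
  by apply/measurable_EFinP; exact: bG.1.
exact: (bmeas_integrable P (bmeas_comp mpsi bG)).
Qed.

Lemma iexp_mp n (F : n.-tuple T -> R) : bmeas F ->
  iexp P (fun x => F [tuple of map psi x]) = iexp P F.
Proof.
elim: n F => [|n IHn] F bF; first by rewrite /=; congr F; exact: tuple0.
rewrite /= -(expect_comp_mp (bmeas_head P bF)); apply: eq_Rintegral => x _.
rewrite -(IHn _ (bmeas_tail (psi x) bF)); apply: eq_iexp => y.
by congr F; apply: val_inj.
Qed.
End measure_preserving.

Section graphon_kernel.
Context {R : realType}.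
Local Notation T := (measurableTypeR R).
Local Notation mu := (@lebesgue_measure R).
Local Notation mu2 := (mu \x mu)%E.
Local Notation unitI := (@unitI R).
Local Notation unitI2 := (@unitI2 R).
Local Notation PP := (unif \x unif)%E.

(** Only the values of a graphon on the unit square matter; extended by zero they
    define a measurable function on the whole plane. *)
Definition zext (f : T * T -> R) : T * T -> R := f \_ unitI2.

Lemma zextE f z : unitI2 z -> zext f z = f z.
Proof. by move=> Iz; rewrite /zext patchE mem_set. Qed.

Lemma zext_out f z : ~ unitI2 z -> zext f z = 0.
Proof. by move=> Iz; rewrite /zext patchE memNset. Qed.

Lemma zext01 f z : graphon_like f -> 0 <= zext f z <= 1.
Proof.
move=> [_ f01]; have [Iz|nIz] := pselect (unitI2 z); first by rewrite zextE// f01.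
by rewrite zext_out// lexx ler01.
Qed.

Lemma bmeas_zext f : graphon_like f -> bmeas (zext f).
Proof.
move=> gf; apply: bmeas_pos => [|z]; last exact: zext01.
by apply/(measurable_restrictT f measurable_unitI2); exact: gf.1.
Qed.

Lemma zext_sym (f : graphon R) x y : zext f (x, y) = zext f (y, x).
Proof.
have [[Ix Iy]|nI] := pselect (unitI2 (x, y)).
  by rewrite zextE// zextE//; apply: graphon_sym.
by rewrite zext_out// zext_out// => -[Iy Ix]; apply: nI.
Qed.

Lemma rect_integral f g (S U : set T) : graphon_like f -> graphon_like g ->
  measurable S -> measurable U ->
  \int[unif]_x \int[unif]_y (\1_S x * \1_U y * (zext f (x, y) - zext g (x, y))) =
  \int[mu2]_(z in (S `&` unitI) `*` (U `&` unitI)) (f z - g z).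
Proof.
move=> gf gg mS mU.
have bW : bmeas (fun z : T * T => \1_S z.1 * \1_U z.2 * (zext f z - zext g z)).
  apply: bmeasM; last by apply: bmeasB; exact: bmeas_zext.
  apply: bmeasM.
    exact: (bmeas_comp measurable_fst (bmeas_indic mS)).
  exact: (bmeas_comp measurable_snd (bmeas_indic mU)).
rewrite -(expect_prod unif unif bW) Rintegral_unif2; last exact: bW.1.
rewrite Rintegral_mkcond [RHS]Rintegral_mkcond; apply: eq_Rintegral => -[x y] _.
rewrite !patchE; case: ifPn => [/set_mem [Ix Iy]|nI].
  rewrite !zextE// !indicE/=.
  have -> : ((x, y) \in (S `&` unitI) `*` (U `&` unitI)) = (x \in S) && (y \in U).
    apply/idP/andP => [/set_mem [[? ?] [? ?]]|[/set_mem ? /set_mem ?]].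
      by split; exact/mem_set.
    by apply/mem_set; split.
  by rewrite -natrM mulnb; case: ifP => _; rewrite ?mul1r ?mul0r.
rewrite ifF//; apply/negP => /set_mem[[_ Ix] [_ Iy]].
by move/negP: nI; apply; exact/mem_set.
Qed.

Lemma rect_integral_le_L1 f g (S U : set T) : graphon_like f -> graphon_like g ->
  measurable S -> measurable U ->
  `|\int[unif]_x \int[unif]_y (\1_S x * \1_U y * (zext f (x, y) - zext g (x, y)))| <=
  \int[PP]_z `|zext f z - zext g z|.
Proof.
move=> gf gg mS mU.
have bfg : bmeas (fun z => zext f z - zext g z) by apply: bmeasB; exact: bmeas_zext.
have bW : bmeas (fun z : T * T => \1_S z.1 * \1_U z.2 * (zext f z - zext g z)).
  apply: bmeasM => //; apply: bmeasM.
    exact: (bmeas_comp measurable_fst (bmeas_indic mS)).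
  exact: (bmeas_comp measurable_snd (bmeas_indic mU)).
rewrite -(expect_prod unif unif bW); apply: (le_trans (le_norm_expect PP bW)).
apply: (le_expect PP) => [||z]; [exact: bmeas_norm|exact: bmeas_norm|].
rewrite normrM ler_piMl// !indicE -natrM ger0_norm//.
by rewrite lern1 mulnb leq_b1.
Qed.

(** The set whose supremum is [cut_dist]. *)
Definition cut_set (f g : T * T -> R) := [set r | exists S U : set T,
    [/\ measurable S, S `<=` unitI, measurable U, U `<=` unitI &
        r = `| \int[mu2]_(z in S `*` U) (f z - g z) |]].

Lemma cut_set_nonempty f g : cut_set f g !=set0.
Proof.
by exists `| \int[mu2]_(z in set0 `*` set0) (f z - g z) |;
  exists set0, set0; split => //; exact: measurable0.
Qed.

Lemma cut_set_ub f g : graphon_like f -> graphon_like g ->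
  ubound (cut_set f g) (\int[PP]_z `|zext f z - zext g z|).
Proof.
move=> gf gg _ [S [U [mS SI mU UI ->]]].
have := rect_integral_le_L1 gf gg mS mU.
by rewrite rect_integral// (setIidl SI) (setIidl UI).
Qed.

Lemma cut_dist_le_L1 f g : graphon_like f -> graphon_like g ->
  cut_dist f g <= \int[PP]_z `|zext f z - zext g z|.
Proof. by move=> gf gg; apply: ge_sup; [exact: cut_set_nonempty|exact: cut_set_ub]. Qed.

Lemma cut_le_cut_dist f g : graphon_like f -> graphon_like g ->
  cut_le unif (fun z => zext f z - zext g z) (cut_dist f g).
Proof.
move=> gf gg S U mS mU; rewrite rect_integral//.
apply: (@ub_le_sup _ (cut_set f g)).
  by exists (\int[PP]_z `|zext f z - zext g z|); exact: cut_set_ub.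
exists (S `&` unitI), (U `&` unitI); split => //.
all: try exact: subIsetr.
all: by apply: measurableI => //; exact: measurable_unitI.
Qed.

(** An automorphism of [0, 1] becomes one of the whole line, so that relabelling
    turns into a composition ([zext_relabel]) and the law [unif] is preserved. *)
Definition extend_id (phi : T -> T) (x : T) : T := if x \in unitI then phi x else x.

Section relabelling.
Variable phi : T -> T.
Hypothesis mp : mp_bij phi.

Lemma extend_id_preimage A : extend_id phi @^-1` A =
  (unitI `&` phi @^-1` (A `&` unitI)) `|` (A `\` unitI).
Proof.
have [[phiI _ _] _ _] := mp.
apply/seteqP; split=> x; rewrite /extend_id /=.
  case: ifPn => [/set_mem Ix Ax|/negP nIx Ax]; [left|right]; split => //.
    by split => //; exact: phiI.
  by move=> Ix; apply: nIx; exact/mem_set.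
move=> [[Ix [Ax _]]|[Ax nIx]]; first by rewrite mem_set.
by rewrite memNset.
Qed.

Lemma measurable_extend_id : measurable_fun setT (extend_id phi).
Proof.
move=> _ A mA; rewrite setTI extend_id_preimage.
have mAI : measurable (A `&` unitI) by apply: measurableI => //; exact: measurable_unitI.
have [_ phim _] := mp; have [m1 _] := phim _ (@subIsetr _ A unitI) mAI.
by apply: measurableU => //; apply: measurableD => //; exact: measurable_unitI.
Qed.

Lemma unif_extend_id A : measurable A -> unif (extend_id phi @^-1` A) = unif A.
Proof.
move=> mA; rewrite !unifE//; last first.
  by rewrite -[X in measurable X]setTI; apply: measurable_extend_id.
have mAI : measurable (A `&` unitI) by apply: measurableI => //; exact: measurable_unitI.
have [_ phim _] := mp; have [_ e1] := phim _ (@subIsetr _ A unitI) mAI.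
rewrite [unitI `&` A]setIC -e1 extend_id_preimage; congr (mu _).
apply/seteqP; split=> x /=; first by move=> [Ix [//|[]]].
by move=> [Ix H]; split => //; left.
Qed.

Lemma zext_relabel g z : zext (relabel phi g) z = zext g (extend_id phi z.1, extend_id phi z.2).
Proof.
have [[phiI _ _] _ _] := mp; rewrite /extend_id.
have [Iz|nIz] := pselect (unitI2 z).
  have [I1 I2] := Iz; rewrite zextE// !mem_set// zextE//.
  by split; exact: phiI.
rewrite !zext_out// => -[/=].
case: ifPn => [/set_mem I1 _|_ I1]; case: ifPn => [/set_mem I2 _|_ I2]; exact: nIz.
Qed.

Lemma graphon_like_relabel g : graphon_like g -> graphon_like (relabel phi g).
Proof.
move=> gg; have [[phiI _ _] _ _] := mp; split; last first.
  by move=> [x y] [/= Ix Iy]; apply: gg.2; split; exact: phiI.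
apply/(measurable_restrictT (relabel phi g) measurable_unitI2).
have -> : relabel phi g \_ unitI2 = zext g \o (fun z => (extend_id phi z.1, extend_id phi z.2)).
  by apply/funext => z; exact: zext_relabel.
apply: (measurableT_comp (bmeas_zext gg).1).
apply: measurable_fun_pair.
  exact: (measurableT_comp measurable_extend_id measurable_fst).
exact: (measurableT_comp measurable_extend_id measurable_snd).
Qed.

Lemma hom_relabel v (Q : pred ('I_v * 'I_v)) g : graphon_like g ->
  hom_integral unif Q (fun=> zext (relabel phi g)) = hom_integral unif Q (fun=> zext g).
Proof.
move=> gg; rewrite /hom_integral -[RHS](iexp_mp measurable_extend_id unif_extend_id); last first.
  by apply: (bmeas_hom _ (K := fun=> zext g)) => _; exact: bmeas_zext.
by apply: eq_iexp => x; apply: eq_bigr => e _; rewrite zext_relabel !tnth_map.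
Qed.

End relabelling.

Lemma mp_bij_id : mp_bij (id : T -> T).
Proof.
split; first by split => // x Ix; exists x.
  by move=> A AI mA; rewrite preimage_id (_ : unitI `&` A = A)//; exact: setIidr.
by move=> A AI mA; rewrite image_id.
Qed.

Lemma delta_le_L1 (f g : graphon R) : delta f g <= \int[PP]_z `|zext f z - zext g z|.
Proof.
apply: le_trans (cut_dist_le_L1 (graphon_b f) (graphon_b g)).
apply: ge_inf; last first.
  exists id; first exact: mp_bij_id.
  by congr (cut_dist f _); apply/funext => -[].
exists 0 => _ [phi mp <-].
have [r cr] := cut_set_nonempty f (relabel phi g).
have gr := graphon_like_relabel mp (graphon_b g).
apply: le_trans (ub_le_sup _ cr); first by case: cr => S [U [_ _ _ _ ->]].
by exists (\int[PP]_z `|zext f z - zext (relabel phi g) z|); exact: cut_set_ub (graphon_b f) gr.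
Qed.

Definition edge v (H : simple_graph v) : pred ('I_v * 'I_v) :=
  fun e => (e.1 < e.2)%N && H e.1 e.2.

Lemma edge_lt v (H : simple_graph v) e : edge H e -> (e.1 < e.2)%N.
Proof. by case/andP. Qed.

Lemma hom_densityE v (H : simple_graph v) (f : graphon R) :
  hom_density H f = hom_integral unif (edge H) (fun=> zext f).
Proof.
have gf := graphon_b f; apply: EFin_inj.
rewrite /hom_integral -lebesgue_tuple_iexp; last 2 first.
- by apply: (bmeas_hom _ (K := fun=> zext f)) => _; exact: bmeas_zext.
- by move=> x; apply: prodr_ge0 => e _; have /andP[] := zext01 (tnth x e.1, tnth x e.2) gf.
rewrite /hom_density /Rintegral.
have E : (\int[lebesgue_tuple R v]_(x in [set x | forall i, unitI (tnth x i)])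
    (\prod_(e : 'I_v * 'I_v | (e.1 < e.2)%N && H e.1 e.2) f (tnth x e.1, tnth x e.2))%:E =
  \int[lebesgue_tuple R v]_(x in @cube R v)
    (\prod_(e | edge H e) zext f (tnth x e.1, tnth x e.2))%:E)%E.
  apply: eq_integral => x /set_mem Ix; congr EFin; apply: eq_bigr => e _.
  by rewrite zextE//; split; exact: Ix.
rewrite E fineK// lebesgue_tuple_iexp//.
- by apply: (bmeas_hom _ (K := fun=> zext f)) => _; exact: bmeas_zext.
- by move=> x; apply: prodr_ge0 => e _; have /andP[] := zext01 (tnth x e.1, tnth x e.2) gf.
Qed.

Lemma hom_density_delta_lt v (H : simple_graph v) (f g : graphon R) r : delta f g < r ->
  hom_density H f <= hom_density H g + #|edge H|%:R * r.
Proof.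
move=> /inf_lt[|_ [phi mp <-] /ltW cr].
  by exists (cut_dist f (relabel id g)); exists id => //; exact: mp_bij_id.
have gf := graphon_b f; have gr := graphon_like_relabel mp (graphon_b g).
rewrite !hom_densityE -(hom_relabel mp _ (graphon_b g)).
apply: (counting_lemma (@edge_lt _ H)) => //; try exact: bmeas_zext.
- by move=> z; exact: zext01.
- by move=> z; exact: zext01.
- by move=> S U mS mU; apply: le_trans cr; exact: cut_le_cut_dist.
Qed.

Lemma hom_density_delta v (H : simple_graph v) (f g : graphon R) :
  hom_density H f <= hom_density H g + #|edge H|%:R * delta f g.
Proof.
apply/ler_addgt0Pr => e e0.
have K0 : (0 : R) < #|edge H|%:R + 1 by rewrite ltr_wpDl.
have := @hom_density_delta_lt _ H f g (delta f g + e / (#|edge H|%:R + 1)).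
rewrite ltrDl divr_gt0// => /(_ isT) /le_trans; apply.
rewrite mulrDr addrA lerD2l mulrCA ler_piMr ?ltW//.
by rewrite ltr_pdivrMr// mul1r ltrDl.
Qed.

(** Graphons at distance 0 have the same densities, by the counting lemma. *)
Lemma hom_density_repr v (H : simple_graph v) (f : graphon R) :
  hom_density_class H (to_class f) = hom_density H f.
Proof.
have d0 : delta (repr (to_class f)) f = 0.
  by have := delta_classE f f; rewrite delta_refl.
rewrite /hom_density_class; apply/le_anti/andP; split.
  by have := hom_density_delta H (repr (to_class f)) f; rewrite d0 mulr0 addr0.
by have := hom_density_delta H f (repr (to_class f)); rewrite delta_sym d0 mulr0 addr0.
Qed.

End graphon_kernel.

(** * Block partitions and the rate function *)

Section block_map.
Context {R : realType}.
Local Notation T := (measurableTypeR R).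
Local Notation unitI := (@unitI R).
Context (m : nat) (gamma : 'I_m -> rat).
Hypothesis m_gt0 : (0 < m)%N.
Hypothesis gammaP : rat_simplex gamma.

Let gamma0 i : 0 <= gamma i. Proof. by have [/(_ i)/andP[]] := gammaP. Qed.

Let sum_sub (A B : pred 'I_m) : {subset A <= B} ->
  (ratr (\sum_(k | A k) gamma k) : R) <= ratr (\sum_(k | B k) gamma k).
Proof.
move=> AB; rewrite ler_rat.
have -> : \sum_(k | B k) gamma k =
    \sum_(k | A k) gamma k + \sum_(k | B k && ~~ A k) gamma k.
  rewrite (bigID A)/=; congr (_ + _); apply: eq_bigl => k.
  by case: (boolP (A k)) => Ak; rewrite ?andbF// andbT; exact: AB.
by rewrite lerDl sumr_ge0.
Qed.

Lemma block_unitI i (x : R) : block gamma i x -> unitI x.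
Proof.
rewrite /block/= /unitI/= in_itv/= => -[lo hi]; apply/andP; split.
  case: ifP lo => // _ /ltW; apply: le_trans.
  by rewrite ler0q sumr_ge0.
apply: (le_trans hi); have <- : ratr (\sum_k gamma k) = 1 :> R.
  by have [_ ->] := gammaP; rewrite rmorph1.
exact: sum_sub.
Qed.

Lemma block_lt_disjoint (i j : 'I_m) (x : R) : (i < j)%N -> block gamma i x -> block gamma j x -> False.
Proof.
rewrite /block/= => ij [_ hi] [+ _]; rewrite gtn_eqF ?(leq_ltn_trans _ ij)// => lo.
have : (ratr (\sum_(k < m | (k <= i)%N) gamma k) : R) <= ratr (\sum_(k < m | (k < j)%N) gamma k).
  by apply: sum_sub => k; rewrite !unfold_in => /leq_ltn_trans; exact.
by move=> /(le_trans hi); rewrite leNgt lo.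
Qed.

Lemma block_inj i j (x : R) : block gamma i x -> block gamma j x -> i = j.
Proof.
move=> bi bj; have [ij|ji|/val_inj//] := ltngtP i j.
  by case: (block_lt_disjoint ij bi bj).
by case: (block_lt_disjoint ji bj bi).
Qed.

Lemma block_cover (x : R) : unitI x -> exists i, block gamma i x.
Proof.
rewrite /unitI/= in_itv/= => /andP[x0 x1].
pose good := fun k : nat => (k < m)%N && (x <= ratr (\sum_(l < m | (l <= k)%N) gamma l)).
have ex : exists k, good k.
  exists m.-1; rewrite /good prednK// leqnn/=; apply: (le_trans x1).
  have [_ g1] := gammaP; rewrite (eq_bigl xpredT); first by rewrite g1 rmorph1.
  by move=> l; rewrite -ltnS prednK// ltn_ord.
have [k /andP[km xk] kmin] := ex_minnP ex.
exists (Ordinal km); rewrite /block/=; split => //.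
case: eqP => [//|/eqP k0]; rewrite ltNge; apply/negP => xk'.
have : good k.-1.
  rewrite /good (leq_ltn_trans (leq_pred k) km)/=; apply: (le_trans xk').
  by apply: sum_sub => l; rewrite !unfold_in => lk; rewrite -ltnS prednK ?lt0n.
by move=> /kmin; rewrite -ltnS prednK ?lt0n// ltnn.
Qed.

Lemma measurable_block i : measurable (block gamma i : set T).
Proof.
have [i0|i0] := eqVneq (i : nat) 0%N.
  rewrite [X in measurable X](_ : _ = `[0, ratr (\sum_(k < m | (k <= i)%N) gamma k)]%classic).
    exact: measurable_itv.
  by apply/seteqP; split => x; rewrite /block/= i0/= in_itv/= => /andP.
rewrite [X in measurable X](_ : _ = `]ratr (\sum_(k < m | (k < i)%N) gamma k),
    ratr (\sum_(k < m | (k <= i)%N) gamma k)]%classic).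
  exact: measurable_itv.
by apply/seteqP; split => x; rewrite /block/= (negbTE i0) in_itv/= => /andP.
Qed.

(** A map defined on the whole line is easier to handle than a partition of
    [0, 1]; the points outside [0, 1] are sent to the first block. *)
Lemma exists_block_map : exists beta : T -> 'I_m,
  [/\ forall x, unitI x -> block gamma (beta x) x,
      forall i x, block gamma i x -> beta x = i &
      forall i, measurable (beta @^-1` [set i])].
Proof.
pose beta (x : T) : 'I_m := odflt (Ordinal m_gt0) [pick i | `[< block gamma i x >]].
have betaI x : unitI x -> block gamma (beta x) x.
  move=> Ix; rewrite /beta; case: pickP => [i /asboolP//|].
  by have [i bi] := block_cover Ix; move=> /(_ i)/asboolP.
have betaE i x : block gamma i x -> beta x = i.
  by move=> bi; apply: (block_inj _ bi); apply: betaI; exact: block_unitI bi.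
have betaO x : ~ unitI x -> beta x = Ordinal m_gt0.
  by move=> nIx; rewrite /beta; case: pickP => [i /asboolP/block_unitI//|].
exists beta; split => // i.
have -> : beta @^-1` [set i] = block gamma i `|`
    (if i == Ordinal m_gt0 then ~` unitI else set0).
  apply/seteqP; split => [x /= bx|x [/betaE//|]].
    have [Ix|nIx] := pselect (unitI x); first by left; rewrite -bx; exact: betaI.
    by right; rewrite -bx betaO// eqxx.
  by case: ifP => [/eqP -> /betaO//|_ []].
apply: measurableU; first exact: measurable_block.
case: ifP => _ //; apply: measurableC; exact: measurable_unitI.
Qed.

End block_map.

Section rate_integral.
Context {R : realType}.
Local Notation T := (measurableTypeR R).
Local Notation mu := (@lebesgue_measure R).
Local Notation mu2 := (mu \x mu)%E.
Local Notation unitI := (@unitI R).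
Local Notation unitI2 := (@unitI2 R).
Local Notation PP := (unif \x unif)%E.

Lemma eq_expect_unitI2 (F G : T * T -> R) : bmeas F -> bmeas G ->
  (forall z, unitI2 z -> F z = G z) -> \int[PP]_z F z = \int[PP]_z G z.
Proof.
move=> bF bG FG; rewrite !Rintegral_unif2; [|exact: bG.1|exact: bF.1].
by apply: eq_Rintegral => z /set_mem; exact: FG.
Qed.

Lemma hom_eq_unitI2 v (Q : pred ('I_v * 'I_v)) (F G : T * T -> R) :
  bmeas F -> bmeas G -> (forall z, 0 <= F z) -> (forall z, 0 <= G z) ->
  (forall z, unitI2 z -> F z = G z) ->
  hom_integral unif Q (fun=> F) = hom_integral unif Q (fun=> G).
Proof.
move=> bF bG F0 G0 FG; apply: EFin_inj; rewrite /hom_integral -!lebesgue_tuple_iexp.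
- apply: eq_integral => x /set_mem Ix; congr EFin; apply: eq_bigr => e _.
  by apply: FG; split; exact: Ix.
- by apply: (bmeas_hom _ (K := fun=> G)).
- by move=> x; exact: prodr_ge0.
- by apply: (bmeas_hom _ (K := fun=> F)).
- by move=> x; exact: prodr_ge0.
Qed.

Context (m : nat) (beta : T -> 'I_m).
Hypothesis mbeta : forall i, measurable (beta @^-1` [set i]).
Context (p : 'M[R]_m).
Hypothesis p01 : forall i j, 0 <= p i j <= 1.
Context (W0 : graphon R).
Hypothesis W0E : forall z, unitI2 z -> W0 z = block_kernel beta p z.

Lemma rel_entropy_ge0 (q u : R) : 0 <= q <= 1 -> 0 <= u <= 1 -> (0 <= rel_entropy q u)%E.
Proof.
move=> q01 u01; rewrite /rel_entropy; case: ifPn => // H.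
rewrite lee_fin -/(kl q u).
have [qb|] := boundary_or_interior q01; last by move=> qi; exact: kl_ge0.
have : (q == 0) || (q == 1) by case: qb => ->; rewrite eqxx ?orbT.
by move=> qB; move: H; rewrite qB negbK => /eqP ->; rewrite kl_self.
Qed.

Lemma measurable_rel_entropy (q : R) (f : T * T -> R) : 0 <= q <= 1 -> bmeas f ->
  (forall z, 0 <= f z <= 1) -> measurable_fun setT (fun z => rel_entropy q (f z)).
Proof.
move=> q01 bf f01; rewrite /rel_entropy; apply: measurable_fun_ifT.
- apply: measurable_and => //; apply: measurable_neg; apply: measurable_fun_eqr => //.
  exact: bf.1.
- exact: measurable_cst.
- by apply/measurable_EFinP; exact: (bmeas_kl q01 bf f01).1.
Qed.

Lemma measurable_rel_entropy_block (f : T * T -> R) : bmeas f ->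
  (forall z, 0 <= f z <= 1) ->
  measurable_fun setT (fun z => rel_entropy (block_kernel beta p z) (f z)).
Proof.
move=> bf f01.
have -> : (fun z => rel_entropy (block_kernel beta p z) (f z)) =
    (fun z => \sum_i \sum_j (pair_indic beta i j z)%:E * rel_entropy (p i j) (f z))%E.
  apply/funext => z; rewrite /block_kernel.
  rewrite (bigD1 (beta z.1))//= (bigD1 (beta z.2))//= pair_indicE !eqxx mul1e.
  rewrite [X in (_ + X)%E]big1 ?adde0; last first.
    by move=> i ni; apply: big1 => j _; rewrite pair_indicE eq_sym (negbTE ni) mul0e.
  rewrite big1 ?adde0// => j nj.
  by rewrite pair_indicE [_ == j]eq_sym (negbTE nj) andbF mul0e.
apply: emeasurable_sum => i; apply: emeasurable_sum => j.
apply: emeasurable_funM; last exact: measurable_rel_entropy.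
by apply/measurable_EFinP; exact: (bmeas_pair_indic mbeta i j).1.
Qed.

Lemma rateE (f : graphon R) : rate W0 f = ((2^-1)%:E *
  \int[mu2]_(z in unitI2) rel_entropy (block_kernel beta p z) (zext f z))%E.
Proof.
rewrite /rate; congr (_ * _)%E; apply: eq_integral => z /set_mem Iz.
by rewrite W0E// zextE.
Qed.

Lemma rate_ge0 (f : graphon R) : (0 <= rate W0 f)%E.
Proof.
rewrite rateE mule_ge0// ?lee_fin ?invr_ge0//; apply: integral_ge0 => z _.
by apply: rel_entropy_ge0 => //; [exact: p01|apply: zext01; exact: graphon_b].
Qed.

Lemma W0_boundary z : unitI2 z -> ~ Omega W0 z -> W0 z = 0 \/ W0 z = 1.
Proof.
move=> Iz nO; have [//|W01] := boundary_or_interior (graphon_itv W0 Iz).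
by case: nO.
Qed.

(** The integrand is infinite where W0 is 0 or 1 and f differs from it. *)
Lemma rate_graphon_Omega (f : graphon R) : (rate W0 f < +oo)%E -> graphon_Omega W0 f.
Proof.
have gf := graphon_b f.
have mRE := measurable_rel_entropy_block (bmeas_zext gf) (fun z => zext01 z gf).
rewrite rateE => rfin.
have intRE : mu2.-integrable unitI2
    (fun z => rel_entropy (block_kernel beta p z) (zext f z)).
  apply/integrableP; split; first exact: measurable_funTS.
  under eq_integral => z _ do rewrite gee0_abs ?(rel_entropy_ge0 (p01 _ _) (zext01 z gf))//.
  rewrite ltey; apply/eqP => E; move: rfin.
  by rewrite E gt0_muley ?lte_fin ?invr_gt0// ltxx.
have := integrable_ae measurable_unitI2 intRE.
apply: filterS => z Hz Iz nO; have := Hz Iz.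
rewrite /rel_entropy -W0E// zextE//.
have [/eqP -> //|ne] := boolP (f z == W0 z).
by case: (W0_boundary Iz nO) => ->; rewrite ?eqxx ?orbT ?andbT.
Qed.

Lemma W0_block i j z : unitI2 z -> beta z.1 = i -> beta z.2 = j -> W0 z = p i j.
Proof. by move=> Iz <- <-; exact: W0E. Qed.

Lemma rate_kl_integral (f : graphon R) : graphon_Omega W0 f ->
  rate W0 f = (2^-1 * kl_integral unif beta p (zext f))%:E.
Proof.
move=> fO; have gf := graphon_b f; have bf := bmeas_zext gf.
have f01 z := zext01 z gf.
have mRE := measurable_rel_entropy_block bf f01.
have bk : bmeas (fun z => kl (p (beta z.1) (beta z.2)) (zext f z)).
  apply: (bmeas_block_dep mbeta (F := fun i j z => kl (p i j) (zext f z))) => i j.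
  exact: bmeas_kl.
have mk : measurable_fun setT (fun z => (kl (p (beta z.1) (beta z.2)) (zext f z))%:E).
  by apply/measurable_EFinP; exact: bk.1.
rewrite rateE EFinM; congr (_ * _)%E.
rewrite /kl_integral (EFin_expect PP)// integral_unif2//.
apply: ae_eq_integral; [exact: measurable_unitI2|exact: measurable_funTS|
  exact: measurable_funTS|].
move: fO; apply: filterS => z Hz Iz.
rewrite /rel_entropy -[p _ _]/(block_kernel beta p z) -W0E//.
case: ifPn => [/andP[b ne]|//].
have : zext f z = W0 z.
  rewrite zextE//; apply: Hz => // -[_]; case/orP: b => /eqP ->; rewrite ?ltxx ?andbF//.
by move=> E; move: ne; rewrite E eqxx.
Qed.

Lemma admissible_graphon_Omega (f : graphon R) : graphon_Omega W0 f ->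
  admissible unif beta p (zext f).
Proof.
move=> fO; have gf := graphon_b f; have bf := bmeas_zext gf.
have f01 z := zext01 z gf.
split => // [x y|i j pij]; first exact: zext_sym.
have bI : bmeas (fun z => pair_indic beta i j z * `|zext f z - p i j|).
  apply: bmeasM; first exact: bmeas_pair_indic.
  by apply: bmeas_norm; apply: bmeasB => //; exact: bmeas_cst.
rewrite /block_int Rintegral_unif2; last exact: bI.1.
rewrite /Rintegral (@ae_eq_integral _ _ _ _ _ (cst 0%E)) ?integral0//.
- exact: measurable_unitI2.
- by apply: measurable_funTS; apply/measurable_EFinP; exact: bI.1.
move: fO; apply: filterS => z Hz Iz; rewrite /= pair_indicE.
case: eqVneq => [zi|]; last by rewrite mul0r.
case: eqVneq => [zj|]; last by rewrite andbF mul0r.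
have Wp := W0_block Iz zi zj.
have -> : zext f z = p i j.
  rewrite zextE// -Wp; apply: Hz => // -[_].
  by rewrite Wp; case: pij => ->; rewrite ltxx ?andbF.
by rewrite subrr normr0 mulr0.
Qed.

Lemma exists_block_graphon (q : 'M[R]_m) : q^T = q -> (forall i j, 0 <= q i j <= 1) ->
  exists g : graphon R, forall z, g z = block_kernel beta q z.
Proof.
move=> qT q01; have mq : measurable_fun unitI2 (block_kernel beta q).
  by apply: measurable_funTS; exact: (bmeas_block_kernel mbeta q).1.
have q01' z : unitI2 z -> 0 <= block_kernel beta q z <= 1 by move=> _; exact: q01.
have qs x y : unitI x -> unitI y -> block_kernel beta q (x, y) = block_kernel beta q (y, x).
  by move=> _ _; rewrite /block_kernel/= -[in LHS]qT mxE.
by exists (Graphon mq q01' qs).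
Qed.

Section block_graphon_facts.
Context (q : 'M[R]_m) (g : graphon R).
Hypothesis gE : forall z, g z = block_kernel beta q z.
Hypothesis q01 : forall i j, 0 <= q i j <= 1.

Let bq : bmeas (block_kernel beta q). Proof. exact: bmeas_block_kernel. Qed.

Let kgE z : unitI2 z -> zext g z = block_kernel beta q z.
Proof. by move=> Iz; rewrite zextE. Qed.

Let bg : bmeas (zext g). Proof. by apply: bmeas_zext; exact: graphon_b. Qed.

Lemma hom_density_block v (H : simple_graph v) :
  hom_density H g = block_density unif (edge H) beta q.
Proof.
rewrite hom_densityE -(hom_block_kernel unif (edge H) mbeta); apply: hom_eq_unitI2 => //.
  by move=> z; have /andP[] := zext01 z (graphon_b g).
by move=> z; have /andP[] := q01 (beta z.1) (beta z.2).
Qed.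

Lemma kl_integral_block_graphon :
  kl_integral unif beta p (zext g) = kl_integral unif beta p (block_kernel beta q).
Proof.
apply: eq_expect_unitI2 => [||z Iz]; last by rewrite kgE.
  apply: (bmeas_block_dep mbeta (F := fun i j z => kl (p i j) (zext g z))) => i j.
  by apply: bmeas_kl => // z; apply: zext01; exact: graphon_b.
apply: (bmeas_block_dep mbeta (F := fun i j z => kl (p i j) (block_kernel beta q z))) => i j.
by apply: bmeas_kl => // z; exact: q01.
Qed.

Lemma delta_block_graphon (f : graphon R) :
  delta f g <= \int[PP]_z `|zext f z - block_kernel beta q z|.
Proof.
apply: (le_trans (delta_le_L1 f g)); rewrite le_eqVlt; apply/orP; left; apply/eqP.
have bf : bmeas (zext f) by apply: bmeas_zext; exact: graphon_b.
apply: eq_expect_unitI2 => [||z Iz]; last by rewrite kgE.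
  by apply: bmeas_norm; exact: bmeasB.
by apply: bmeas_norm; exact: bmeasB.
Qed.

Lemma graphon_Omega_block : (forall i j, p i j = 0 \/ p i j = 1 -> q i j = p i j) ->
  graphon_Omega W0 g.
Proof.
move=> qp; apply: aeW => z Iz nO; rewrite gE W0E// /block_kernel; apply: qp.
by have := W0_boundary Iz nO; rewrite W0E.
Qed.

End block_graphon_facts.

End rate_integral.

(** * Minimizers near the maximal density *)

Section limit_point.
Context {R : realType}.

Lemma matrix_limit_point (m : nat) (q_ : nat -> 'M[R]_m) :
  (forall n i j, 0 <= q_ n i j <= 1) ->
  exists2 q : 'M[R]_m, forall i j, 0 <= q i j <= 1 &
  forall e, 0 < e -> forall N, exists2 n, (N <= n)%N &
    forall i j, `|q_ n i j - q i j| < e.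
Proof.
move=> q01; pose r n : 'rV[R]_(m * m) := mxvec (q_ n).
have cA : compact [set x : 'rV[R]_(m * m) | forall k, `[(0 : R), 1]%classic (x ord0 k)].
  by apply: (rV_compact (A := fun _ => `[(0 : R), 1]%classic)) => k; exact: segment_compact.
have rA n : [set x : 'rV[R]_(m * m) | forall k, `[(0 : R), 1]%classic (x ord0 k)] (r n).
  by move=> k /=; case/mxvec_indexP: k => i j; rewrite /r mxvecE in_itv/=.
have [|x [xA xr]] := cA (r @ \oo) _; first by exists 0%N => // n _; exact: rA.
exists (vec_mx x) => [i j|e e0 N].
  by have := xA (mxvec_index i j); rewrite /= in_itv/= mxE.
have [] := xr [set r n | n in [set n | (N <= n)%N]] (ball x e).
- by exists N => // n Nn; exists n.
- exact: (nbhsx_ballx x e e0).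
move=> y [[n Nn <-] [_ /(_ ord0) xb]]; exists n => // i j.
by have := xb (mxvec_index i j); rewrite /ball/= /r mxvecE mxE distrC.
Qed.

End limit_point.

Section edge_degree.

(** The edges at a, written in increasing order, correspond to its neighbours. *)
Lemma edge_degree v (H : simple_graph v) d : regular H d ->
  forall a : 'I_v, #|[pred e : 'I_v * 'I_v | edge H e && ((e.1 == a) || (e.2 == a))]| = d.
Proof.
move=> Hreg a; rewrite -(Hreg a).
pose g (b : 'I_v) := if (a < b)%N then (a, b) else (b, a).
have gb b : g b = (a, b) \/ g b = (b, a) by rewrite /g; case: ifP; [left|right].
have inj : {in H a &, injective g}.
  move=> b c _ _; case: (gb b) => ->; case: (gb c) => -> [] //.
    by move=> -> ->.
  by move=> -> ->.
rewrite -(card_in_image inj); apply: eq_card => -[x y]; rewrite !inE /edge/=.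
apply/idP/idP => [/andP[/andP[xy Hxy] /orP[/eqP xa|/eqP ya]]|/mapP[b]].
- apply/mapP; exists y; [by rewrite mem_enum -xa|by rewrite /g -xa xy].
- apply/mapP; exists x; first by rewrite mem_enum -ya [_ \in _]adj_sym.
  by rewrite /g -ya ltnNge ltnW.
- rewrite mem_enum => Hb gbE.
  have ab : a != b by apply: contraTneq Hb => ->; rewrite [_ \in _]adj_irr.
  move: gbE; rewrite /g; case: ltngtP => [lt|gt|/val_inj E] [-> ->].
  + by rewrite lt eqxx andbT; exact: Hb.
  + by rewrite gt eqxx orbT andbT adj_sym; exact: Hb.
  + by rewrite E eqxx in ab.
Qed.

End edge_degree.

Section assembly.
Context {R : realType}.
Local Notation T := (measurableTypeR R).
Local Notation unitI := (@unitI R).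
Local Notation unitI2 := (@unitI2 R).
Local Notation PP := (unif \x unif)%E.
Context (m : nat) (beta : T -> 'I_m).
Hypothesis mbeta : forall i, measurable (beta @^-1` [set i]).
Context (p : 'M[R]_m).
Hypothesis p01 : forall i j, 0 <= p i j <= 1.
Hypothesis psym : p^T = p.
Context (W0 : graphon R).
Hypothesis W0E : forall z, unitI2 z -> W0 z = block_kernel beta p z.
Context (v d : nat) (H : simple_graph v).
Hypothesis d_gt0 : (0 < d)%N.
Hypothesis Hreg : regular H d.

Let Q := edge H.
Let Qlt := @edge_lt _ H.
Let Qreg := edge_degree Hreg.
Let tau := @hom_density_class R v H.
Let w i : R := block_weight unif beta i.
Let density (q : 'M[R]_m) : R := block_density unif Q beta q.
Let klq (q : 'M[R]_m) : R := kl_integral unif beta p (block_kernel beta q).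

Lemma class_Omega_to_class g : graphon_Omega W0 g -> class_Omega W0 (to_class g).
Proof. by move=> gO; exists g => //; rewrite delta_classE delta_refl. Qed.

Lemma rate_class_le g : graphon_Omega W0 g -> (rate_class W0 (to_class g) <= rate W0 g)%E.
Proof.
move=> gO; rewrite /rate_class asboolT; last exact: class_Omega_to_class.
apply: ge_ereal_sup => _ [e e0 <-]; apply: ereal_inf_lbound; exists g => //=.
by rewrite delta_classE delta_refl ltW.
Qed.

Lemma tau_class F (g : graphon R) : delta_class F g = 0 -> tau F = hom_density H g.
Proof.
rewrite /delta_class => Fg; rewrite /tau /hom_density_class; apply/le_anti/andP; split.
  by have := hom_density_delta H (repr F) g; rewrite Fg mulr0 addr0.
by have := hom_density_delta H g (repr F); rewrite delta_sym Fg mulr0 addr0.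
Qed.

Lemma top_block01 i j : 0 <= top_block p i j <= 1.
Proof. by rewrite mxE; case: (0 < _); rewrite ?lexx ler01. Qed.

Lemma top_block_sym : (top_block p)^T = top_block p.
Proof. by apply/matrixP => i j; rewrite !mxE -[in LHS]psym mxE. Qed.

Lemma top_block_boundary i j : p i j = 0 \/ p i j = 1 -> top_block p i j = p i j.
Proof. by rewrite mxE => -[->|->]; rewrite ?ltxx ?ltr01. Qed.

Lemma exists_top_graphon : exists2 g : graphon R, graphon_Omega W0 g &
  hom_density H g = density (top_block p) /\ forall z, g z = block_kernel beta (top_block p) z.
Proof.
have [g gE] := exists_block_graphon mbeta top_block_sym top_block01.
exists g.
  exact: (graphon_Omega_block W0E gE top_block_boundary).
by split => //; exact: (hom_density_block mbeta gE top_block01).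
Qed.

Lemma tau_le_top F : class_Omega W0 F -> tau F <= density (top_block p).
Proof.
move=> [g gO Fg]; rewrite (tau_class Fg) hom_densityE.
apply: (hom_le_top Qlt mbeta d_gt0 Qreg p01).
exact: (admissible_graphon_Omega mbeta W0E gO).
Qed.

(** [hom_le_top] gives one inequality; the graphon of [top_block] attains it. *)
Lemma t_maxE : t_max W0 tau = density (top_block p).
Proof.
have [g gO [gd _]] := exists_top_graphon.
have ub : ubound [set tau F | F in class_Omega W0] (density (top_block p)).
  by move=> _ [F FO <-]; exact: tau_le_top.
have mem : [set tau F | F in class_Omega W0] (density (top_block p)).
  exists (to_class g); first exact: class_Omega_to_class.
  by rewrite /tau hom_density_repr.
apply/le_anti/andP; split.
  by apply: ge_sup => //; exists (density (top_block p)).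
by apply: ub_le_sup => //; exists (density (top_block p)).
Qed.

(** Matrices whose block graphons have finite rate. *)
Definition feasible (q : 'M[R]_m) := [/\ q^T = q, forall i j, 0 <= q i j <= 1 &
  forall i j, p i j = 0 \/ p i j = 1 -> q i j = p i j].

(** Where p is 0 or 1 feasible matrices agree, and [kl_lsc] applies elsewhere. *)
Lemma kl_integral_lsc (q : 'M[R]_m) (e : R) : feasible q -> 0 < e ->
  exists2 del, 0 < del & forall q', feasible q' ->
    (forall i j, `|q' i j - q i j| < del) -> klq q - e <= klq q'.
Proof.
move=> [_ q01 qb] e0.
pose C : R := \sum_(i < m) \sum_(j < m) w i * w j.
have w0 i : 0 <= w i by exact: block_weight_ge0.
have C0 : 0 <= C by apply: sumr_ge0 => i _; apply: sumr_ge0 => j _; exact: mulr_ge0.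
(* C is the total weight of the blocks; an error e' on each block adds up to at most e *)
pose e' := e / (C + 1).
have e'0 : 0 < e' by rewrite divr_gt0// ltr_wpDl.
have /choice[del Hdel] : forall ij : 'I_m * 'I_m, exists del, 0 < del /\
    forall q', feasible q' -> `|q' ij.1 ij.2 - q ij.1 ij.2| < del ->
      kl (p ij.1 ij.2) (q ij.1 ij.2) - e' <= kl (p ij.1 ij.2) (q' ij.1 ij.2).
  move=> [i j] /=; have [pb|pi] := boundary_or_interior (p01 i j).
  - exists 1; split => // q' [_ _ q'b] _; rewrite qb// q'b// kl_self; lra.
  - have e'20 : 0 < e' / 2 by rewrite divr_gt0.
    have [K K0 HK] := kl_lsc pi (q01 i j) e'20.
    exists (e' / 2 / (K + 1)); split; first by rewrite divr_gt0// ltr_wpDl.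
    move=> q' [_ q'01 _] qq'; apply: le_trans (HK _ (q'01 i j)).
    have K1 : 0 < K + 1 by rewrite ltr_wpDl.
    move: qq'; rewrite ltr_pdivlMr// => qq'.
    have : K * `|q' i j - q i j| <= `|q' i j - q i j| * (K + 1).
      by rewrite mulrDr mulr1 mulrC lerDl.
    lra.
have [del' del'0 Hdel'] := finite_min_pos (fun ij => (Hdel ij).1).
exists del' => // q' fq' qq'.
rewrite /klq !kl_integral_block//.
rewrite -[X in _ - X](_ : e' * (C + 1) = e); last by rewrite mulfVK// gt_eqF// ltr_wpDl.
apply: (@le_trans _ _ (\sum_i \sum_j kl (p i j) (q i j) * (w i * w j) - e' * C)).
  by rewrite lerD2l lerN2 ler_pM2l// lerDl.
rewrite mulr_sumr -sumrB; apply: ler_sum => i _.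
rewrite mulr_sumr -sumrB; apply: ler_sum => j _.
rewrite -mulrBl; apply: ler_wpM2r; first exact: mulr_ge0.
apply: ((Hdel (i, j)).2 _ fq'); apply: (lt_le_trans (qq' i j)); exact: (Hdel' (i, j)).
Qed.

(** Pointwise |x| <= s + x^2 / s. *)
Lemma L1_le_L2 (f : T * T -> R) s : bmeas f -> 0 < s ->
  \int[PP]_z `|f z| <= s + s^-1 * \int[PP]_z f z ^+ 2.
Proof.
move=> bf s0; have b2 : bmeas (fun z => f z ^+ 2) by exact: bmeasX.
rewrite -(expectZl PP)// -[X in X + _](expect_cst PP) -(expectD PP); last 2 first.
- exact: bmeas_cst.
- exact: bmeasZ.
apply: (le_expect PP) => [||z]; first exact: bmeas_norm.
  by apply: bmeasD; [exact: bmeas_cst|exact: bmeasZ].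
rewrite -[f z ^+ 2]real_normK ?num_real//; set a := `|f z|.
have a0 : 0 <= a by exact: normr_ge0.
rewrite -(ler_pM2l s0) mulrDr mulrA mulfV ?gt_eqF// mul1r.
by have := sqr_ge0 (s - a); nra.
Qed.

Section minimizers.
Variable eta : R.
Hypothesis gain : forall f, admissible unif beta p f ->
  density (top_block p) - eta < hom_integral unif Q (fun=> f) ->
  hom_integral unif Q (fun=> f) <= density (symmetrize unif Q beta d p f) /\
  klq (symmetrize unif Q beta d p f) +
    4^-1 * \int[PP]_z (f z - block_kernel beta (symmetrize unif Q beta d p f) z) ^+ 2 <=
  kl_integral unif beta p f.

Lemma minimizer_approx F (j e : R) : class_Omega W0 F -> (rate_class W0 F <= j%:E)%E ->
  0 < e -> density (top_block p) - eta < tau F - #|Q|%:R * e ->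
  exists h q, [/\ delta_class F h <= e, feasible q, tau F - #|Q|%:R * e <= density q &
    2^-1 * klq q + 8^-1 * \int[PP]_z (zext h z - block_kernel beta q z) ^+ 2 <= j + e].
Proof.
move=> FO; rewrite /rate_class asboolT// => Jj e0 etaF.
set inner := fun e => ereal_inf [set rate W0 h | h in [set h | delta_class F h <= e]].
have : (inner e < (j + e)%:E)%E.
  apply: (@le_lt_trans _ _ j%:E); last by rewrite lte_fin ltrDl.
  by apply: le_trans Jj; apply: ereal_sup_ubound; exists e.
move=> /ereal_inf_lt[_ [h /= dFh <-] rh].
have hO : graphon_Omega W0 h.
  by apply: (rate_graphon_Omega mbeta p01 W0E); apply: (lt_trans rh); rewrite ltry.
have ah := admissible_graphon_Omega mbeta W0E hO.
have homh : tau F - #|Q|%:R * e <= hom_integral unif Q (fun=> zext h).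
  rewrite -hom_densityE lerBlDr; apply: le_trans (hom_density_delta H (repr F) h) _.
  by rewrite lerD2l ler_wpM2l.
have [g1 g2] := gain ah (lt_le_trans etaF homh).
exists h, (symmetrize unif Q beta d p (zext h)); split => //.
- split.
  + exact: (symmetrize_sym Q mbeta d psym ah).
  + by move=> i k; exact: (symmetrize01 Q mbeta d_gt0 p01 i k ah).
  + by move=> i k; exact: symmetrize_boundary.
- exact: le_trans g1.
- move: rh; rewrite (rate_kl_integral mbeta p01 W0E hO) lte_fin; lra.
Qed.

Let K : R := #|Q|%:R.

(** The matrix q is a limit of symmetrizations of graphons h that tend to F, with
    rates tending to at most j.  The last inequality keeps the gain of
    [symmetrization_gain]. *)
Definition approximated F (j : R) (q : 'M[R]_m) := forall s, 0 < s ->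
  exists (h : graphon R) (q' : 'M[R]_m),
  [/\ delta_class F h <= s, feasible q', forall i k, `|q' i k - q i k| < s,
    tau F - K * s <= density q' &
    2^-1 * klq q' + 8^-1 * \int[PP]_z (zext h z - block_kernel beta q' z) ^+ 2 <= j + s].

(** A limit point of the symmetrizations of a sequence of graphons that approach
    F and its rate. *)
Lemma exists_approximated F (j : R) : class_Omega W0 F -> (rate_class W0 F <= j%:E)%E ->
  density (top_block p) - eta < tau F ->
  exists2 q : 'M[R]_m, forall i k, 0 <= q i k <= 1 & approximated F j q.
Proof.
move=> FO Jj topF; have K0 : 0 <= K by exact: ler0n.
have K1 : 0 < K + 1 by rewrite ltr_wpDl.
pose gap := tau F - (density (top_block p) - eta).
have gap0 : 0 < gap by rewrite subr_gt0.
pose e_ (n : nat) : R := Num.min (n.+1%:R^-1) (gap / (K + 1) / 2).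
have e0 n : 0 < e_ n by rewrite lt_min invr_gt0 ltr0n/= !divr_gt0.
have /choice[hq Hhq] : forall n, exists hq : graphon R * 'M[R]_m,
    [/\ delta_class F hq.1 <= e_ n, feasible hq.2, tau F - K * e_ n <= density hq.2 &
    2^-1 * klq hq.2 + 8^-1 * \int[PP]_z (zext hq.1 z - block_kernel beta hq.2 z) ^+ 2
      <= j + e_ n].
  move=> n; have [|||h [q hq]] := @minimizer_approx F j (e_ n) FO; last by exists (h, q).
  - by [].
  - exact: e0.
  - have : (K + 1) * e_ n <= gap / 2.
      rewrite -ler_pdivlMl//; apply: (@le_trans _ _ (gap / (K + 1) / 2)).
        by rewrite ge_min lexx orbT.
      by rewrite -mulrA [X in X <= _]mulrCA.
    have := e0 n; rewrite /gap -/K; lra.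
have [q q01 qlim] := matrix_limit_point (q_ := fun n => (hq n).2)
  (fun n => let: And4 _ (And3 _ H _) _ _ := Hhq n in H).
exists q => // s s0.
have [n Nn qn] := qlim s s0 (Num.trunc s^-1).
have en : e_ n <= s.
  apply: (@le_trans _ _ n.+1%:R^-1); first by rewrite ge_min lexx.
  rewrite invf_ple ?posrE ?ltr0n//; apply/ltW.
  by apply: lt_le_trans (truncnS_gt s^-1) _; rewrite ler_nat ltnS.
have [dh fqn dn kn] := Hhq n.
exists (hq n).1, (hq n).2; split => //.
- exact: le_trans en.
- by apply: le_trans dn; rewrite lerD2l lerN2 ler_wpM2l.
- by apply: (le_trans kn); rewrite lerD2l.
Qed.

Section approximated_theory.
Context (F : graphon_class R) (j : R) (q : 'M[R]_m).
Hypothesis q01 : forall i k, 0 <= q i k <= 1.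
Hypothesis Fq : approximated F j q.

Let eq_small (x y : R) : (forall s, 0 < s -> `|x - y| <= s) -> x = y.
Proof.
move=> xy; apply/eqP; rewrite -subr_eq0 -normr_le0; apply/ler_addgt0Pr => s s0.
by rewrite add0r; exact: xy.
Qed.

Lemma approximated_feasible : feasible q.
Proof.
split => // [|i k pb].
  apply/matrixP => i k; rewrite mxE; apply: eq_small => s s0.
  have s20 : 0 < s / 2 by rewrite divr_gt0.
  have [h [q' [_ [q'T _ _] q'q _ _]]] := Fq s20.
  have q'ki : q' k i = q' i k by rewrite -[in LHS]q'T mxE.
  have := q'q k i; have := q'q i k; rewrite q'ki => q1 q2.
  have -> : q k i - q i k = (q' i k - q i k) - (q' i k - q k i) by ring.
  apply: (le_trans (ler_normB _ _)); rewrite [leRHS]splitr.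
  by apply: lerD; exact: ltW.
apply: eq_small => s s0; have [h [q' [_ [_ _ q'b] q'q _ _]]] := Fq s0.
by rewrite -(q'b i k pb) distrC; exact: ltW.
Qed.

Let bk (r : 'M[R]_m) : bmeas (block_kernel beta r).
Proof. exact: bmeas_block_kernel. Qed.

Lemma block_kernel_dist (q' : 'M[R]_m) (s : R) : (forall i k, `|q' i k - q i k| < s) ->
  \int[PP]_z `|block_kernel beta q' z - block_kernel beta q z| <= s.
Proof.
move=> qq'; rewrite -[leRHS](expect_cst PP); apply: (le_expect PP) => [||z].
- by apply: bmeas_norm; exact: bmeasB.
- exact: bmeas_cst.
- by apply/ltW; exact: qq'.
Qed.

Variable g : graphon R.
Hypothesis gE : forall z, g z = block_kernel beta q z.

Lemma approximated_density : tau F <= hom_density H g.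
Proof.
have K0 : 0 <= K by exact: ler0n.
apply/ler_addgt0Pr => e e0; pose s := e / (2 * K + 1).
have K2 : 0 < 2 * K + 1 by rewrite ltr_wpDl// mulr_ge0.
have s0 : 0 < s by rewrite divr_gt0.
have [h [q' [_ [q'T q'01 _] q'q dq' _]]] := Fq s0.
have [g' g'E] := exists_block_graphon mbeta q'T q'01.
have dg' : hom_density H g' = density q' by exact: (hom_density_block mbeta g'E q'01).
have bg' : bmeas (zext g') by apply: bmeas_zext; exact: graphon_b.
have dist : delta g' g <= s.
  apply: (le_trans (delta_block_graphon mbeta gE g')).
  apply: le_trans (block_kernel_dist q'q); rewrite le_eqVlt; apply/orP; left; apply/eqP.
  apply: eq_expect_unitI2 => [||z Iz]; last by rewrite zextE// g'E.
    by apply: bmeas_norm; exact: bmeasB.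
  by apply: bmeas_norm; exact: bmeasB.
have := hom_density_delta H g' g; rewrite dg' -/K.
have : K * delta g' g <= K * s by exact: ler_wpM2l.
have : 2 * K * s <= e.
  by rewrite /s mulrCA ler_piMr ?ltW// ltr_pdivrMr// mul1r ltrDl.
lra.
Qed.

(** By lower semicontinuity the rate of q itself, in place of that of the nearby
    q', together with the gain is at most j, up to an arbitrarily small error. *)
Lemma approximated_close (s : R) : 0 < s -> exists (h : graphon R) (q' : 'M[R]_m),
  [/\ delta_class F h <= s, forall i k, `|q' i k - q i k| < s &
    2^-1 * klq q + 8^-1 * \int[PP]_z (zext h z - block_kernel beta q' z) ^+ 2 <= j + 2 * s].
Proof.
move=> s0; have [del del0 Hdel] := kl_integral_lsc approximated_feasible s0.
pose r := Num.min del s.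
have r0 : 0 < r by rewrite lt_min del0.
have rdel : r <= del by rewrite ge_min lexx.
have rs : r <= s by rewrite ge_min lexx orbT.
have [h [q' [dh fq' q'q _ kq']]] := Fq r0.
exists h, q'; split; first exact: le_trans rs.
  by move=> i k; exact: lt_le_trans (q'q i k) rs.
have kn : klq q - s <= klq q'.
  by apply: Hdel => // i k; exact: lt_le_trans (q'q i k) rdel.
lra.
Qed.

Lemma approximated_rate : 2^-1 * klq q <= j.
Proof.
apply/ler_addgt0Pr => e e0; have s0 : 0 < e / 2 by rewrite divr_gt0.
have [h [q' [_ _ kq]]] := approximated_close s0.
have sq0 : 0 <= \int[PP]_z (zext h z - block_kernel beta q' z) ^+ 2.
  by apply: expect_ge0 => z; exact: sqr_ge0.
rewrite (_ : e = 2 * (e / 2)); last by rewrite mulrC divfK.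
by apply: le_trans kq; rewrite lerDl mulr_ge0// invr_ge0.
Qed.

(** If the rate of q is at least j, the gain tends to 0, and with it the L^1
    distance between the graphons h and their symmetrizations. *)
Lemma approximated_class : j <= 2^-1 * klq q -> delta_class F g = 0.
Proof.
move=> jq.
have key s : 0 < s -> s < 1 -> delta_class F g <= 19 * s.
  move=> s0 s1; have s20 : 0 < s ^+ 2 by exact: exprn_gt0.
  have ss : s ^+ 2 <= s by rewrite expr2 ler_piMr ?ltW.
  have [h [q' [dh q'q kq]]] := approximated_close s20.
  set I2 := \int[PP]_z (zext h z - block_kernel beta q' z) ^+ 2 in kq.
  have I2s : I2 <= 16 * s ^+ 2 by move: kq; lra.
  have bh : bmeas (zext h) by apply: bmeas_zext; exact: graphon_b.
  have L1 : \int[PP]_z `|zext h z - block_kernel beta q' z| <= 17 * s.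
    apply: (le_trans (L1_le_L2 (bmeasB bh (bk _)) s0)).
    have -> : 17 * s = s + s^-1 * (16 * s ^+ 2) by field; rewrite gt_eqF.
    by rewrite lerD2l ler_pM2l ?invr_gt0.
  have dhg : delta h g <= 17 * s + s ^+ 2.
    apply: (le_trans (delta_block_graphon mbeta gE h)).
    apply: le_trans (lerD L1 (block_kernel_dist q'q)); rewrite -(expectD PP); last 2 first.
    - by apply: bmeas_norm; exact: bmeasB.
    - by apply: bmeas_norm; exact: bmeasB.
    apply: (le_expect PP) => [||z].
    - by apply: bmeas_norm; exact: bmeasB.
    - by apply: bmeasD; apply: bmeas_norm; exact: bmeasB.
    - exact: ler_distD.
  apply: (le_trans (delta_triangle (repr F) h g)).
  apply: (le_trans (lerD dh dhg)).
  rewrite (_ : 19 * s = s + (17 * s + s)); last by ring.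
  by rewrite lerD// lerD2l.
apply/le_anti; rewrite [X in _ && X]delta_ge0 andbT.
apply/ler_addgt0Pr => e e0; rewrite add0r.
pose s := Num.min (e / 19) (2^-1).
have s0 : 0 < s by rewrite lt_min invr_gt0 divr_gt0/=.
have s1 : s < 1 by rewrite gt_min; apply/orP; right; rewrite invf_lt1// ltr1n.
apply: (le_trans (key _ s0 s1)).
by rewrite mulrC -ler_pdivlMr// ge_min lexx.
Qed.

End approximated_theory.

(** The matrix q comes from [exists_approximated], applied with the rate of F as
    j.  Its density is at least t, so its rate is at least that of F because F
    is a minimizer, and [approximated_class] identifies F with its class. *)
Lemma minimizer_block (t : R) F : density (top_block p) - eta < t ->
  t <= density (top_block p) -> minimizer W0 tau t F ->
  exists (q : 'M[R]_m) (g : graphon R), feasible q /\ [/\ forall z, g z = block_kernel beta q z,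
    to_class g = F, rate_class W0 F = rate W0 g, t <= hom_density H g &
    forall g' : graphon R, t <= hom_density H g' -> (rate W0 g <= rate W0 g')%E].
Proof.
move=> eta_t t_top [tF minF].
have le_rate g : t <= hom_density H g -> (rate_class W0 F <= rate W0 g)%E.
  move=> tg; have [rfin|?] := ltP (rate W0 g) +oo%E; last by apply: le_trans (leey _) _.
  have gO := rate_graphon_Omega mbeta p01 W0E rfin.
  apply: le_trans (rate_class_le gO); apply: minF.
  by rewrite /tau hom_density_repr.
have [gt gtO [gtd _]] := exists_top_graphon.
have Jfin : (rate_class W0 F < +oo)%E.
  apply: (le_lt_trans (le_rate gt _)); first by rewrite gtd.
  by rewrite (rate_kl_integral mbeta p01 W0E gtO) ltry.
have FO : class_Omega W0 F.
  by apply: contrapT => nFO; move: Jfin; rewrite /rate_class asboolF// ltxx.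
have J0 : (0 <= rate_class W0 F)%E.
  rewrite /rate_class asboolT//.
  apply: (@le_trans _ _ (ereal_inf [set rate W0 h | h in [set h | delta_class F h <= 1]])).
    by apply: le_ereal_inf_tmp => _ [h _ <-]; exact: (rate_ge0 p01 W0E).
  by apply: ereal_sup_ubound; exists 1 => //=; exact: ltr01.
have [j Jj] : exists j, rate_class W0 F = j%:E.
  by exists (fine (rate_class W0 F)); rewrite fineK// ge0_fin_numE.
have [|q q01 Fq] := @exists_approximated F j FO _ (lt_le_trans eta_t tF).
  by rewrite Jj.
have fq := approximated_feasible q01 Fq; have [qT _ qb] := fq.
have [g gE] := exists_block_graphon mbeta qT q01.
have gO : graphon_Omega W0 g by exact: (graphon_Omega_block W0E gE).
have rg : rate W0 g = (2^-1 * klq q)%:E.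
  rewrite (rate_kl_integral mbeta p01 W0E gO).
  by rewrite (kl_integral_block_graphon mbeta p01 gE q01).
have tg : t <= hom_density H g := le_trans tF (approximated_density Fq gE).
have jq : j <= 2^-1 * klq q by have := le_rate g tg; rewrite Jj rg lee_fin.
have rFg : rate_class W0 F = rate W0 g.
  by rewrite Jj rg; congr EFin; apply/le_anti; rewrite jq (approximated_rate q01 Fq).
exists q, g; split => //; split => //.
  rewrite -[F]reprK; apply/to_classP; rewrite delta_sym.
  exact: (approximated_class q01 Fq gE jq).
by move=> g' tg'; rewrite -rFg; exact: le_rate.
Qed.

End minimizers.

End assembly.

Lemma hom_density_edgeless (R : realType) v (H : simple_graph v) (f : graphon R) :
  (forall e, ~~ edge H e) -> hom_density H f = 1.
Proof.
move=> H0; rewrite hom_densityE -[RHS](iexp_cst unif v); apply: eq_iexp => x.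
by apply: big_pred0 => e; exact/negbTE.
Qed.

Theorem theorem1p20 (R : realType) (m : nat) (gamma : 'I_m -> rat)
    (W0 : graphon R) (v d : nat) (H : simple_graph v) :
  (0 < m)%N -> rat_simplex gamma -> block_graphon_star gamma W0 ->
  regular H d ->
  let tau := @hom_density_class R v H in
  let tmax := t_max W0 tau in
  hom_density H W0 < tmax ->
  exists eta : R, 0 < eta /\
    forall t : R, (1 - eta) * tmax < t -> t <= tmax ->
      symmetric_regime gamma W0 tau t /\
      forall F : graphon_class R, minimizer W0 tau t F ->
        exists h : graphon R,
          [/\ to_class h = F,
              block_graphon gamma h,
              rate_class W0 F = rate W0 h &
              is_minimum
                [set rate W0 g | g in [set g | block_graphon gamma g /\
                                               t <= hom_density H g]]
                (rate W0 h)].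
Proof.
move=> m_gt0 gammaP [[p [psym p01 W0p]] _] Hreg tau tmax W0_lt.
have [beta [betaI betaE mbeta]] := exists_block_map (R := R) m_gt0 gammaP.
have W0E z : unitI2 z -> W0 z = block_kernel beta p z.
  by case: z => x y [/= Ix Iy]; apply: W0p; exact: betaI.
have d_gt0 : (0 < d)%N.
  rewrite lt0n; apply/eqP => d0; rewrite d0 in Hreg.
  have noedge e : ~~ edge H e.
    apply/negP => He; have /card0_eq/(_ e) := edge_degree Hreg e.1.
    by rewrite inE He eqxx.
  have : tmax <= 1.
    apply: ge_sup.
      exists (tau (to_class W0)), (to_class W0) => //.
      by apply: class_Omega_to_class; exact: aeW.
    by move=> _ [F _ <-]; rewrite /tau /hom_density_class hom_density_edgeless.
  by rewrite leNgt -(hom_density_edgeless W0 noedge) W0_lt.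
have tmaxE : tmax = block_density unif (edge H) beta (top_block p).
  exact: (t_maxE mbeta p01 psym W0E d_gt0 Hreg).
have tmax0 : 0 < tmax.
  apply: le_lt_trans W0_lt; rewrite hom_densityE; apply: iexp_ge0 => x.
  apply: prodr_ge0 => e _; by have /andP[] := zext01 (tnth x e.1, tnth x e.2) (graphon_b W0).
have [eta0 eta00 gain] := symmetrization_gain unif (@edge_lt _ H) mbeta d_gt0
  (edge_degree Hreg) p01.
(* with this choice (1 - eta) * tmax = tmax - eta0 *)
exists (eta0 / tmax); split; first exact: divr_gt0.
move=> t; rewrite mulrBl mul1r divfK ?gt_eqF// => lo hi.
have main F : minimizer W0 tau t F -> exists h : graphon R,
    [/\ to_class h = F, block_graphon gamma h, rate_class W0 F = rate W0 h &
      is_minimum [set rate W0 g | g in [set g | block_graphon gamma g /\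
        t <= hom_density H g]] (rate W0 h)].
  move=> minF; rewrite tmaxE in lo hi.
  have [q [g [[qsym q01 _] [gE gF rFg tg gmin]]]] :=
    minimizer_block mbeta p01 psym W0E d_gt0 gain lo hi minF.
  have bg : block_graphon gamma g.
    exists q; split => // i j x y bi bj.
    by rewrite gE /block_kernel/= (betaE i)// (betaE j).
  exists g; split => //; split; first by exists g.
  by move=> _ [g' [_ tg'] <-]; exact: gmin.
split; last exact: main.
split => // F /main[h [hF bh _ _]]; exists h => //.
by rewrite -hF delta_classE delta_refl.
Qed.
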